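(* Let $n\in\mathbb{N}_0$, let $a,b\in\mathbb{R}$ with $b\neq0$, and let $I\subset\mathbb{R}$ be an open interval on which $a+bq>0$. Then, as indefinite integrals in $q$ on $I$ (up to an additive constant), $$\int q^{n}\,\psi(a+bq)\,dq=n!\sum_{j=0}^{n}\frac{(-1)^j}{b^{j+1}(n-j)!}\,q^{n-j}\,\psi^{(-j-1)}(a+bq),$$ that is, the right-hand side is an antiderivative on $I$ of $q^n\psi(a+bq)$.
   Context: $\mathbb{N}=\{1,2,\dots\}$, $\mathbb{N}_0=\{0,1,2,\dots\}$. $\psi(q)=\frac{d}{dq}\ln\Gamma(q)$ is the digamma function. For $k\in\mathbb{N}$ and $q>0$ the balanced negapolygamma function is $$\psi^{(-k)}(q)=\frac{1}{k!}\left[A_k(q)-H_{k-1}B_k(q)\right],\qquad A_k(q)=k\,\frac{\partial}{\partial z}\zeta(z,q)\Big|_{z=1-k},$$ where $\zeta(z,q)$ is the Hurwitz zeta function ($\zeta(z,q)=\sum_{n\ge0}(n+q)^{-z}$ for $\operatorname{Re}z>1$, analytically continued in $z$ to $\mathbb{C}\setminus\{1\}$), $B_k(q)$ is the $k$-th Bernoulli polynomial, given by $\frac{te^{qt}}{e^t-1}=\sum_{k\ge0}B_k(q)\frac{t^k}{k!}$, and $H_r=\sum_{i=1}^r 1/i$ is the harmonic number ($H_0=0$). *)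

(* Defs.v *)
From Stdlib Require Import Reals Factorial ClassicalEpsilon.
From Coquelicot Require Import Coquelicot.

Open Scope R_scope.

Definition Gamma (x : R) : R :=
  RInt_gen (fun t => Rpower t (x - 1) * exp (- t))
    (at_right 0) (Rbar_locally p_infty).

Definition digamma (q : R) : R := Derive (fun x => ln (Gamma x)) q.

(** [x ^ w] for a real base [x > 0] and a complex exponent [w]: this is
    [exp (w * ln x)], split into its real and imaginary parts. *)
Definition Rpower_C (x : R) (w : C) : C :=
  (exp (Re w * ln x) * cos (Im w * ln x),
   exp (Re w * ln x) * sin (Im w * ln x)).

Definition analytic_at (f : C -> C) (z0 : C) : Prop :=
  exists (c : nat -> C) (r : R), 0 < r /\
    forall z : C, Cmod (z - z0) < r ->
      is_pseries (K := C_AbsRing) (V := C_NormedModule) c (z - z0)%C (f z).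

Definition is_hurwitz_zeta (q : R) (f : C -> C) : Prop :=
  (forall z : C, z <> RtoC 1 -> analytic_at f z) /\
  (forall z : C, 1 < Re z ->
     is_series (K := C_AbsRing) (V := C_NormedModule)
       (fun n : nat => Rpower_C (INR n + q) (- z)%C) (f z)).

(** For [q > 0] the analytic continuation exists and is unique on [C \ {1}];
    the value at the pole [z = 1], and everything for [q <= 0], is
    unspecified. *)
Definition hurwitz_zeta (z : C) (q : R) : C :=
  epsilon (inhabits (fun _ : C => RtoC 0)) (is_hurwitz_zeta q) z.

(** The generating function has a removable singularity at [t = 0], hence the
    expansion is required on a punctured neighbourhood of [0]; this determines
    the whole sequence [B]. *)
Definition is_bernoulli_seq (q : R) (B : nat -> R) : Prop :=
  exists r : R, 0 < r /\
    forall t : R, 0 < Rabs t < r ->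
      is_pseries (fun k : nat => B k / INR (fact k)) t
        (t * exp (q * t) / (exp t - 1)).

Definition bernoulli_poly (k : nat) (q : R) : R :=
  epsilon (inhabits (fun _ : nat => 0)) (is_bernoulli_seq q) k.

Definition harmonic (r : nat) : R := sum_n_m (fun i : nat => / INR i) 1 r.

(** The derivative of [zeta] is the complex one; its value at the real point
    [1 - k] is real, since [zeta] is real on the real axis, and [Re] only
    changes its type. *)
Definition A_fun (k : nat) (q : R) : R :=
  INR k * Re (C_derive (fun z : C => hurwitz_zeta z q) (RtoC (1 - INR k))).

(** [negapolygamma k] is [psi^(-k)]; only meaningful for [k >= 1]. *)
Definition negapolygamma (k : nat) (q : R) : R :=
  / INR (fact k) * (A_fun k q - harmonic (k - 1) * bernoulli_poly k q).

(* Main.v *)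
Require Import Defs.
From Stdlib Require Import Reals Factorial.
From Stdlib Require Import Arith Lra Lia Classical ClassicalEpsilon.
From Coquelicot Require Import Coquelicot.

Open Scope R_scope.

(** Write [E (z, q) = (z - 1) zeta (z, q)], an entire function of [z].  Since
    [zeta (z, q)] has derivative [- z zeta (z + 1, q)] in [q] and mean
    [q^(1-z) / (z - 1)] over [[q, q + 1]], integration by parts gives
    [E (z, q) = q^(1-z) + (z - 1) int_q^(q+1) (q + 1 - t) E (z + 1, t) dt],
    which continues [E] from a half-plane one strip at a time.  The recursion is
    run on all Taylor coefficients in [z] at once, so that analyticity and
    [q]-derivatives come out together; the continuation is unique by the
    identity theorem along a segment avoiding [z = 1].

    At [z = 1 - k] the value of [E] is the Bernoulli polynomial [B_k]: these
    values form an Appell sequence with [B_k (q + 1) - B_k (q) = k q^(k-1)],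
    which determines the generating function.  The [z]-derivative [E_k'] of [E]
    there satisfies [d/dq E_k' = k E_(k-1)' - B_(k-1)], hence
    [psi^(-k) = (- E_k' - H_k B_k) / k!] has derivative [psi^(-(k-1))] for all
    [k >= 1], with [psi^(0) = - E_0'].  That this is the digamma function is the
    Bohr-Mollerup theorem applied to [psi^(-1)].  The claim is then [n]-fold
    integration by parts. *)

(** * Complex power series and the identity theorem *)

(** [hurwitz_zeta] and [bernoulli_poly] are chosen by [epsilon]: existence makes each choice
    meaningful, and uniqueness identifies it with a concrete object. For the zeta function,
    existence asks for a power series at every point except 1, and the theorem asks for
    [q]-derivatives on top. The factor [z - 1] makes the unit mean an explicit power [q^(1-z)]
    without a pole, so one recursion serves every [z]. On Taylor coefficients, analyticity of an
    integral depending on [z] reduces to termwise integration under geometric bounds; multiplication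
    by [z - 1] becomes the operator [shift], and each identity in [z] is proved coefficient by
    coefficient. The [z]-derivative needed in [A_fun] is then just the coefficient of index 1, which
    obeys the same rules in [q] as the value. The Gamma integral and the continued series meet only
    through a functional equation and convexity, which is why they are compared by Bohr-Mollerup. *)

Notation Cseries := (@is_series C_AbsRing C_NormedModule).
Notation Cpseries := (@is_pseries C_AbsRing C_NormedModule).

Ltac Cring :=
  match goal with |- @eq _ ?a ?b => change (@eq C a b) end;
  repeat match goal with
    | |- context [@plus ?G ?a ?b] => change (@plus G a b) with (Cplus a b)
    | |- context [@opp ?G ?a] => change (@opp G a) with (Copp a)
    end; ring.

Ltac Rring :=
  match goal with |- @eq _ ?a ?b => change (@eq R a b) end; ring.

Lemma R_ball (x e y : R) : ball x e y -> Rabs (y - x) < e.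
Proof. exact (fun H => H). Qed.

Lemma Cseries_eps (a : nat -> C) (l : C) :
  Cseries a l <->
  forall eps : R, 0 < eps ->
    exists N : nat, forall n : nat, (N <= n)%nat -> Cmod (sum_n a n - l) < eps.
Proof.
  unfold is_series. split.
  - intros H eps He.
    specialize (H (ball_norm (V := C_NormedModule) l (mkposreal eps He))).
    destruct H as [N HN].
    { apply locally_ball_norm. }
    exists N. intros n Hn. exact (HN n Hn).
  - intros H P HP.
    apply (locally_norm_le_locally (V := C_NormedModule)) in HP.
    destruct HP as [eps HP].
    destruct (H eps (cond_pos eps)) as [N HN].
    exists N. intros n Hn. apply HP. exact (HN n Hn).
Qed.

Lemma Cpseries_series (c : nat -> C) (w l : C) :
  Cpseries c w l <-> Cseries (fun k => (w ^ k * c k)%C) l.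
Proof.
  assert (E : forall k, pow_n (K := C_AbsRing) w k = (w ^ k)%C).
  { induction k as [|k IH]; simpl; [reflexivity|].
    rewrite IH. reflexivity. }
  unfold is_pseries.
  split; apply is_series_ext; intro k; rewrite <- (E k); reflexivity.
Qed.

(** Finite blocks of [a] are dominated by the same blocks of [u]. An excess [d] between the tails
    would survive at a common large index [n], where both partial sums are within [d / 2] of their
    limits. *)
Lemma Cseries_tail (a : nat -> C) (u : nat -> R) (l : C) (U : R) (K : nat) :
  (forall k, Cmod (a k) <= u k) -> is_series u U -> Cseries a l ->
  Cmod (l - sum_n a K) <= U - sum_n u K.
Proof.
  intros H Hu Ha.
  apply Rnot_lt_le. intros Hlt.
  set (d := Cmod (l - sum_n a K) - (U - sum_n u K)).
  assert (Hd : 0 < d) by (unfold d; lra).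
  destruct (proj1 (Cseries_eps a l) Ha (d / 2)) as [N1 HN1]; [lra|].
  apply is_series_Reals in Hu. destruct (Hu (d / 2)) as [N2 HN2]; [lra|].
  set (n := (N1 + N2 + K + 1)%nat).
  specialize (HN1 n ltac:(unfold n; lia)). specialize (HN2 n ltac:(unfold n; lia)).
  unfold Rdist in HN2. rewrite <- sum_n_Reals in HN2.
  apply Rabs_def2 in HN2.
  assert (M : forall m, Cmod (sum_n a (K + m) - sum_n a K) <= sum_n u (K + m) - sum_n u K).
  { induction m as [|m IH].
    - rewrite Nat.add_0_r. replace (sum_n a K - sum_n a K)%C with (RtoC 0) by ring.
      rewrite Cmod_0. lra.
    - rewrite Nat.add_succ_r, !sum_Sn.
      replace (plus (sum_n a (K + m)) (a (S (K + m))) - sum_n a K)%C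
        with ((sum_n a (K + m) - sum_n a K) + a (S (K + m)))%C
        by (unfold plus; simpl; ring).
      eapply Rle_trans; [apply Cmod_triangle|].
      unfold plus at 1; simpl. specialize (H (S (K + m))). lra. }
  specialize (M (N1 + N2 + 1)%nat).
  replace (K + (N1 + N2 + 1))%nat with n in M by (unfold n; lia).
  assert (T : Cmod (l - sum_n a K) <= Cmod (sum_n a n - l) + Cmod (sum_n a n - sum_n a K)).
  { replace (l - sum_n a K)%C with (- (sum_n a n - l) + (sum_n a n - sum_n a K))%C by ring.
    eapply Rle_trans; [apply Cmod_triangle|]. rewrite Cmod_opp. lra. }
  unfold d in *. lra.
Qed.

Lemma Cseries_norm_le (a : nat -> C) (u : nat -> R) (l : C) (U : R) :
  (forall k, Cmod (a k) <= u k) -> is_series u U -> Cseries a l -> Cmod l <= U.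
Proof.
  intros H Hu Ha.
  assert (T := Cseries_tail a u l U 0 H Hu Ha).
  rewrite !sum_O in T. specialize (H 0%nat).
  replace l with (l - a 0%nat + a 0%nat)%C by ring.
  eapply Rle_trans; [apply Cmod_triangle|]. lra.
Qed.

Lemma Cseries_dominated (a : nat -> C) (u : nat -> R) :
  (forall k, Cmod (a k) <= u k) -> ex_series u -> exists l : C, Cseries a l.
Proof.
  intros H Hu.
  apply (ex_series_le (K := C_AbsRing) (V := C_CompleteNormedModule) a u); assumption.
Qed.

Lemma geom_sum_closed (x : R) (n : nat) :
  x <> 1 -> sum_n (fun k => x ^ k) n = (1 - x ^ S n) / (1 - x).
Proof.
  intros Hx. rewrite sum_n_Reals, tech3 by assumption. reflexivity.
Qed.

Lemma is_series_geom_scal (N x : R) :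
  0 <= x < 1 -> is_series (fun k => N * x ^ k) (N / (1 - x)).
Proof.
  intros Hx. apply (is_series_scal N (fun k => x ^ k)).
  apply is_series_geom. rewrite Rabs_pos_eq; lra.
Qed.

Lemma Cseries_geom_tail (a : nat -> C) (N x : R) (l : C) (K : nat) :
  0 <= x < 1 -> (forall k, Cmod (a k) <= N * x ^ k) -> Cseries a l ->
  Cmod (l - sum_n a K) <= N * x ^ S K / (1 - x).
Proof.
  intros Hx H Ha.
  assert (T := Cseries_tail a (fun k => N * x ^ k) l _ K H (is_series_geom_scal N x Hx) Ha).
  assert (E : sum_n (fun k => N * x ^ k) K = N * ((1 - x ^ S K) / (1 - x))).
  { rewrite <- (geom_sum_closed x K) by lra.
    apply (sum_n_scal_l N (fun k => x ^ k)). }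
  rewrite E in T. eapply Rle_trans; [exact T|]. right. field. lra.
Qed.

Lemma Cseries_unique (a : nat -> C) (l l' : C) : Cseries a l -> Cseries a l' -> l = l'.
Proof.
  intros H H'.
  apply (filterlim_locally_unique (K := C_AbsRing) (V := C_NormedModule) (F := eventually)
    (sum_n a)); assumption.
Qed.

Lemma Cpseries_coef_bounded (c : nat -> C) (w l : C) :
  Cpseries c w l -> exists N, forall k, Cmod (c k) * Cmod w ^ k <= N.
Proof.
  intros H. apply Cpseries_series in H.
  destruct (proj1 (Cseries_eps _ _) H 1 Rlt_0_1) as [N HN].
  assert (F : forall n, exists M, forall k, (k <= n)%nat -> Cmod (c k) * Cmod w ^ k <= M).
  { induction n as [|n [M HM]].
    - exists (Cmod (c 0%nat) * Cmod w ^ 0). intros k Hk.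
      replace k with 0%nat by lia. lra.
    - exists (Rmax M (Cmod (c (S n)) * Cmod w ^ S n)). intros k Hk.
      destruct (Nat.eq_dec k (S n)) as [->|Hne].
      + apply Rmax_r.
      + eapply Rle_trans; [apply HM; lia|apply Rmax_l]. }
  destruct (F N) as [M HM].
  (* Beyond [N] consecutive partial sums lie within 1 of [l], so each later term is below 2; [M]
     covers the earlier ones. *)
  exists (Rmax M 2). intros k.
  destruct (le_lt_dec k N) as [Hk|Hk].
  - eapply Rle_trans; [apply HM, Hk|apply Rmax_l].
  - eapply Rle_trans; [|apply Rmax_r].
    destruct k as [|k]; [lia|].
    assert (H1 := HN k ltac:(lia)). assert (H2 := HN (S k) ltac:(lia)).
    rewrite sum_Sn in H2.
    rewrite Rmult_comm, <- Cmod_pow, <- Cmod_mult.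
    set (t := (w ^ S k * c (S k))%C) in *.
    set (s := sum_n (fun k0 : nat => (w ^ k0 * c k0)%C) k) in *.
    change (Cmod ((s + t) - l) < 1) in H2.
    replace t with (((s + t) - l) + - (s - l))%C by ring.
    eapply Rle_trans; [apply Cmod_triangle|]. rewrite Cmod_opp.
    apply Rlt_le. replace 2 with (1 + 1) by ring.
    apply Rplus_lt_compat; assumption.
Qed.

Lemma Cpseries_term_le (c : nat -> C) (w : C) (r N : R) (k : nat) :
  0 < r -> (forall k, Cmod (c k) * r ^ k <= N) ->
  Cmod (w ^ k * c k) <= N * (Cmod w / r) ^ k.
Proof.
  intros Hr H. rewrite Cmod_mult, Cmod_pow.
  unfold Rdiv. rewrite Rpow_mult_distr, pow_inv.
  assert (P := pow_lt r k Hr).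
  apply (Rmult_le_reg_r (r ^ k)); [assumption|].
  replace (N * (Cmod w ^ k * / r ^ k) * r ^ k) with (Cmod w ^ k * N) by (field; lra).
  replace (Cmod w ^ k * Cmod (c k) * r ^ k) with (Cmod w ^ k * (Cmod (c k) * r ^ k)) by ring.
  apply Rmult_le_compat_l; [apply pow_le, Cmod_ge_0|apply H].
Qed.

Lemma Cmod_ratio (w : C) (r : R) : Cmod w < r -> 0 <= Cmod w / r < 1.
Proof.
  intros H. assert (G := Cmod_ge_0 w). split.
  - apply Rdiv_le_0_compat; lra.
  - apply Rlt_div_l; lra.
Qed.

Lemma Cpseries_ex (c : nat -> C) (w : C) (r N : R) :
  (forall k, Cmod (c k) * r ^ k <= N) -> Cmod w < r ->
  exists l, Cpseries c w l.
Proof.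
  intros H Hw.
  destruct (Cseries_dominated (fun k => (w ^ k * c k)%C) (fun k => N * (Cmod w / r) ^ k))
    as [l Hl].
  - intro k. apply Cpseries_term_le; [|exact H].
    assert (G := Cmod_ge_0 w). lra.
  - eexists. apply is_series_geom_scal, Cmod_ratio, Hw.
  - exists l. apply Cpseries_series. exact Hl.
Qed.

Lemma Cpseries_remainder (c : nat -> C) (w l : C) (r N : R) (K : nat) :
  (forall k, Cmod (c k) * r ^ k <= N) -> Cmod w < r -> Cpseries c w l ->
  Cmod (l - sum_n (fun k => w ^ k * c k)%C K) <=
    N * (Cmod w / r) ^ S K / (1 - Cmod w / r).
Proof.
  intros H Hw Hl. apply Cseries_geom_tail.
  - apply Cmod_ratio, Hw.
  - intro k. apply Cpseries_term_le; [|exact H].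
    assert (G := Cmod_ge_0 w). lra.
  - apply Cpseries_series, Hl.
Qed.

(** Within half the radius the denominator [1 - Cmod w / r] is at least [1 / 2], whence the constant
    2. *)
Lemma Cpseries_remainder_half (c : nat -> C) (w l : C) (r N : R) (K : nat) :
  (forall k, Cmod (c k) * r ^ k <= N) -> 0 < r -> Cmod w <= r / 2 -> Cpseries c w l ->
  Cmod (l - sum_n (fun k => w ^ k * c k)%C K) <= 2 * N * (Cmod w / r) ^ S K.
Proof.
  intros H Hr Hw Hl.
  eapply Rle_trans; [apply (Cpseries_remainder c w l r N K H); [lra|exact Hl]|].
  assert (HN : 0 <= N).
  { eapply Rle_trans; [|apply (H 0%nat)]. simpl. rewrite Rmult_1_r. apply Cmod_ge_0. }
  assert (Hx : 0 <= Cmod w / r <= 1 / 2).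
  { split; [apply Rdiv_le_0_compat; [apply Cmod_ge_0|exact Hr]|].
    apply Rle_div_l; lra. }
  set (x := Cmod w / r) in *.
  assert (P : 0 <= N * x ^ S K) by (apply Rmult_le_pos; [exact HN|apply pow_le; lra]).
  apply Rle_div_l; [lra|]. nra.
Qed.

(** A power series vanishing at points accumulating at its centre is zero:
    its constant term is a limit of zeros, and one may then divide by [w]. *)
Lemma Cpseries_isolated_zeros (k : nat) : forall (c : nat -> C) (r N : R),
  0 < r -> (forall i, Cmod (c i) * r ^ i <= N) ->
  (forall eps, 0 < eps -> exists w, 0 < Cmod w < eps /\ Cpseries c w (RtoC 0)) ->
  c k = RtoC 0.
Proof.
  assert (Base : forall (c : nat -> C) (r N : R), 0 < r ->
    (forall i, Cmod (c i) * r ^ i <= N) ->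
    (forall eps, 0 < eps -> exists w, 0 < Cmod w < eps /\ Cpseries c w (RtoC 0)) ->
    c 0%nat = RtoC 0).
  { intros c r N Hr H Hz. apply Cmod_eq_0.
    apply Rle_antisym; [|apply Cmod_ge_0].
    apply Rnot_lt_le. intros Hlt.
    assert (HN : 0 <= N).
    { eapply Rle_trans; [|apply (H 0%nat)]. simpl. rewrite Rmult_1_r. apply Cmod_ge_0. }
    set (m := Cmod (c 0%nat)) in *.
    (* If the series has value 0 at [w], the remainder after the constant term has modulus [m], yet
       it is at most [2 N Cmod w / r]. This radius makes that bound smaller than [m]; the [+ 1]
       covers [N = 0]. *)
    assert (He : 0 < Rmin (r / 2) (m * r / (2 * N + 1))).
    { apply Rmin_pos; [lra|]. apply Rdiv_lt_0_compat; nra. }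
    destruct (Hz _ He) as [w [[Hw0 Hw] Hl]].
    assert (R1 := Rmin_l (r / 2) (m * r / (2 * N + 1))).
    assert (R2 := Rmin_r (r / 2) (m * r / (2 * N + 1))).
    assert (T := Cpseries_remainder_half c w _ r N 0 H Hr ltac:(lra) Hl).
    rewrite sum_O in T. simpl Cpow in T.
    replace (RtoC 0 - 1 * c 0%nat)%C with (- c 0%nat)%C in T by ring.
    rewrite Cmod_opp in T. fold m in T.
    simpl in T. rewrite Rmult_1_r in T.
    assert (Hx : Cmod w / r * (2 * N + 1) < m).
    { assert (Q : Cmod w < m * r / (2 * N + 1)) by lra.
      apply (Rmult_lt_compat_r ((2 * N + 1) / r)) in Q.
      - replace (m * r / (2 * N + 1) * ((2 * N + 1) / r)) with m in Q by (field; lra).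
        replace (Cmod w * ((2 * N + 1) / r)) with (Cmod w / r * (2 * N + 1)) in Q by (field; lra).
        exact Q.
      - apply Rdiv_lt_0_compat; lra. }
    assert (0 <= Cmod w / r) by (apply Rdiv_le_0_compat; lra).
    nra. }
  induction k as [|k IH]; intros c r N Hr H Hz; [eapply Base; eassumption|].
  assert (C0 := Base c r N Hr H Hz).
  apply (IH (fun i => c (S i)) r (N / r) Hr).
  - intro i. apply (Rmult_le_reg_r r); [exact Hr|].
    specialize (H (S i)). simpl in H.
    replace (N / r * r) with N by (field; lra). lra.
  - intros eps He. destruct (Hz eps He) as [w [Hw Hl]].
    exists w. split; [exact Hw|].
    assert (Hwn : w <> RtoC 0) by (intros ->; rewrite Cmod_0 in Hw; lra).
    assert (D := is_pseries_decr_1 (K := C_AbsRing) (V := C_NormedModule) c w (/ w)%C (RtoC 0)).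
    assert (E : mult (K := C_AbsRing) (/ w)%C w = one).
    { change (/ w * w = RtoC 1)%C. field. exact Hwn. }
    specialize (D E Hl).
    match type of D with Cpseries _ _ ?v => assert (Ev : v = RtoC 0) end.
    { rewrite C0. change (/ w * (RtoC 0 + - RtoC 0) = RtoC 0)%C. ring. }
    rewrite Ev in D. exact D.
Qed.

(** Convergence at the single point [z0 + r / 2] already bounds all terms there. *)
Lemma Cpseries_half_bound (c : nat -> C) (f : C -> C) (z0 : C) (r : R) :
  0 < r -> (forall z, Cmod (z - z0) < r -> Cpseries c (z - z0)%C (f z)) ->
  exists N, forall k, Cmod (c k) * (r / 2) ^ k <= N.
Proof.
  intros Hr H.
  assert (E : (z0 + RtoC (r / 2) - z0)%C = RtoC (r / 2)) by ring.
  specialize (H (z0 + RtoC (r / 2))%C). rewrite E in H.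
  rewrite Cmod_R, Rabs_pos_eq in H by lra.
  destruct (Cpseries_coef_bounded _ _ _ (H ltac:(lra))) as [N HN].
  exists N. intro k. specialize (HN k). rewrite Cmod_R, Rabs_pos_eq in HN by lra. exact HN.
Qed.

Lemma analytic_minus (f g : C -> C) (z : C) :
  analytic_at f z -> analytic_at g z -> analytic_at (fun x => f x - g x)%C z.
Proof.
  intros [c [r [Hr Hc]]] [d [s [Hs Hd]]].
  exists (PS_minus (K := C_AbsRing) (V := C_NormedModule) c d), (Rmin r s).
  split; [apply Rmin_pos; assumption|].
  intros x Hx.
  assert (M1 := Rmin_l r s). assert (M2 := Rmin_r r s).
  exact (is_pseries_minus (K := C_AbsRing) (V := C_NormedModule) c d (x - z)%C _ _
    (Hc x ltac:(lra)) (Hd x ltac:(lra))).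
Qed.

Definition vanishes_near (h : C -> C) (z0 : C) : Prop :=
  exists r, 0 < r /\ forall z, Cmod (z - z0) < r -> h z = RtoC 0.

Lemma analytic_vanishes_near (h : C -> C) (z0 : C) :
  analytic_at h z0 ->
  (forall eps, 0 < eps -> exists z, 0 < Cmod (z - z0) < eps /\ h z = RtoC 0) ->
  vanishes_near h z0.
Proof.
  intros [c [r [Hr Hc]]] Hz.
  destruct (Cpseries_half_bound c h z0 r Hr Hc) as [N HN].
  assert (C0 : forall k, c k = RtoC 0).
  { intro k. apply (Cpseries_isolated_zeros k c (r / 2) N); [lra|exact HN|].
    intros eps He.
    assert (Hm : 0 < Rmin eps r) by (apply Rmin_pos; assumption).
    destruct (Hz _ Hm) as [z [Hz1 Hz2]].
    assert (M1 := Rmin_l eps r). assert (M2 := Rmin_r eps r).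
    exists (z - z0)%C. split; [lra|]. rewrite <- Hz2. apply Hc. lra. }
  exists r. split; [exact Hr|]. intros z Hzr.
  specialize (Hc z Hzr). apply Cpseries_series in Hc.
  eapply Cseries_unique; [exact Hc|].
  apply Cseries_eps. intros eps He. exists 0%nat. intros n _.
  assert (E : sum_n (fun k : nat => ((z - z0) ^ k * c k)%C) n = RtoC 0).
  { induction n as [|n IH].
    - rewrite sum_O, C0. Cring.
    - rewrite sum_Sn, IH, C0. Cring. }
  change (Cmod (sum_n (fun k : nat => ((z - z0) ^ k * c k)%C) n - RtoC 0) < eps).
  rewrite E. replace (0 - 0)%C with (RtoC 0) by ring. rewrite Cmod_0. exact He.
Qed.

(** Connectedness of [[0, 1]], through the supremum [m] of the parameters up to which [h] vanishes:
    zeros accumulate at [g m], so [h] vanishes near [g m], and this would carry past [m] unless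
    [m = 1]. *)
Lemma vanishes_along_segment (h : C -> C) (z1 z2 : C) :
  (forall t : R, 0 <= t <= 1 -> analytic_at h (z1 + RtoC t * (z2 - z1))%C) ->
  vanishes_near h z1 -> vanishes_near h z2.
Proof.
  intros Han H1.
  destruct (Ceq_dec z1 z2) as [<-|Hne]; [exact H1|].
  set (g := fun t : R => (z1 + RtoC t * (z2 - z1))%C) in *.
  set (d := Cmod (z2 - z1)).
  assert (Hd : 0 < d).
  { apply Cmod_gt_0. intros E. apply Hne.
    replace z2 with (z2 - z1 + z1)%C by ring. rewrite E. ring. }
  assert (Hg : forall s t, Cmod (g s - g t) = Rabs (s - t) * d).
  { intros s t. unfold g.
    replace (z1 + s * (z2 - z1) - (z1 + t * (z2 - z1)))%C with (RtoC (s - t) * (z2 - z1))%C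
      by (rewrite RtoC_minus; ring).
    rewrite Cmod_mult, Cmod_R. reflexivity. }
  assert (Hopen : forall t, vanishes_near h (g t) ->
            exists e, 0 < e /\ forall s, Rabs (s - t) < e -> vanishes_near h (g s)).
  { intros t [r [Hr Hv]]. exists (r / 2 / d). split.
    - apply Rdiv_lt_0_compat; lra.
    - intros s Hs. exists (r / 2). split; [lra|]. intros z Hz. apply Hv.
      replace (z - g t)%C with ((z - g s) + (g s - g t))%C by ring.
      eapply Rle_lt_trans; [apply Cmod_triangle|]. rewrite Hg.
      apply Rlt_div_r in Hs; lra. }
  set (S := fun t => 0 <= t <= 1 /\ forall s, 0 <= s <= t -> vanishes_near h (g s)).
  assert (G0 : g 0 = z1) by (unfold g; ring).
  assert (G1 : g 1 = z2) by (unfold g; ring).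
  assert (S0 : S 0).
  { split; [lra|]. intros s Hs. replace s with 0 by lra. rewrite G0. exact H1. }
  destruct (completeness S) as [m [Hub Hlub]].
  { exists 1. intros t [Ht _]. lra. }
  { exists 0. exact S0. }
  assert (Hbelow : forall s, 0 <= s < m -> vanishes_near h (g s)).
  { intros s Hs. apply NNPP. intros Hn.
    assert (m <= s); [|lra]. apply Hlub. intros t [Ht Hv].
    apply Rnot_lt_le. intros Hst. apply Hn, Hv. lra. }
  assert (Hm0 : 0 < m).
  { rewrite <- G0 in H1. destruct (Hopen 0 H1) as [e [He Hv]].
    assert (Sx : S (Rmin (e / 2) 1)).
    { assert (M1 := Rmin_l (e / 2) 1). assert (M2 := Rmin_r (e / 2) 1).
      assert (M3 : 0 < Rmin (e / 2) 1) by (apply Rmin_pos; lra).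
      split; [lra|]. intros s Hs. apply Hv. rewrite Rabs_pos_eq; lra. }
    apply Hub in Sx.
    assert (M3 : 0 < Rmin (e / 2) 1) by (apply Rmin_pos; lra). lra. }
  assert (Hm1 : m <= 1) by (apply Hlub; intros t [Ht _]; lra).
  assert (Hm : vanishes_near h (g m)).
  { apply analytic_vanishes_near; [apply Han; lra|].
    intros eps He.
    set (x := Rmin (m / 2) (eps / 2 / d)).
    assert (X0 : 0 < x) by (apply Rmin_pos; [lra|apply Rdiv_lt_0_compat; lra]).
    assert (X1 : x <= m / 2) by apply Rmin_l.
    assert (X2 : x <= eps / 2 / d) by apply Rmin_r.
    exists (g (m - x)). split.
    - rewrite Hg. replace (m - x - m) with (- x) by ring.
      rewrite Rabs_Ropp, Rabs_pos_eq by lra.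
      apply Rle_div_r in X2; [|lra]. nra.
    - destruct (Hbelow (m - x)) as [r [Hr Hv]]; [lra|]. apply Hv.
      rewrite Hg. replace (m - x - (m - x)) with 0 by ring. rewrite Rabs_R0. lra. }
  destruct (Req_dec m 1) as [E|E]; [rewrite <- G1, <- E; exact Hm|].
  exfalso. destruct (Hopen m Hm) as [e [He Hv]].
  set (x := Rmin (e / 2) (1 - m)).
  assert (X0 : 0 < x) by (apply Rmin_pos; lra).
  assert (X1 : x <= e / 2) by apply Rmin_l.
  assert (X2 : x <= 1 - m) by apply Rmin_r.
  assert (Sx : S (m + x)).
  { split; [lra|]. intros s Hs. destruct (Rlt_le_dec s m) as [Hlt|Hge].
    - apply Hbelow. lra.
    - apply Hv. rewrite Rabs_pos_eq; lra. }
  apply Hub in Sx. lra.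
Qed.

Lemma identity_along_segment (f g : C -> C) (z1 z2 : C) (r : R) :
  (forall t : R, 0 <= t <= 1 -> analytic_at f (z1 + RtoC t * (z2 - z1))%C) ->
  (forall t : R, 0 <= t <= 1 -> analytic_at g (z1 + RtoC t * (z2 - z1))%C) ->
  0 < r -> (forall z, Cmod (z - z1) < r -> f z = g z) ->
  f z2 = g z2.
Proof.
  intros Hf Hg Hr H.
  assert (V : vanishes_near (fun x => f x - g x)%C z2).
  { apply (vanishes_along_segment _ z1).
    - intros t Ht. apply analytic_minus; auto.
    - exists r. split; [exact Hr|]. intros z Hz. rewrite (H z Hz). ring. }
  destruct V as [s [Hs V]]. specialize (V z2).
  replace (z2 - z2)%C with (RtoC 0) in V by ring. rewrite Cmod_0 in V.
  specialize (V Hs). replace (f z2) with (f z2 - g z2 + g z2)%C by ring.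
  rewrite V. ring.
Qed.

(** * Averages over a unit interval *)

Definition pos_continuous (g : R -> R) : Prop := forall x, 0 < x -> continuous g x.

Lemma pos_continuous_ex_RInt (g : R -> R) (a b : R) :
  pos_continuous g -> 0 < a -> 0 < b -> ex_RInt g a b.
Proof.
  intros H Ha Hb. apply (ex_RInt_continuous (V := R_CompleteNormedModule)).
  intros z Hz. apply H. eapply Rlt_le_trans; [|apply Hz].
  apply Rmin_glb_lt; assumption.
Qed.

Lemma is_derive_primitive (g : R -> R) (a q : R) :
  pos_continuous g -> 0 < a -> 0 < q -> is_derive (fun x => RInt g a x) q (g q).
Proof.
  intros H Ha Hq. apply (is_derive_RInt (V := R_NormedModule) g _ a).
  - exists (mkposreal q Hq). intros y Hy. apply (RInt_correct (V := R_CompleteNormedModule)).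
    apply pos_continuous_ex_RInt; try assumption.
    apply R_ball in Hy; simpl in Hy.
    apply Rabs_def2 in Hy. lra.
  - apply H, Hq.
Qed.

(** The weight is separate from the integrand so that the same facts serve [flat], which gives
    means, and [ramp q], the kernel left by integration by parts. *)
Definition unit_int (w g : R -> R) (q : R) : R := RInt (fun t => w t * g t) q (q + 1).

Lemma unit_int_ex (w g : R -> R) (q : R) :
  (forall t, continuous w t) -> pos_continuous g -> 0 < q ->
  ex_RInt (fun t => w t * g t) q (q + 1).
Proof.
  intros Hw Hg Hq. apply pos_continuous_ex_RInt; try lra.
  intros x Hx. apply (continuous_mult w g); auto.
Qed.

Lemma unit_int_lin (w f g : R -> R) (a b q : R) :
  (forall t, continuous w t) -> pos_continuous f -> pos_continuous g -> 0 < q ->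
  unit_int w (fun t => a * f t + b * g t) q = a * unit_int w f q + b * unit_int w g q.
Proof.
  intros Hw Hf Hg Hq. unfold unit_int.
  assert (Ef := unit_int_ex w f q Hw Hf Hq). assert (Eg := unit_int_ex w g q Hw Hg Hq).
  rewrite (RInt_ext _ (fun t => plus (scal a (w t * f t)) (scal b (w t * g t)))).
  - rewrite (RInt_plus (V := R_CompleteNormedModule)); [|apply (ex_RInt_scal (V := R_NormedModule)); assumption..].
    rewrite !(RInt_scal (V := R_CompleteNormedModule)) by assumption. reflexivity.
  - intros x _. unfold plus, scal; simpl. unfold mult; simpl. ring.
Qed.

Lemma unit_int_abs_le (w g : R -> R) (q N : R) :
  (forall t, continuous w t) -> pos_continuous g -> 0 < q ->
  (forall t, q <= t <= q + 1 -> Rabs (w t) <= 1) ->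
  (forall t, q <= t <= q + 1 -> Rabs (g t) <= N) ->
  Rabs (unit_int w g q) <= N.
Proof.
  intros Hw Hg Hq Bw Bg.
  assert (T := norm_RInt_le_const (V := R_NormedModule) (fun t => w t * g t) q (q + 1)
    (unit_int w g q) N).
  unfold norm in T; simpl in T. unfold abs in T; simpl in T.
  replace ((q + 1 - q) * N) with N in T by ring.
  apply T.
  - lra.
  - intros x Hx. rewrite Rabs_mult. specialize (Bw x Hx). specialize (Bg x Hx).
    assert (P := Rabs_pos (w x)). assert (P' := Rabs_pos (g x)). nra.
  - apply (RInt_correct (V := R_CompleteNormedModule)), unit_int_ex; assumption.
Qed.

Lemma unit_int_ext (w f g : R -> R) (q : R) :
  0 < q -> (forall t, 0 < t -> f t = g t) -> unit_int w f q = unit_int w g q.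
Proof.
  intros Hq H. apply RInt_ext. intros x. rewrite Rmin_left, Rmax_right by lra.
  intros Hx. rewrite H by lra. reflexivity.
Qed.

Definition flat (t : R) : R := 1.
Definition ramp (q t : R) : R := q + 1 - t.

Lemma continuous_flat (t : R) : continuous flat t.
Proof. apply continuous_const. Qed.

Lemma continuous_ramp (q t : R) : continuous (ramp q) t.
Proof.
  apply (ex_derive_continuous (ramp q)). unfold ramp. auto_derive. exact I.
Qed.

Lemma flat_int (g : R -> R) (q : R) : unit_int flat g q = RInt g q (q + 1).
Proof.
  unfold unit_int, flat. apply RInt_ext. intros. apply Rmult_1_l.
Qed.

Lemma flat_int_derive (g dg : R -> R) (q : R) :
  0 < q -> (forall x, 0 < x -> is_derive g x (dg x)) -> pos_continuous dg ->
  unit_int flat dg q = g (q + 1) - g q.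
Proof.
  intros Hq Hd Hc. rewrite flat_int. apply is_RInt_unique.
  apply (is_RInt_derive (V := R_CompleteNormedModule)).
  - intros x. rewrite Rmin_left, Rmax_right by lra. intros. apply Hd. lra.
  - intros x. rewrite Rmin_left, Rmax_right by lra. intros. apply Hc. lra.
Qed.

(** [ramp q] is 0 at [q + 1] and 1 at [q], so integration by parts leaves a boundary term only at
    [q]. *)
Lemma ramp_int_derive (g dg : R -> R) (q : R) :
  0 < q -> (forall x, 0 < x -> is_derive g x (dg x)) -> pos_continuous dg ->
  unit_int (ramp q) dg q = unit_int flat g q - g q.
Proof.
  intros Hq Hd Hc.
  assert (Hg : pos_continuous g).
  { intros x Hx. apply (ex_derive_continuous g). exists (dg x). auto. }
  rewrite flat_int.
  assert (I1 : is_RInt (fun t => minus (ramp q t * dg t) (g t)) q (q + 1) (- g q)).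
  { replace (- g q) with (minus (ramp q (q + 1) * g (q + 1)) (ramp q q * g q))
      by (unfold minus, plus, opp, ramp; simpl; ring).
    apply (is_RInt_derive (V := R_CompleteNormedModule) (fun t => ramp q t * g t)).
    - intros x. rewrite Rmin_left, Rmax_right by lra. intros Hx. unfold ramp.
      assert (D := Hd x ltac:(lra)).
      auto_derive; [exists (dg x); exact D|].
      replace (Derive (fun x : R => g x) x) with (dg x)
        by (symmetry; apply is_derive_unique, D).
      unfold minus, plus, opp; simpl. ring.
    - intros x. rewrite Rmin_left, Rmax_right by lra. intros Hx.
      apply (continuous_minus (V := R_NormedModule)).
      + apply (continuous_mult (ramp q) dg); [apply continuous_ramp|apply Hc; lra].
      + apply Hg. lra. }
  assert (I2 : is_RInt (fun t => ramp q t * dg t) q (q + 1) (unit_int (ramp q) dg q)).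
  { apply (RInt_correct (V := R_CompleteNormedModule)), unit_int_ex; auto.
    apply continuous_ramp. }
  assert (I3 : is_RInt g q (q + 1) (RInt g q (q + 1))).
  { apply (RInt_correct (V := R_CompleteNormedModule)), pos_continuous_ex_RInt; auto; lra. }
  assert (I4 := is_RInt_minus _ _ _ _ _ _ I2 I3).
  assert (E := eq_trans (eq_sym (is_RInt_unique _ _ _ _ I4)) (is_RInt_unique _ _ _ _ I1)).
  unfold minus, plus, opp in E; simpl in E. lra.
Qed.

(** The point enters both limits and the kernel. Splitting the kernel expresses the integral through
    primitives [G] of [g t] and [H] of [t g t]; on differentiation the values of [g] at [q + 1]
    cancel because the kernel vanishes there. *)
Lemma is_derive_ramp_int (g : R -> R) (q : R) :
  0 < q -> pos_continuous g ->
  is_derive (fun x => unit_int (ramp x) g x) q (unit_int flat g q - g q).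
Proof.
  intros Hq Hg.
  set (G := fun x => RInt g 1 x). set (H := fun x => RInt (fun t => t * g t) 1 x).
  assert (Hid : pos_continuous (fun t => t * g t)).
  { intros x Hx. apply (continuous_mult (fun t => t) g); [apply continuous_id|apply Hg, Hx]. }
  assert (DG : forall x, 0 < x -> is_derive G x (g x)).
  { intros x Hx. apply is_derive_primitive; auto; lra. }
  assert (DH : forall x, 0 < x -> is_derive H x (x * g x)).
  { intros x Hx. apply (is_derive_primitive (fun t => t * g t)); auto; lra. }
  assert (EG : forall x, 0 < x -> RInt g x (x + 1) = G (x + 1) - G x).
  { intros x Hx. unfold G.
    assert (E := RInt_Chasles (V := R_CompleteNormedModule) g 1 x (x + 1)
      ltac:(apply pos_continuous_ex_RInt; auto; lra) ltac:(apply pos_continuous_ex_RInt; auto; lra)).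
    unfold plus in E; simpl in E. lra. }
  assert (EH : forall x, 0 < x -> RInt (fun t => t * g t) x (x + 1) = H (x + 1) - H x).
  { intros x Hx. unfold H.
    assert (E := RInt_Chasles (V := R_CompleteNormedModule) (fun t => t * g t) 1 x (x + 1)
      ltac:(apply pos_continuous_ex_RInt; auto; lra) ltac:(apply pos_continuous_ex_RInt; auto; lra)).
    unfold plus in E; simpl in E. lra. }
  apply (is_derive_ext_loc
    (fun x => (x + 1) * (G (x + 1) - G x) - (H (x + 1) - H x))).
  - exists (mkposreal q Hq). intros y Hy.
    apply R_ball in Hy; simpl in Hy.
    apply Rabs_def2 in Hy. assert (Hy0 : 0 < y) by lra.
    rewrite <- EG, <- EH by assumption. unfold unit_int, ramp.
    rewrite (RInt_ext (fun t => (y + 1 - t) * g t) (fun t => minus (scal (y + 1) (g t)) (t * g t))).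
    + rewrite (RInt_minus (V := R_CompleteNormedModule)).
      * rewrite (RInt_scal (V := R_CompleteNormedModule)); [reflexivity|].
        apply pos_continuous_ex_RInt; auto; lra.
      * apply (ex_RInt_scal (V := R_NormedModule)), pos_continuous_ex_RInt; auto; lra.
      * apply pos_continuous_ex_RInt; auto; lra.
    + intros x _. unfold minus, plus, opp, scal; simpl. unfold mult; simpl. ring.
  - rewrite flat_int, EG by assumption.
    assert (D1 := DG q Hq). assert (D2 := DG (q + 1) ltac:(lra)).
    assert (D3 := DH q Hq). assert (D4 := DH (q + 1) ltac:(lra)).
    auto_derive.
    + repeat split; [exists (g (q + 1)); exact D2|exists (g q); exact D1|
        exists ((q + 1) * g (q + 1)); exact D4|exists (q * g q); exact D3].
    + replace (Derive (fun x : R => G x) (q + 1)) with (g (q + 1)) by (symmetry; apply is_derive_unique, D2).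
      replace (Derive (fun x : R => G x) q) with (g q) by (symmetry; apply is_derive_unique, D1).
      replace (Derive (fun x : R => H x) (q + 1)) with ((q + 1) * g (q + 1)) by (symmetry; apply is_derive_unique, D4).
      replace (Derive (fun x : R => H x) q) with (q * g q) by (symmetry; apply is_derive_unique, D3).
      ring.
Qed.

(** * Complex-valued functions of a real variable, treated componentwise *)

Definition Cderive (f : R -> C) (x : R) (l : C) : Prop :=
  is_derive (fun t => Re (f t)) x (Re l) /\ is_derive (fun t => Im (f t)) x (Im l).

Definition Cpos_continuous (f : R -> C) : Prop :=
  pos_continuous (fun t => Re (f t)) /\ pos_continuous (fun t => Im (f t)).

Lemma Cderive_pos_continuous (f df : R -> C) :
  (forall x, 0 < x -> Cderive f x (df x)) -> Cpos_continuous f.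
Proof.
  intros H. split; intros x Hx.
  - apply (ex_derive_continuous (fun t => Re (f t))). exists (Re (df x)). apply H, Hx.
  - apply (ex_derive_continuous (fun t => Im (f t))). exists (Im (df x)). apply H, Hx.
Qed.

Lemma Cpos_continuous_ext (f g : R -> C) :
  (forall t, 0 < t -> f t = g t) -> Cpos_continuous f -> Cpos_continuous g.
Proof.
  intros E [H1 H2].
  assert (L : forall x, 0 < x -> locally x (fun t => f t = g t)).
  { intros x Hx. exists (mkposreal x Hx). intros y Hy.
    apply R_ball in Hy; simpl in Hy.
    apply Rabs_def2 in Hy. apply E. lra. }
  split; intros x Hx.
  - apply (continuous_ext_loc (fun t => Re (g t)) (fun t => Re (f t)) x); [|apply H1, Hx].
    generalize (L x Hx). apply filter_imp. intros t ->. reflexivity.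
  - apply (continuous_ext_loc (fun t => Im (g t)) (fun t => Im (f t)) x); [|apply H2, Hx].
    generalize (L x Hx). apply filter_imp. intros t ->. reflexivity.
Qed.

Lemma is_derive_lin (f g : R -> R) (a b x df dg l : R) :
  is_derive f x df -> is_derive g x dg -> l = a * df + b * dg ->
  is_derive (fun t => a * f t + b * g t) x l.
Proof.
  intros Hf Hg ->.
  apply (is_derive_plus (fun t => a * f t) (fun t => b * g t) x (a * df) (b * dg)).
  - apply (is_derive_scal f x a df Hf).
  - apply (is_derive_scal g x b dg Hg).
Qed.

Lemma Cderive_plus (f g : R -> C) (x : R) (a b : C) :
  Cderive f x a -> Cderive g x b -> Cderive (fun t => f t + g t)%C x (a + b)%C.
Proof.
  intros [H1 H2] [H3 H4]. split.
  - exact (is_derive_plus (fun t => Re (f t)) (fun t => Re (g t)) x _ _ H1 H3).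
  - exact (is_derive_plus (fun t => Im (f t)) (fun t => Im (g t)) x _ _ H2 H4).
Qed.

Lemma Cderive_scal (f : R -> C) (x : R) (c a : C) :
  Cderive f x a -> Cderive (fun t => c * f t)%C x (c * a)%C.
Proof.
  intros [H1 H2]. split.
  - apply (is_derive_ext (fun t => Re c * Re (f t) + (- Im c) * Im (f t))).
    { intro t. unfold Re, Im, Cmult; simpl. ring. }
    eapply is_derive_lin; [exact H1|exact H2|]. unfold Re, Im, Cmult; simpl. ring.
  - apply (is_derive_ext (fun t => Re c * Im (f t) + Im c * Re (f t))).
    { intro t. unfold Re, Im, Cmult; simpl. ring. }
    eapply is_derive_lin; [exact H2|exact H1|]. unfold Re, Im, Cmult; simpl. ring.
Qed.

Lemma continuous_lin (f g : R -> R) (a b x : R) :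
  continuous f x -> continuous g x -> continuous (fun t => a * f t + b * g t) x.
Proof.
  intros Hf Hg.
  apply (continuous_plus (V := R_NormedModule) (fun t => a * f t) (fun t => b * g t)).
  - exact (continuous_scal_r (V := R_NormedModule) a f x Hf).
  - exact (continuous_scal_r (V := R_NormedModule) b g x Hg).
Qed.

Lemma Cpos_continuous_lin (a b : C) (f g : R -> C) :
  Cpos_continuous f -> Cpos_continuous g -> Cpos_continuous (fun t => a * f t + b * g t)%C.
Proof.
  intros [H1 H2] [H3 H4]. split; intros x Hx.
  - apply (continuous_ext (fun t => 1 * (Re a * Re (f t) + (- Im a) * Im (f t))
                              + 1 * (Re b * Re (g t) + (- Im b) * Im (g t)))).
    { intro t. unfold Re, Im, Cmult, Cplus; simpl. ring. }
    apply continuous_lin; apply continuous_lin; auto.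
  - apply (continuous_ext (fun t => 1 * (Re a * Im (f t) + Im a * Re (f t))
                              + 1 * (Re b * Im (g t) + Im b * Re (g t)))).
    { intro t. unfold Re, Im, Cmult, Cplus; simpl. ring. }
    apply continuous_lin; apply continuous_lin; auto.
Qed.

Definition Cunit_int (w : R -> R) (g : R -> C) (q : R) : C :=
  (unit_int w (fun t => Re (g t)) q, unit_int w (fun t => Im (g t)) q).

Lemma Cunit_int_lin (w : R -> R) (f g : R -> C) (a b : C) (q : R) :
  (forall t, continuous w t) -> Cpos_continuous f -> Cpos_continuous g -> 0 < q ->
  Cunit_int w (fun t => a * f t + b * g t)%C q = (a * Cunit_int w f q + b * Cunit_int w g q)%C.
Proof.
  intros Hw [F1 F2] [G1 G2] Hq. unfold Cunit_int. apply injective_projections; simpl.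
  - rewrite (unit_int_ext w _ (fun t => 1 * (Re a * Re (f t) + (- Im a) * Im (f t))
                              + 1 * (Re b * Re (g t) + (- Im b) * Im (g t))) q Hq).
    2:{ intros t _. unfold Re, Im, Cmult, Cplus; simpl. ring. }
    rewrite !unit_int_lin; auto; try (intros x Hx; apply continuous_lin; auto).
    unfold Re, Im. ring.
  - rewrite (unit_int_ext w _ (fun t => 1 * (Re a * Im (f t) + Im a * Re (f t))
                              + 1 * (Re b * Im (g t) + Im b * Re (g t))) q Hq).
    2:{ intros t _. unfold Re, Im, Cmult, Cplus; simpl. ring. }
    rewrite !unit_int_lin; auto; try (intros x Hx; apply continuous_lin; auto).
    unfold Re, Im. ring.
Qed.

Lemma Cunit_int_ext (w : R -> R) (f g : R -> C) (q : R) :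
  0 < q -> (forall t, 0 < t -> f t = g t) -> Cunit_int w f q = Cunit_int w g q.
Proof.
  intros Hq H. unfold Cunit_int.
  f_equal; apply unit_int_ext; auto; intros t Ht; rewrite H; auto.
Qed.

Lemma im_le_Cmod (c : C) : Rabs (Im c) <= Cmod c.
Proof.
  eapply Rle_trans; [apply Rmax_r|apply Rmax_Cmod].
Qed.

Lemma Cmod_le_components (c : C) (N : R) :
  Rabs (Re c) <= N -> Rabs (Im c) <= N -> Cmod c <= 2 * N.
Proof.
  intros H1 H2. replace c with (RtoC (Re c) + RtoC (Im c) * Ci)%C.
  - eapply Rle_trans; [apply Cmod_triangle|].
    rewrite Cmod_mult, Cmod_Ci, !Cmod_R. lra.
  - destruct c as [x y]. unfold Cplus, Cmult, RtoC, Ci; simpl.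
    apply injective_projections; simpl; ring.
Qed.

Lemma Cunit_int_norm_le (w : R -> R) (g : R -> C) (q N : R) :
  (forall t, continuous w t) -> Cpos_continuous g -> 0 < q ->
  (forall t, q <= t <= q + 1 -> Rabs (w t) <= 1) ->
  (forall t, q <= t <= q + 1 -> Cmod (g t) <= N) ->
  Cmod (Cunit_int w g q) <= 2 * N.
Proof.
  intros Hw [G1 G2] Hq Bw Bg. apply Cmod_le_components; apply unit_int_abs_le; auto.
  - intros t Ht. eapply Rle_trans; [apply re_le_Cmod|auto].
  - intros t Ht. eapply Rle_trans; [apply im_le_Cmod|auto].
Qed.

Lemma ramp_le_1 (q t : R) : q <= t <= q + 1 -> Rabs (ramp q t) <= 1.
Proof. intros H. unfold ramp. apply Rabs_le. lra. Qed.

Lemma Cramp_int_derive (g dg : R -> C) (q : R) :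
  0 < q -> (forall x, 0 < x -> Cderive g x (dg x)) -> Cpos_continuous dg ->
  Cunit_int (ramp q) dg q = (Cunit_int flat g q - g q)%C.
Proof.
  intros Hq Hd [H1 H2]. unfold Cunit_int. apply injective_projections; simpl.
  - apply (ramp_int_derive (fun t => Re (g t))); auto. intros x Hx. apply Hd, Hx.
  - apply (ramp_int_derive (fun t => Im (g t))); auto. intros x Hx. apply Hd, Hx.
Qed.

Lemma Cflat_int_derive (g dg : R -> C) (q : R) :
  0 < q -> (forall x, 0 < x -> Cderive g x (dg x)) -> Cpos_continuous dg ->
  Cunit_int flat dg q = (g (q + 1)%R - g q)%C.
Proof.
  intros Hq Hd [H1 H2]. unfold Cunit_int. apply injective_projections; simpl.
  - apply (flat_int_derive (fun t => Re (g t))); auto. intros x Hx. apply Hd, Hx.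
  - apply (flat_int_derive (fun t => Im (g t))); auto. intros x Hx. apply Hd, Hx.
Qed.

Lemma Cderive_ramp_int (g : R -> C) (q : R) :
  0 < q -> Cpos_continuous g ->
  Cderive (fun x => Cunit_int (ramp x) g x) q (Cunit_int flat g q - g q)%C.
Proof.
  intros Hq [H1 H2]. split.
  - exact (is_derive_ramp_int (fun t => Re (g t)) q Hq H1).
  - exact (is_derive_ramp_int (fun t => Im (g t)) q Hq H2).
Qed.

(** * The Hurwitz series and its Taylor coefficients *)

Lemma pow_fact_le_exp (x : R) (k : nat) : 0 <= x -> x ^ k / INR (fact k) <= exp x.
Proof.
  intros Hx.
  assert (H := is_exp_Reals x). apply is_pseries_R in H.
  set (a := fun n => / INR (fact n) * x ^ n) in *.
  assert (Ha : forall n, 0 <= a n).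
  { intro n. apply Rmult_le_pos; [|apply pow_le, Hx].
    left. apply Rinv_0_lt_compat, INR_fact_lt_0. }
  apply is_series_Reals in H.
  apply Rle_trans with (sum_f_R0 a k).
  - replace (x ^ k / INR (fact k)) with (a k) by (unfold a, Rdiv; ring).
    destruct k as [|k]; simpl; [lra|].
    assert (P : 0 <= sum_f_R0 a k) by (apply cond_pos_sum, Ha). lra.
  - apply (sum_incr a k (exp x) H Ha).
Qed.

Lemma pseries_entire (a : nat -> R) (M : R) (t : R) :
  0 < M -> (forall k, Rabs (a k) <= M ^ k / INR (fact k)) ->
  Rbar_lt (Rabs t) (CV_radius a).
Proof.
  intros HM H.
  assert (Hr : 0 <= Rabs t + 1) by (assert (P := Rabs_pos t); lra).
  assert (L : Rbar_le (Rabs t + 1) (CV_radius a)).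
  { apply (proj1 (CV_radius_bounded a)).
    exists (exp (M * (Rabs t + 1))). intro n.
    rewrite Rabs_mult, (Rabs_pos_eq (_ ^ n)) by (apply pow_le, Hr).
    eapply Rle_trans; [apply Rmult_le_compat_r; [apply pow_le, Hr|apply H]|].
    replace (M ^ n / INR (fact n) * (Rabs t + 1) ^ n)
      with ((M * (Rabs t + 1)) ^ n / INR (fact n))
      by (rewrite Rpow_mult_distr; unfold Rdiv; ring).
    apply pow_fact_le_exp, Rmult_le_pos; lra. }
  apply (Rbar_lt_le_trans _ (Rabs t + 1)); [simpl; lra|exact L].
Qed.

(** The power series of [exp (t w)] in the real variable [t] solves the linear
    system [X' = a X - b Y], [Y' = b X + a Y] for [w = a + i b]; conjugating by
    the expected solution gives a constant. *)
Lemma Cexp_series (w : C) (t : R) :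
  Cseries (fun k => w ^ k * RtoC (t ^ k / INR (fact k)))%C
    (exp (Re w * t) * cos (Im w * t), exp (Re w * t) * sin (Im w * t)).
Proof.
  set (a := Re w). set (b := Im w).
  set (u := fun k => Re (w ^ k) / INR (fact k)).
  set (v := fun k => Im (w ^ k) / INR (fact k)).
  (* The added 1 keeps [M] positive when [w = 0]. *)
  set (M := Cmod w + 1).
  assert (HM : 0 < M) by (assert (G := Cmod_ge_0 w); unfold M; lra).
  assert (Hpow : forall k, Cmod (w ^ k) <= M ^ k).
  { intro k. rewrite Cmod_pow. apply pow_incr. unfold M. assert (G := Cmod_ge_0 w). lra. }
  assert (Bu : forall k, Rabs (u k) <= M ^ k / INR (fact k)).
  { intro k. unfold u, Rdiv. rewrite Rabs_mult, (Rabs_pos_eq (/ _))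
      by (left; apply Rinv_0_lt_compat, INR_fact_lt_0).
    apply Rmult_le_compat_r; [left; apply Rinv_0_lt_compat, INR_fact_lt_0|].
    eapply Rle_trans; [apply re_le_Cmod|apply Hpow]. }
  assert (Bv : forall k, Rabs (v k) <= M ^ k / INR (fact k)).
  { intro k. unfold v, Rdiv. rewrite Rabs_mult, (Rabs_pos_eq (/ _))
      by (left; apply Rinv_0_lt_compat, INR_fact_lt_0).
    apply Rmult_le_compat_r; [left; apply Rinv_0_lt_compat, INR_fact_lt_0|].
    eapply Rle_trans; [apply im_le_Cmod|apply Hpow]. }
  assert (Cu := fun x => pseries_entire u M x HM Bu).
  assert (Cv := fun x => pseries_entire v M x HM Bv).
  assert (Eu : forall x, ex_pseries u x) by (intro x; apply CV_disk_correct, CV_disk_inside, Cu).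
  assert (Ev : forall x, ex_pseries v x) by (intro x; apply CV_disk_correct, CV_disk_inside, Cv).
  assert (Fu : forall n, PS_derive u n = a * u n + (- b) * v n).
  { intro n. unfold PS_derive, u, v. rewrite fact_simpl, mult_INR.
    assert (Q := INR_fact_lt_0 n). assert (T : 0 < INR (S n)) by (apply lt_0_INR; lia).
    change (w ^ S n)%C with (w * w ^ n)%C.
    replace (Re (w * w ^ n)) with (a * Re (w ^ n) - b * Im (w ^ n))
      by (unfold a, b, Re, Im, Cmult; reflexivity).
    field. lra. }
  assert (Fv : forall n, PS_derive v n = b * u n + a * v n).
  { intro n. unfold PS_derive, u, v. rewrite fact_simpl, mult_INR.
    assert (Q := INR_fact_lt_0 n). assert (T : 0 < INR (S n)) by (apply lt_0_INR; lia).
    change (w ^ S n)%C with (w * w ^ n)%C.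
    replace (Im (w * w ^ n)) with (a * Im (w ^ n) + b * Re (w ^ n))
      by (unfold a, b, Re, Im, Cmult; reflexivity).
    field. lra. }
  assert (Lin : forall c d x, PSeries (fun n => c * u n + d * v n) x = c * PSeries u x + d * PSeries v x).
  { intros c d x. apply is_pseries_unique.
    assert (P1 := is_pseries_scal (K := R_AbsRing) c u x _ (Rmult_comm x c) (PSeries_correct u x (Eu x))).
    assert (P2 := is_pseries_scal (K := R_AbsRing) d v x _ (Rmult_comm x d) (PSeries_correct v x (Ev x))).
    exact (is_pseries_plus _ _ _ _ _ P1 P2). }
  assert (Du : forall x, is_derive (PSeries u) x (a * PSeries u x + (- b) * PSeries v x)).
  { intro x. rewrite <- Lin, <- (PSeries_ext _ _ x Fu). apply is_derive_PSeries, Cu. }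
  assert (Dv : forall x, is_derive (PSeries v) x (b * PSeries u x + a * PSeries v x)).
  { intro x. rewrite <- Lin, <- (PSeries_ext _ _ x Fv). apply is_derive_PSeries, Cv. }
  (* [P + i Q] is the series multiplied by [exp (- w x)]. *)
  set (P := fun x => exp (- a * x) * (PSeries u x * cos (b * x) + PSeries v x * sin (b * x))).
  set (Q := fun x => exp (- a * x) * (PSeries v x * cos (b * x) - PSeries u x * sin (b * x))).
  assert (DP : forall x, is_derive P x 0).
  { intro x. unfold P. auto_derive.
    - repeat split; eexists; [apply Du|apply Dv].
    - replace (Derive (fun x0 => PSeries u x0) x) with (a * PSeries u x + (- b) * PSeries v x)
        by (symmetry; apply is_derive_unique, Du).
      replace (Derive (fun x0 => PSeries v x0) x) with (b * PSeries u x + a * PSeries v x)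
        by (symmetry; apply is_derive_unique, Dv).
      ring. }
  assert (DQ : forall x, is_derive Q x 0).
  { intro x. unfold Q. auto_derive.
    - repeat split; eexists; [apply Dv|apply Du].
    - replace (Derive (fun x0 => PSeries u x0) x) with (a * PSeries u x + (- b) * PSeries v x)
        by (symmetry; apply is_derive_unique, Du).
      replace (Derive (fun x0 => PSeries v x0) x) with (b * PSeries u x + a * PSeries v x)
        by (symmetry; apply is_derive_unique, Dv).
      ring. }
  assert (Const : forall f : R -> R, (forall x, is_derive f x 0) -> f t = f 0).
  { intros f Hf.
    destruct (MVT_gen f 0 t (fun _ => 0)) as [c [_ Hc]].
    - intros x _. apply Hf.
    - intros x _. apply derivable_continuous_pt. exists 0. apply is_derive_Reals, Hf.
    - lra. }
  assert (U0 : PSeries u 0 = 1).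
  { rewrite PSeries_0. unfold u. simpl. field. }
  assert (V0 : PSeries v 0 = 0).
  { rewrite PSeries_0. unfold v. simpl. field. }
  assert (EP : P t = 1).
  { rewrite (Const P DP). unfold P. rewrite U0, V0, !Rmult_0_r, exp_0, cos_0. ring. }
  assert (EQ : Q t = 0).
  { rewrite (Const Q DQ). unfold Q. rewrite U0, V0, !Rmult_0_r, exp_0, sin_0. ring. }
  assert (Ee : exp (a * t) * exp (- a * t) = 1).
  { rewrite <- exp_plus. replace (a * t + - a * t) with 0 by ring. apply exp_0. }
  assert (SC : cos (b * t) * cos (b * t) + sin (b * t) * sin (b * t) = 1).
  { assert (T := sin2_cos2 (b * t)). unfold Rsqr in T. lra. }
  assert (EU : PSeries u t = exp (a * t) * cos (b * t)).
  { transitivity (exp (a * t) * (P t * cos (b * t) - Q t * sin (b * t))).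
    - unfold P, Q.
      transitivity ((exp (a * t) * exp (- a * t)) * (PSeries u t * (cos (b * t) * cos (b * t) + sin (b * t) * sin (b * t)))).
      + rewrite Ee, SC. ring.
      + ring.
    - rewrite EP, EQ. ring. }
  assert (EV : PSeries v t = exp (a * t) * sin (b * t)).
  { transitivity (exp (a * t) * (P t * sin (b * t) + Q t * cos (b * t))).
    - unfold P, Q.
      transitivity ((exp (a * t) * exp (- a * t)) * (PSeries v t * (cos (b * t) * cos (b * t) + sin (b * t) * sin (b * t)))).
      + rewrite Ee, SC. ring.
      + ring.
    - rewrite EP, EQ. ring. }
  rewrite <- EU, <- EV.
  assert (SU := PSeries_correct u t (Eu t)). assert (SV := PSeries_correct v t (Ev t)).
  apply is_pseries_R, is_series_Reals in SU. apply is_pseries_R, is_series_Reals in SV.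
  apply Cseries_eps. intros eps He.
  destruct (SU (eps / 3)) as [N1 H1]; [lra|]. destruct (SV (eps / 3)) as [N2 H2]; [lra|].
  exists (N1 + N2)%nat. intros n Hn.
  specialize (H1 n ltac:(lia)). specialize (H2 n ltac:(lia)).
  assert (ES : sum_n (fun k => w ^ k * RtoC (t ^ k / INR (fact k)))%C n
    = (sum_f_R0 (fun k => u k * t ^ k) n, sum_f_R0 (fun k => v k * t ^ k) n)).
  { clear. induction n as [|n IH].
    - rewrite sum_O. simpl sum_f_R0. unfold u, v, Cmult, RtoC, Re, Im, Rdiv; simpl.
      apply injective_projections; simpl; ring.
    - rewrite sum_Sn, IH. rewrite !tech5. unfold plus; simpl.
      unfold prod_plus; simpl. unfold plus; simpl.
      unfold u, v, Cmult, RtoC, Re, Im, Rdiv; simpl.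
      apply injective_projections; simpl; ring. }
  change (Cmod (sum_n (fun k => w ^ k * RtoC (t ^ k / INR (fact k)))%C n - (PSeries u t, PSeries v t)) < eps).
  rewrite ES. eapply Rle_lt_trans; [apply (Cmod_le_components _ (eps / 3))|lra].
  - unfold Rdist in H1. simpl. left. exact H1.
  - unfold Rdist in H2. simpl. left. exact H2.
Qed.

Lemma Rpower_C_plus (y : R) (v w : C) : Rpower_C y (v + w) = (Rpower_C y v * Rpower_C y w)%C.
Proof.
  unfold Rpower_C, Cmult. destruct v as [a b], w as [c d]; simpl.
  rewrite !Rmult_plus_distr_r, exp_plus, cos_plus, sin_plus.
  apply injective_projections; simpl; ring.
Qed.

Lemma Rpower_C_m1 (y : R) : 0 < y -> Rpower_C y (RtoC (- (1))) = RtoC (/ y).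
Proof.
  intros Hy. unfold Rpower_C, RtoC; simpl.
  rewrite Rmult_0_l, cos_0, sin_0.
  replace (- (1) * ln y) with (- ln y) by ring. rewrite exp_Ropp, exp_ln by assumption.
  f_equal; ring.
Qed.

Lemma Cmod_Rpower_C (y : R) (w : C) : Cmod (Rpower_C y w) = exp (Re w * ln y).
Proof.
  unfold Rpower_C, Cmod; simpl.
  replace (_ + _) with (exp (Re w * ln y) ^ 2 * ((sin (Im w * ln y))² + (cos (Im w * ln y))²))
    by (unfold Rsqr; ring).
  rewrite sin2_cos2, Rmult_1_r. apply sqrt_pow2. left. apply exp_pos.
Qed.

(** The Taylor coefficients of [z |-> y ^ (- z)] at [z]. *)
Definition pow_coef (z : C) (k : nat) (y : R) : C :=
  (Rpower_C y (- z) * RtoC ((- ln y) ^ k / INR (fact k)))%C.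

(** Effect on Taylor coefficients of multiplying a function by
    [a + (z - z0)], where [z0] is the centre of the expansion. *)
Definition shift (a : C) (c : nat -> C) (k : nat) : C :=
  (a * c k + match k with 0%nat => RtoC 0 | S i => c i end)%C.

Lemma pow_coef_pseries (z w : C) (y : R) :
  Cpseries (fun k => pow_coef z k y) w (Rpower_C y (- (z + w))).
Proof.
  apply Cpseries_series.
  assert (H := Cexp_series w (- ln y)).
  apply (is_series_scal (K := C_AbsRing) (V := C_NormedModule) (Rpower_C y (- z))) in H.
  match type of H with Cseries _ ?l =>
    assert (E : l = Rpower_C y (- (z + w))) end.
  { replace (- (z + w))%C with (- z + - w)%C by ring. rewrite Rpower_C_plus.
    match goal with |- @eq _ ?a ?b => change (@eq C a b) end.
    unfold scal; simpl. unfold mult; simpl. f_equal.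
    unfold Rpower_C. destruct w as [a b]; simpl.
    f_equal; f_equal; f_equal; ring. }
  rewrite E in H. revert H. apply is_series_ext.
  intro k. unfold pow_coef. unfold scal; simpl. unfold mult; simpl.
  Cring.
Qed.

Lemma Cderive_mult_real (f : R -> C) (g : R -> R) (x : R) (df : C) (dg : R) :
  Cderive f x df -> is_derive g x dg ->
  Cderive (fun t => f t * RtoC (g t))%C x (df * RtoC (g x) + f x * RtoC dg)%C.
Proof.
  intros [H1 H2] Hg. split.
  - apply (is_derive_ext (fun t => Re (f t) * g t)).
    { intro t. unfold Re, Cmult, RtoC; simpl. ring. }
    replace (Re (df * RtoC (g x) + f x * RtoC dg)) with (Re df * g x + Re (f x) * dg)
      by (unfold Re, Cmult, Cplus, RtoC; simpl; ring).
    apply (is_derive_mult (fun t => Re (f t)) g x _ _ H1 Hg). intros; apply Rmult_comm.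
  - apply (is_derive_ext (fun t => Im (f t) * g t)).
    { intro t. unfold Im, Cmult, RtoC; simpl. ring. }
    replace (Im (df * RtoC (g x) + f x * RtoC dg)) with (Im df * g x + Im (f x) * dg)
      by (unfold Im, Cmult, Cplus, RtoC; simpl; ring).
    apply (is_derive_mult (fun t => Im (f t)) g x _ _ H2 Hg). intros; apply Rmult_comm.
Qed.

Lemma Cderive_Rpower_C (w : C) (y : R) :
  0 < y -> Cderive (fun t => Rpower_C t w) y (w * Rpower_C y w * RtoC (/ y))%C.
Proof.
  intros Hy. unfold Rpower_C. destruct w as [a b]. split; unfold Re, Im, Cmult, RtoC; simpl.
  - auto_derive; [repeat split; assumption|]. ring.
  - auto_derive; [repeat split; assumption|]. ring.
Qed.

(** The rule [d/dy y^(-z) = - z y^(-(z+1))], read off coefficient by coefficient: multiplication by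
    the variable [z] acts on Taylor coefficients as [shift z]. *)
Lemma Cderive_pow_coef (z : C) (k : nat) (y : R) :
  0 < y ->
  Cderive (pow_coef z k) y (- shift z (fun i => pow_coef (z + 1) i y) k)%C.
Proof.
  intros Hy.
  assert (D : is_derive (fun t => (- ln t) ^ k / INR (fact k)) y
    (- match k with 0%nat => 0 | S i => (- ln y) ^ i / INR (fact i) end * / y)).
  { auto_derive; [assumption|]. destruct k as [|k].
    - simpl. field. lra.
    - rewrite fact_simpl, mult_INR. rewrite Nat.pred_succ.
      assert (Q := INR_fact_lt_0 k). assert (T : 0 < INR (S k)) by (apply lt_0_INR; lia).
      field. repeat split; lra. }
  assert (P := Cderive_mult_real _ _ _ _ _ (Cderive_Rpower_C (- z) y Hy) D).
  match type of P with Cderive _ _ ?l =>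
    assert (E : l = (- shift z (fun i => pow_coef (z + 1) i y) k)%C) end.
  { unfold shift, pow_coef.
    replace (- (z + 1))%C with (- z + RtoC (- (1)))%C by (rewrite RtoC_opp; ring).
    rewrite Rpower_C_plus, Rpower_C_m1 by assumption.
    destruct k as [|k].
    - rewrite Ropp_0, Rmult_0_l. ring.
    - rewrite !RtoC_mult, RtoC_opp. ring. }
  rewrite <- E. exact P.
Qed.

Lemma exp_Rabs_le (x : R) : exp (Rabs x) <= exp x + exp (- x).
Proof.
  assert (P := exp_pos x). assert (P' := exp_pos (- x)).
  unfold Rabs. destruct (Rcase_abs x); lra.
Qed.

(** [(rho |ln y|)^k / k!] is one term of the series of [exp (rho |ln y|)], which is at most
    [y^rho + y^(-rho)] whatever the sign of [ln y]. The bound is therefore uniform in [k]. *)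
Lemma pow_coef_bound (z : C) (k : nat) (y rho : R) :
  0 < rho ->
  Cmod (pow_coef z k y) * rho ^ k <=
    exp ((rho - Re z) * ln y) + exp ((- rho - Re z) * ln y).
Proof.
  intros Hr. unfold pow_coef. rewrite Cmod_mult, Cmod_Rpower_C, Cmod_R.
  unfold Rdiv. rewrite Rabs_mult, <- RPow_abs, (Rabs_pos_eq (/ _))
    by (left; apply Rinv_0_lt_compat, INR_fact_lt_0).
  rewrite Rabs_Ropp.
  replace (exp (Re (- z) * ln y) * (Rabs (ln y) ^ k * / INR (fact k)) * rho ^ k)
    with (exp (Re (- z) * ln y) * ((rho * Rabs (ln y)) ^ k / INR (fact k)))
    by (rewrite Rpow_mult_distr; unfold Rdiv; ring).
  replace ((rho - Re z) * ln y) with (Re (- z) * ln y + rho * ln y)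
    by (unfold Re, Copp; simpl; ring).
  replace ((- rho - Re z) * ln y) with (Re (- z) * ln y + - (rho * ln y))
    by (unfold Re, Copp; simpl; ring).
  rewrite !exp_plus, <- Rmult_plus_distr_l.
  apply Rmult_le_compat_l; [left; apply exp_pos|].
  eapply Rle_trans; [apply pow_fact_le_exp; apply Rmult_le_pos; [lra|apply Rabs_pos]|].
  replace (rho * Rabs (ln y)) with (Rabs (rho * ln y))
    by (rewrite Rabs_mult, (Rabs_pos_eq rho); lra).
  apply exp_Rabs_le.
Qed.

(** * Summable majorants and termwise differentiation *)

Lemma exp_ln_anti (s x y : R) : s <= 0 -> 0 < x <= y -> exp (s * ln y) <= exp (s * ln x).
Proof.
  intros Hs [Hx Hxy].
  assert (L : ln x <= ln y) by (apply ln_le; assumption).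
  assert (E : s * ln y <= s * ln x) by nra.
  destruct E as [E|E]; [left; apply exp_increasing, E|rewrite E; lra].
Qed.

(** Integral comparison: [F] is a primitive of [t^s], each term after the first is at most an
    increment of [F], and [F] is negative because [s + 1 < 0], which bounds the telescoped sum. *)
Lemma ex_series_power (s q : R) :
  s < -1 -> 0 < q -> ex_series (fun n => exp (s * ln (q + INR n))).
Proof.
  intros Hs Hq.
  set (a := fun n => exp (s * ln (q + INR n))).
  set (F := fun t => exp ((s + 1) * ln t) / (s + 1)).
  assert (Hpos : forall n, 0 < q + INR n) by (intro n; assert (P := pos_INR n); lra).
  assert (Step : forall y, 0 < y -> exp (s * ln (y + 1)) <= F (y + 1) - F y).
  { intros y Hy.
    destruct (MVT_gen F y (y + 1) (fun t => exp (s * ln t))) as [c [Hc E]].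
    - intros x. rewrite Rmin_left, Rmax_right by lra. intros Hx. unfold F.
      auto_derive; [lra|].
      replace ((s + 1) * ln x) with (s * ln x + ln x) by ring.
      rewrite exp_plus, exp_ln by lra. field. split; lra.
    - intros x. rewrite Rmin_left, Rmax_right by lra. intros Hx.
      apply continuity_pt_filterlim. apply (ex_derive_continuous F).
      unfold F. auto_derive. lra.
    - rewrite Rmin_left, Rmax_right in Hc by lra. rewrite E.
      replace (y + 1 - y) with 1 by ring. rewrite Rmult_1_r.
      apply exp_ln_anti; lra. }
  assert (Fneg : forall y, F y <= 0).
  { intro y. unfold F. assert (P := exp_pos ((s + 1) * ln y)).
    assert (I : / (s + 1) < 0) by (apply Rinv_lt_0_compat; lra).
    unfold Rdiv. nra. }
  assert (B : forall n, sum_n a n <= a 0%nat + (F (q + INR n) - F q)).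
  { induction n as [|n IH].
    - rewrite sum_O. simpl INR. rewrite Rplus_0_r. lra.
    - rewrite sum_Sn. change (sum_n a n + exp (s * ln (q + INR (S n))) <= a 0%nat + (F (q + INR (S n)) - F q)).
      assert (St := Step _ (Hpos n)). rewrite S_INR.
      replace (q + (INR n + 1)) with (q + INR n + 1) by ring. lra. }
  assert (X : ex_finite_lim_seq (sum_n a)).
  { apply (ex_finite_lim_seq_incr _ (a 0%nat - F q)).
    - intro n. rewrite sum_Sn. change (sum_n a n <= sum_n a n + exp (s * ln (q + INR (S n)))).
      assert (P := exp_pos (s * ln (q + INR (S n)))). lra.
    - intro n. specialize (B n). specialize (Fneg (q + INR n)). lra. }
  destruct X as [l Hl]. exists l. exact Hl.
Qed.

(** Uniformity is asked on half-lines away from 0 only: a term such as [x^(-z)] with [Re z > 1]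
    blows up at 0. *)
Definition dominated (f : nat -> R -> C) : Prop :=
  forall q1, 0 < q1 -> exists u : nat -> R,
    ex_series u /\ forall n x, q1 <= x -> Cmod (f n x) <= u n.

Lemma dominated_lin (a b : C) (f g : nat -> R -> C) :
  dominated f -> dominated g -> dominated (fun n x => a * f n x + b * g n x)%C.
Proof.
  intros Hf Hg q1 Hq.
  destruct (Hf q1 Hq) as [u [Eu Hu]]. destruct (Hg q1 Hq) as [v [Ev Hv]].
  exists (fun n => plus (scal (Cmod a) (u n)) (scal (Cmod b) (v n))). split.
  - apply (ex_series_plus (V := R_NormedModule)); apply (ex_series_scal (V := R_NormedModule)); assumption.
  - intros n x Hx. eapply Rle_trans; [apply Cmod_triangle|]. rewrite !Cmod_mult.
    apply Rplus_le_compat; apply Rmult_le_compat_l; auto; apply Cmod_ge_0.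
Qed.

Lemma dominated_ext (f g : nat -> R -> C) :
  (forall n x, f n x = g n x) -> dominated f -> dominated g.
Proof.
  intros E Hf q1 Hq. destruct (Hf q1 Hq) as [u [Eu Hu]].
  exists u. split; [exact Eu|]. intros n x Hx. rewrite <- E. auto.
Qed.

Lemma dominated_ex (f : nat -> R -> C) (x : R) :
  dominated f -> 0 < x -> exists l, Cseries (fun n => f n x) l.
Proof.
  intros Hf Hx. destruct (Hf x Hx) as [u [Eu Hu]].
  apply (Cseries_dominated _ u); [|exact Eu]. intro n. apply Hu. lra.
Qed.

(** Half the distance to the line [Re z = 1]. With [rho] equal to it, both exponents [rho - Re z]
    and [- rho - Re z] stay below [-1]. *)
Definition abscissa_gap (z : C) : R := (Re z - 1) / 2.

Lemma pow_coef_uniform (z : C) (q1 : R) :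
  1 < Re z -> 0 < q1 ->
  exists u : nat -> R, ex_series u /\
    forall n x k, q1 <= x -> Cmod (pow_coef z k (x + INR n)) * abscissa_gap z ^ k <= u n.
Proof.
  intros Hz Hq. set (rho := abscissa_gap z).
  assert (Hr : 0 < rho) by (unfold rho, abscissa_gap; lra).
  exists (fun n => plus (exp ((rho - Re z) * ln (q1 + INR n)))
                        (exp ((- rho - Re z) * ln (q1 + INR n)))). split.
  - apply (ex_series_plus (V := R_NormedModule)); apply ex_series_power; try assumption;
      unfold rho, abscissa_gap; lra.
  - intros n x k Hx. eapply Rle_trans; [apply pow_coef_bound, Hr|].
    assert (P := pos_INR n).
    apply Rplus_le_compat; apply exp_ln_anti; try lra; unfold rho, abscissa_gap; lra.
Qed.

Lemma pow_coef_dominated (z : C) (k : nat) :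
  1 < Re z -> dominated (fun n x => pow_coef z k (x + INR n)).
Proof.
  intros Hz q1 Hq. destruct (pow_coef_uniform z q1 Hz Hq) as [u [Eu Hu]].
  assert (Hr : 0 < abscissa_gap z ^ k) by (apply pow_lt; unfold abscissa_gap; lra).
  exists (fun n => scal (/ abscissa_gap z ^ k) (u n)). split.
  - apply (ex_series_scal (V := R_NormedModule)), Eu.
  - intros n x Hx. specialize (Hu n x k Hx).
    unfold scal; simpl. unfold mult; simpl.
    apply (Rmult_le_reg_r (abscissa_gap z ^ k)); [assumption|].
    eapply Rle_trans; [exact Hu|]. right. field. lra.
Qed.

Lemma shift_dominated (a : C) (f : nat -> nat -> R -> C) (k : nat) :
  (forall i, dominated (f i)) -> dominated (fun n x => shift a (fun i => f i n x) k).
Proof.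
  intros H. unfold shift. destruct k as [|k].
  (* The summand with factor 0 only brings the expression into the two-term shape of the linearity
     lemma; the same device recurs below. *)
  - apply (dominated_ext (fun n x => a * f 0%nat n x + RtoC 0 * f 0%nat n x)%C); [intros; ring|].
    apply dominated_lin; apply H.
  - apply (dominated_ext (fun n x => a * f (S k) n x + RtoC 1 * f k n x)%C); [intros; ring|].
    apply dominated_lin; apply H.
Qed.

(** The mean value theorem is applied twice, to [f t - t f1(q)] and then to [f1], which gives the
    error as [f2(e) (c - q) h]. *)
Lemma taylor_order2 (f f1 f2 : R -> R) (q h d M : R) :
  (forall x, Rabs (x - q) <= d -> is_derive f x (f1 x)) ->
  (forall x, Rabs (x - q) <= d -> is_derive f1 x (f2 x)) ->
  (forall x, Rabs (x - q) <= d -> Rabs (f2 x) <= M) ->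
  Rabs h <= d -> Rabs (f (q + h) - f q - h * f1 q) <= M * h ^ 2.
Proof.
  intros D1 D2 B Hh.
  assert (In : forall h', Rabs h' <= d -> forall x,
    Rmin q (q + h') <= x <= Rmax q (q + h') -> Rabs (x - q) <= Rabs h').
  { intros h' _ x. unfold Rmin, Rmax, Rabs.
    destruct (Rle_dec q (q + h')), (Rcase_abs (x - q)), (Rcase_abs h'); lra. }
  destruct (MVT_gen (fun t => f t - t * f1 q) q (q + h) (fun t => f1 t - f1 q)) as [c [Hc E]].
  - intros x Hx. assert (I := In h Hh x ltac:(lra)).
    assert (D := D1 x ltac:(lra)). auto_derive; [exists (f1 x); exact D|].
    replace (Derive (fun x0 => f x0) x) with (f1 x) by (symmetry; apply is_derive_unique, D). ring.
  - intros x Hx. assert (I := In h Hh x Hx). apply continuity_pt_filterlim.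
    apply (ex_derive_continuous (fun t => f t - t * f1 q)).
    assert (D := D1 x ltac:(lra)). auto_derive. exists (f1 x); exact D.
  - assert (Ic := In h Hh c Hc).
    destruct (MVT_gen f1 q c f2) as [e [He E2]].
    + intros x Hx. apply D2. replace c with (q + (c - q)) in Hx by ring.
      assert (I := In (c - q) ltac:(lra) x ltac:(lra)). lra.
    + intros x Hx. apply continuity_pt_filterlim. apply (ex_derive_continuous f1).
      exists (f2 x). apply D2. replace c with (q + (c - q)) in Hx by ring.
      assert (I := In (c - q) ltac:(lra) x ltac:(lra)). lra.
    + replace c with (q + (c - q)) in He by ring.
      assert (I := In (c - q) ltac:(lra) e He).
      assert (Be := B e ltac:(lra)).
      replace (f (q + h) - f q - h * f1 q)
        with ((f (q + h) - (q + h) * f1 q) - (f q - q * f1 q)) by ring.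
      rewrite E, E2. replace (q + h - q) with h by ring.
      rewrite !Rabs_mult. rewrite <- (pow2_abs h).
      assert (P1 := Rabs_pos (f2 e)). assert (P2 := Rabs_pos (c - q)). assert (P3 := Rabs_pos h).
      assert (M0 : Rabs (f2 e) * Rabs (c - q) <= M * Rabs h) by (apply Rmult_le_compat; assumption).
      nra.
Qed.

Lemma Ctaylor_order2 (f f1 f2 : R -> C) (q h d M : R) :
  (forall x, Rabs (x - q) <= d -> Cderive f x (f1 x)) ->
  (forall x, Rabs (x - q) <= d -> Cderive f1 x (f2 x)) ->
  (forall x, Rabs (x - q) <= d -> Cmod (f2 x) <= M) ->
  Rabs h <= d -> Cmod (f (q + h)%R - f q - RtoC h * f1 q) <= 2 * (M * h ^ 2).
Proof.
  intros D1 D2 B Hh. apply Cmod_le_components.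
  - replace (Re (f (q + h)%R - f q - RtoC h * f1 q)) with (Re (f (q + h)) - Re (f q) - h * Re (f1 q))
      by (unfold Re, Cminus, Cplus, Copp, Cmult, RtoC; simpl; ring).
    apply (taylor_order2 (fun t => Re (f t)) (fun t => Re (f1 t)) (fun t => Re (f2 t)) q h d M).
    + intros x Hx. apply D1, Hx.
    + intros x Hx. apply D2, Hx.
    + intros x Hx. eapply Rle_trans; [apply re_le_Cmod|apply B, Hx].
    + exact Hh.
  - replace (Im (f (q + h)%R - f q - RtoC h * f1 q)) with (Im (f (q + h)) - Im (f q) - h * Im (f1 q))
      by (unfold Im, Cminus, Cplus, Copp, Cmult, RtoC; simpl; ring).
    apply (taylor_order2 (fun t => Im (f t)) (fun t => Im (f1 t)) (fun t => Im (f2 t)) q h d M).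
    + intros x Hx. apply D1, Hx.
    + intros x Hx. apply D2, Hx.
    + intros x Hx. eapply Rle_trans; [apply im_le_Cmod|apply B, Hx].
    + exact Hh.
Qed.

Lemma is_derive_quadratic (f : R -> R) (q l d K : R) :
  0 < d -> (forall h, Rabs h < d -> Rabs (f (q + h) - f q - h * l) <= K * h ^ 2) ->
  is_derive f q l.
Proof.
  intros Hd H. apply is_derive_Reals. intros eps He.
  assert (HK : 0 < Rabs K + 1) by (assert (P := Rabs_pos K); lra).
  assert (Hdelta : 0 < Rmin d (eps / (Rabs K + 1))).
  { apply Rmin_pos; [exact Hd|apply Rdiv_lt_0_compat; assumption]. }
  exists (mkposreal _ Hdelta). intros h Hh0 Hh. simpl in Hh.
  assert (M1 := Rmin_l d (eps / (Rabs K + 1))). assert (M2 := Rmin_r d (eps / (Rabs K + 1))).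
  specialize (H h ltac:(lra)).
  assert (Hp : 0 < Rabs h) by (apply Rabs_pos_lt, Hh0).
  replace ((f (q + h) - f q) / h - l) with ((f (q + h) - f q - h * l) / h) by (field; assumption).
  unfold Rdiv. rewrite Rabs_mult, Rabs_inv.
  apply (Rmult_lt_reg_r (Rabs h)); [exact Hp|].
  rewrite Rmult_assoc, Rinv_l, Rmult_1_r by lra.
  rewrite <- (pow2_abs h) in H.
  assert (A : Rabs h * (Rabs K + 1) < eps).
  { replace eps with (eps / (Rabs K + 1) * (Rabs K + 1)) by (field; lra).
    apply Rmult_lt_compat_r; lra. }
  assert (KK := Rle_abs K). nra.
Qed.

Lemma Cderive_quadratic (f : R -> C) (q d K : R) (l : C) :
  0 < d -> (forall h, Rabs h < d -> Cmod (f (q + h)%R - f q - RtoC h * l) <= K * h ^ 2) ->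
  Cderive f q l.
Proof.
  intros Hd H. split.
  - apply (is_derive_quadratic _ q _ d K Hd). intros h Hh. specialize (H h Hh).
    eapply Rle_trans; [|exact H]. eapply Rle_trans; [|apply re_le_Cmod].
    right. f_equal. unfold Re, Cminus, Cplus, Copp, Cmult, RtoC; simpl; ring.
  - apply (is_derive_quadratic _ q _ d K Hd). intros h Hh. specialize (H h Hh).
    eapply Rle_trans; [|exact H]. eapply Rle_trans; [|apply im_le_Cmod].
    right. f_equal. unfold Im, Cminus, Cplus, Copp, Cmult, RtoC; simpl; ring.
Qed.

Lemma RtoC_m1 : RtoC (-1) = (- (1))%C.
Proof. rewrite <- RtoC_opp. reflexivity. Qed.

Lemma Cseries_plus (a b : nat -> C) (la lb : C) :
  Cseries a la -> Cseries b lb -> Cseries (fun n => a n + b n)%C (la + lb)%C.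
Proof. exact (is_series_plus (K := C_AbsRing) (V := C_NormedModule) a b la lb). Qed.

Lemma Cseries_scal (c : C) (a : nat -> C) (l : C) :
  Cseries a l -> Cseries (fun n => c * a n)%C (c * l)%C.
Proof. exact (is_series_scal (K := C_AbsRing) (V := C_NormedModule) c a l). Qed.

Lemma Cseries_ext (a b : nat -> C) (l : C) :
  (forall n, a n = b n) -> Cseries a l -> Cseries b l.
Proof. exact (is_series_ext (K := C_AbsRing) (V := C_NormedModule) a b l). Qed.

(** Each term is affine in [h] up to an error [2 (u n) h^2]. These errors sum to a quadratic error
    for [F], which is differentiability. Increments below [q / 2] keep all points where [u]
    dominates. *)
Lemma Cderive_series (f f1 f2 : nat -> R -> C) (F : R -> C) (q : R) (l : C) :
  0 < q ->
  (forall n x, 0 < x -> Cderive (f n) x (f1 n x)) ->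
  (forall n x, 0 < x -> Cderive (f1 n) x (f2 n x)) ->
  dominated f2 ->
  (forall x, 0 < x -> Cseries (fun n => f n x) (F x)) ->
  Cseries (fun n => f1 n q) l ->
  Cderive F q l.
Proof.
  intros Hq D1 D2 Hdom HF Hl.
  destruct (Hdom (q / 2)) as [u [[U Eu] Hu]]; [lra|].
  apply (Cderive_quadratic F q (q / 2) (2 * U)); [lra|].
  intros h Hh. assert (Hh' := Rabs_def2 _ _ Hh).
  apply (Cseries_norm_le (fun n => f n (q + h)%R - f n q - RtoC h * f1 n q)%C
    (fun n => scal (2 * h ^ 2) (u n))).
  - intro n.
    assert (T := Ctaylor_order2 (f n) (f1 n) (f2 n) q h (q / 2) (u n)).
    unfold scal; simpl. unfold mult; simpl.
    replace (2 * (h * (h * 1)) * u n) with (2 * (u n * h ^ 2)) by ring.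
    apply T.
    + intros x Hx. apply D1. apply Rabs_le_between in Hx. lra.
    + intros x Hx. apply D2. apply Rabs_le_between in Hx. lra.
    + intros x Hx. apply Hu. apply Rabs_le_between in Hx. lra.
    + lra.
  - replace (2 * U * h ^ 2) with (scal (2 * h ^ 2) U)
      by (unfold scal; simpl; unfold mult; simpl; ring).
    apply (is_series_scal (V := R_NormedModule)), Eu.
  - apply (Cseries_ext (fun n => f n (q + h)%R + (RtoC (-1) * f n q + (- RtoC h) * f1 n q))%C).
    { intro n. rewrite RtoC_m1. ring. }
    replace (F (q + h)%R - F q - RtoC h * l)%C
      with (F (q + h)%R + (RtoC (-1) * F q + (- RtoC h) * l))%C by (rewrite RtoC_m1; ring).
    apply Cseries_plus; [apply HF; lra|].
    apply Cseries_plus; apply Cseries_scal; [apply HF; lra|exact Hl].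
Qed.

(** A choice makes the sum a total function of its terms; it carries meaning only for convergent
    series. *)
Definition Csum (a : nat -> C) : C := epsilon (inhabits (RtoC 0)) (Cseries a).

Lemma Csum_correct (a : nat -> C) : (exists l, Cseries a l) -> Cseries a (Csum a).
Proof. exact (epsilon_spec (inhabits (RtoC 0)) (Cseries a)). Qed.

(** Taylor coefficients in [z] of the Hurwitz series; the case [k = 0] is the
    series itself. *)
Definition series_coef (z : C) (k : nat) (q : R) : C :=
  Csum (fun n => pow_coef z k (q + INR n)).

Lemma series_coef_correct (z : C) (k : nat) (q : R) :
  1 < Re z -> 0 < q -> Cseries (fun n => pow_coef z k (q + INR n)) (series_coef z k q).
Proof.
  intros Hz Hq. apply Csum_correct.
  exact (dominated_ex _ q (pow_coef_dominated z k Hz) Hq).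
Qed.

Lemma Cseries_shift (a : C) (c : nat -> nat -> C) (l : nat -> C) (k : nat) :
  (forall i, Cseries (c i) (l i)) ->
  Cseries (fun n => shift a (fun i => c i n) k) (shift a l k).
Proof.
  intros H. unfold shift. destruct k as [|k].
  - apply (Cseries_ext (fun n => a * c 0%nat n)%C); [intro; ring|].
    replace (a * l 0%nat + 0)%C with (a * l 0%nat)%C by ring. apply Cseries_scal, H.
  - apply Cseries_plus; [apply Cseries_scal|]; apply H.
Qed.

Lemma Cderive_shift (a : C) (f : nat -> R -> C) (df : nat -> C) (k : nat) (x : R) :
  (forall i, Cderive (f i) x (df i)) ->
  Cderive (fun t => shift a (fun i => f i t) k) x (shift a df k).
Proof.
  intros H. unfold shift. apply Cderive_plus; [apply Cderive_scal, H|].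
  destruct k as [|k]; [|apply H].
  split; apply (is_derive_const (V := R_NormedModule)).
Qed.

Lemma shift_opp (a : C) (c : nat -> C) (k : nat) :
  shift a (fun i => - c i)%C k = (- shift a c k)%C.
Proof. unfold shift. destruct k; ring. Qed.

Lemma shift_ext (a : C) (c d : nat -> C) (k : nat) :
  (forall i, c i = d i) -> shift a c k = shift a d k.
Proof. intros H. unfold shift. destruct k; rewrite ?H; reflexivity. Qed.

Lemma Cderive_translate (f : R -> C) (x t : R) (l : C) :
  Cderive f (x + t) l -> Cderive (fun y => f (y + t)) x l.
Proof.
  assert (T : is_derive (fun y => y + t) x 1) by (auto_derive; [exact I|reflexivity]).
  intros [H1 H2]. split.
  - assert (D := is_derive_comp (fun y => Re (f y)) (fun y => y + t) x _ _ H1 T).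
    unfold scal in D; simpl in D. unfold mult in D; simpl in D. rewrite Rmult_1_l in D. exact D.
  - assert (D := is_derive_comp (fun y => Im (f y)) (fun y => y + t) x _ _ H2 T).
    unfold scal in D; simpl in D. unfold mult in D; simpl in D. rewrite Rmult_1_l in D. exact D.
Qed.

Lemma Cderive_opp (f : R -> C) (x : R) (l : C) :
  Cderive f x l -> Cderive (fun t => - f t)%C x (- l)%C.
Proof.
  intros [H1 H2]. split.
  - exact (is_derive_opp (fun t => Re (f t)) x _ H1).
  - exact (is_derive_opp (fun t => Im (f t)) x _ H2).
Qed.

Lemma Cderive_series_coef (z : C) (k : nat) (q : R) :
  1 < Re z -> 0 < q ->
  Cderive (series_coef z k) q (- shift z (fun i => series_coef (z + 1) i q) k)%C.
Proof.
  intros Hz Hq.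
  assert (R1 : 1 < Re (z + 1)) by (unfold Re, Cplus, RtoC in *; simpl; lra).
  assert (R2 : 1 < Re (z + 1 + 1)) by (unfold Re, Cplus, RtoC in *; simpl; lra).
  (* The third family holds the second [q]-derivatives, whose summable majorant controls the
     quadratic errors. *)
  apply (Cderive_series (fun n x => pow_coef z k (x + INR n))
    (fun n x => - shift z (fun i => pow_coef (z + 1) i (x + INR n)) k)%C
    (fun n x => shift z (shift (z + 1) (fun i => pow_coef (z + 1 + 1) i (x + INR n))) k)).
  - exact Hq.
  - intros n x Hx. assert (P := pos_INR n).
    apply (Cderive_translate (pow_coef z k)), Cderive_pow_coef. lra.
  - intros n x Hx. assert (P := pos_INR n).
    replace (shift z (shift (z + 1) (fun i => pow_coef (z + 1 + 1) i (x + INR n))) k)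
      with (- shift z (fun i => - shift (z + 1) (fun i => pow_coef (z + 1 + 1) i (x + INR n)) i) k)%C
      by (rewrite shift_opp; ring).
    apply Cderive_opp.
    apply (Cderive_shift z (fun i y => pow_coef (z + 1) i (y + INR n))).
    intro i. apply (Cderive_translate (pow_coef (z + 1) i)), Cderive_pow_coef. lra.
  - apply (shift_dominated z (fun i n x => shift (z + 1) (fun i => pow_coef (z + 1 + 1) i (x + INR n)) i)).
    intro i. apply (shift_dominated (z + 1) (fun i n x => pow_coef (z + 1 + 1) i (x + INR n))).
    intro j. apply pow_coef_dominated, R2.
  - intros x Hx. apply series_coef_correct; assumption.
  - apply (Cseries_ext (fun n => RtoC (-1) * shift z (fun i => pow_coef (z + 1) i (q + INR n)) k)%C).
    { intro n. rewrite RtoC_m1. ring. }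
    replace (- shift z (fun i => series_coef (z + 1) i q) k)%C
      with (RtoC (-1) * shift z (fun i => series_coef (z + 1) i q) k)%C by (rewrite RtoC_m1; ring).
    apply Cseries_scal.
    apply (Cseries_shift z (fun i n => pow_coef (z + 1) i (q + INR n)) (fun i => series_coef (z + 1) i q)).
    intro i. apply series_coef_correct; assumption.
Qed.

Lemma series_coef_succ (z : C) (k : nat) (q : R) :
  1 < Re z -> 0 < q ->
  series_coef z k (q + 1) = (series_coef z k q - pow_coef z k q)%C.
Proof.
  intros Hz Hq.
  assert (H := series_coef_correct z k q Hz Hq).
  assert (H1 := series_coef_correct z k (q + 1) Hz ltac:(lra)).
  apply (Cseries_unique _ _ _ H1).
  apply (Cseries_ext (fun n => pow_coef z k (q + INR (S n)))).
  { intro n. rewrite S_INR. f_equal. ring. }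
  apply (is_series_incr_1 (K := C_AbsRing) (V := C_NormedModule) (fun n => pow_coef z k (q + INR n))).
  match goal with |- Cseries _ ?l => replace l with (series_coef z k q) end; [exact H|].
  simpl INR. rewrite Rplus_0_r. unfold plus; simpl.
  match goal with |- @eq _ ?a ?b => change (@eq C a (series_coef z k q - pow_coef z k q + pow_coef z k q)%C) end.
  ring.
Qed.

Lemma series_coef_bound (z : C) (q1 : R) :
  1 < Re z -> 0 < q1 -> exists N, forall q k, q1 <= q ->
    Cmod (series_coef z k q) * abscissa_gap z ^ k <= N.
Proof.
  intros Hz Hq. destruct (pow_coef_uniform z q1 Hz Hq) as [u [[U Eu] Hu]].
  exists U. intros q k Hqq.
  assert (Hr : 0 < abscissa_gap z ^ k) by (apply pow_lt; unfold abscissa_gap; lra).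
  rewrite <- (Rabs_pos_eq (abscissa_gap z ^ k)) by lra.
  rewrite <- Cmod_R, Rmult_comm, <- Cmod_mult.
  apply (Cseries_norm_le (fun n => RtoC (abscissa_gap z ^ k) * pow_coef z k (q + INR n))%C u).
  - intro n. rewrite Cmod_mult, Cmod_R, Rabs_pos_eq, Rmult_comm by lra. apply Hu, Hqq.
  - exact Eu.
  - apply Cseries_scal, series_coef_correct; [assumption|lra].
Qed.

Lemma Cseries_finite_sum (c : nat -> nat -> C) (l : nat -> C) (K : nat) :
  (forall k, Cseries (c k) (l k)) ->
  Cseries (fun n => sum_n (fun k => c k n) K) (sum_n l K).
Proof.
  intros H. induction K as [|K IH].
  - rewrite sum_O. apply (Cseries_ext (c 0%nat)); [intro n; rewrite sum_O; reflexivity|apply H].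
  - rewrite sum_Sn. apply (Cseries_ext (fun n => sum_n (fun k => c k n) K + c (S K) n)%C).
    { intro n. rewrite sum_Sn. reflexivity. }
    apply Cseries_plus; [exact IH|apply H].
Qed.

Lemma Cpseries_of_remainder (c : nat -> C) (w l : C) (N x : R) :
  0 <= x < 1 ->
  (forall K, Cmod (l - sum_n (fun k => w ^ k * c k)%C K) <= N * x ^ S K) ->
  Cpseries c w l.
Proof.
  intros Hx H. apply Cpseries_series, Cseries_eps. intros eps He.
  assert (L : is_lim_seq (fun n => N * x ^ S n) 0).
  { replace (Finite 0) with (Rbar_mult N 0) by (simpl; f_equal; ring).
    apply is_lim_seq_scal_l. apply (is_lim_seq_incr_1 (fun n => x ^ n)).
    apply is_lim_seq_geom. rewrite Rabs_pos_eq; lra. }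
  apply is_lim_seq_spec in L. destruct (L (mkposreal eps He)) as [n0 Hn0].
  exists n0. intros n Hn. specialize (Hn0 n Hn). simpl in Hn0.
  rewrite <- Cmod_opp.
  replace (- (sum_n (fun k : nat => (w ^ k * c k)%C) n - l))%C
    with (l - sum_n (fun k : nat => (w ^ k * c k)%C) n)%C by Cring.
  eapply Rle_lt_trans; [apply H|].
  apply Rabs_def2 in Hn0. simpl. lra.
Qed.

(** Interchange of the sum over [n] with the expansion in [w]: the remainder of the [n]-th term
    after index [K] is at most [u n] times [x^(K+1) / (1 - x)], and this sums over [n] to a
    geometric remainder. *)
Lemma series_coef_pseries (z w : C) (q : R) :
  1 < Re z -> 0 < q -> Cmod w < abscissa_gap z ->
  Cpseries (fun k => series_coef z k q) w (series_coef (z + w) 0 q).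
Proof.
  intros Hz Hq Hw. set (rho := abscissa_gap z) in *.
  destruct (pow_coef_uniform z q Hz Hq) as [u [[U Eu] Hu]]. fold rho in Hu.
  assert (Hx := Cmod_ratio w rho Hw). set (x := Cmod w / rho) in *.
  apply (Cpseries_of_remainder _ w _ (U / (1 - x)) x Hx).
  intro K.
  assert (Hzw : 1 < Re (z + w)).
  { assert (T := re_le_Cmod w). apply Rabs_le_between in T.
    unfold rho, abscissa_gap in Hw. unfold Re, Cplus in *; simpl. lra. }
  apply (Cseries_norm_le
    (fun n => pow_coef (z + w) 0 (q + INR n)
              + RtoC (-1) * sum_n (fun k => w ^ k * pow_coef z k (q + INR n)) K)%C
    (fun n => scal (x ^ S K / (1 - x)) (u n))).
  - intro n. rewrite RtoC_m1.
    set (s := sum_n (fun k => w ^ k * pow_coef z k (q + INR n))%C K).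
    replace (pow_coef (z + w) 0 (q + INR n) + - (1) * s)%C
      with (Rpower_C (q + INR n) (- (z + w)) - s)%C.
    2:{ unfold pow_coef. simpl pow. simpl fact. simpl INR.
        replace (1 / 1) with 1 by field. ring. }
    eapply Rle_trans; [apply (Cpseries_remainder _ w _ rho (u n) K)|].
    + intro k. apply Hu. lra.
    + exact Hw.
    + apply pow_coef_pseries.
    + fold x. unfold scal; simpl. unfold mult; simpl. right. field. lra.
  - replace (U / (1 - x) * x ^ S K) with (scal (x ^ S K / (1 - x)) U)
      by (unfold scal; simpl; unfold mult; simpl; field; lra).
    apply (is_series_scal (V := R_NormedModule)), Eu.
  - replace (series_coef (z + w) 0 q - sum_n (fun k => w ^ k * series_coef z k q) K)%C
      with (series_coef (z + w) 0 q + RtoC (-1) * sum_n (fun k => w ^ k * series_coef z k q) K)%C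
      by (rewrite RtoC_m1; Cring).
    apply Cseries_plus; [apply series_coef_correct; assumption|].
    apply Cseries_scal.
    apply (Cseries_finite_sum (fun k n => w ^ k * pow_coef z k (q + INR n))%C).
    intro k. apply Cseries_scal, series_coef_correct; assumption.
Qed.

(** * Continuation strip by strip *)

(** Taylor coefficients at [z] of [(z - 1) zeta (z, q)] after [j] steps of the
    continuation; junk unless [in_strip j z], where the series converges.  The
    base half-plane is [Re z > 2] rather than [Re z > 1], so that the case [j = 0]
    of [has_unit_mean] follows by telescoping the convergent series at [z - 1]. *)
Fixpoint cont_coef (j : nat) (z : C) (k : nat) (q : R) : C :=
  match j with
  | 0%nat => shift (z - 1) (fun i => series_coef z i q) k
  | S j => (pow_coef (z - 1) k q
      + shift (z - 1) (fun i => Cunit_int (ramp q) (cont_coef j (z + 1) i) q) k)%C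
  end.

Definition in_strip (j : nat) (z : C) : Prop := 2 - INR j < Re z.

Lemma Re_plus (z w : C) : Re (z + w) = Re z + Re w.
Proof. reflexivity. Qed.

Lemma in_strip_succ (j : nat) (z : C) : in_strip (S j) z -> in_strip j (z + 1).
Proof. unfold in_strip. rewrite S_INR, Re_plus. simpl. lra. Qed.

Lemma in_strip_plus1 (j : nat) (z : C) : in_strip j z -> in_strip j (z + 1).
Proof. unfold in_strip. rewrite Re_plus. simpl. lra. Qed.

Lemma in_strip_weaken (j i : nat) (z : C) : in_strip j z -> (j <= i)%nat -> in_strip i z.
Proof. unfold in_strip. intros H Hi. apply le_INR in Hi. lra. Qed.

Lemma Cplus1_minus1 (z : C) : (z + 1 - 1)%C = z.
Proof. ring. Qed.

Lemma Cminus1_plus1 (z : C) : (z - 1 + 1)%C = z.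
Proof. ring. Qed.

Lemma Cpos_continuous_shift (a : C) (f : nat -> R -> C) (k : nat) :
  (forall i, Cpos_continuous (f i)) -> Cpos_continuous (fun t => shift a (fun i => f i t) k).
Proof.
  intros H. unfold shift. destruct k as [|k].
  - apply (Cpos_continuous_ext (fun t => a * f 0%nat t + RtoC 0 * f 0%nat t)%C); [intros; ring|].
    apply Cpos_continuous_lin; apply H.
  - apply (Cpos_continuous_ext (fun t => a * f (S k) t + RtoC 1 * f k t)%C); [intros; ring|].
    apply Cpos_continuous_lin; apply H.
Qed.

Lemma Cunit_int_shift (w : R -> R) (a : C) (f : nat -> R -> C) (k : nat) (q : R) :
  (forall t, continuous w t) -> (forall i, Cpos_continuous (f i)) -> 0 < q ->
  Cunit_int w (fun t => shift a (fun i => f i t) k) q = shift a (fun i => Cunit_int w (f i) q) k.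
Proof.
  intros Hw H Hq. unfold shift. destruct k as [|k].
  - rewrite (Cunit_int_ext w _ (fun t => a * f 0%nat t + RtoC 0 * f 0%nat t)%C q Hq) by (intros; ring).
    rewrite Cunit_int_lin; auto. ring.
  - rewrite (Cunit_int_ext w _ (fun t => a * f (S k) t + RtoC 1 * f k t)%C q Hq) by (intros; ring).
    rewrite Cunit_int_lin; auto. ring.
Qed.

Lemma Cunit_int_opp (w : R -> R) (f : R -> C) (q : R) :
  (forall t, continuous w t) -> Cpos_continuous f -> 0 < q ->
  Cunit_int w (fun t => - f t)%C q = (- Cunit_int w f q)%C.
Proof.
  intros Hw H Hq.
  rewrite (Cunit_int_ext w _ (fun t => RtoC (-1) * f t + RtoC 0 * f t)%C q Hq)
    by (intros; rewrite RtoC_m1; ring).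
  rewrite Cunit_int_lin; auto. rewrite RtoC_m1. ring.
Qed.

Lemma Cpos_continuous_opp (f : R -> C) : Cpos_continuous f -> Cpos_continuous (fun t => - f t)%C.
Proof.
  intros H.
  apply (Cpos_continuous_ext (fun t => RtoC (-1) * f t + RtoC 0 * f t)%C);
    [intros; rewrite RtoC_m1; ring|].
  apply Cpos_continuous_lin; exact H.
Qed.

(** The coefficients of the identity [dE/dq (z, q) = - (z - 1) E (z + 1, q)]. *)
Definition lowers (j : nat) : Prop :=
  forall z k q, in_strip j z -> 0 < q ->
    Cderive (cont_coef j z k) q (- shift (z - 1) (fun i => cont_coef j (z + 1) i q) k)%C.

(** The coefficients of the identity [int_q^(q+1) E (z, t) dt = q^(1-z)]. *)
Definition has_unit_mean (j : nat) : Prop :=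
  forall z k q, in_strip j z -> 0 < q ->
    Cunit_int flat (cont_coef j z k) q = pow_coef (z - 1) k q.

Lemma lowers_continuous (j : nat) (z : C) (k : nat) :
  lowers j -> in_strip j z -> Cpos_continuous (cont_coef j z k).
Proof.
  intros D Hz. eapply Cderive_pos_continuous. intros x Hx. apply (D z k x Hz Hx).
Qed.

(** Integration by parts: [int_q^(q+1) (q+1-t) f'(t) dt = int_q^(q+1) f - f(q)]. *)
Lemma ramp_of_lowered (j : nat) (z : C) (k : nat) (q : R) :
  lowers j -> in_strip j z -> 0 < q ->
  shift (z - 1) (fun i => Cunit_int (ramp q) (cont_coef j (z + 1) i) q) k
    = (cont_coef j z k q - Cunit_int flat (cont_coef j z k) q)%C.
Proof.
  intros D Hz Hq.
  assert (Cc : forall i, Cpos_continuous (cont_coef j (z + 1) i)).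
  { intro i. apply lowers_continuous; [exact D|apply in_strip_plus1, Hz]. }
  assert (E := Cramp_int_derive (cont_coef j z k)
    (fun t => - shift (z - 1) (fun i => cont_coef j (z + 1) i t) k)%C q Hq
    (fun x Hx => D z k x Hz Hx)
    (Cpos_continuous_opp _ (Cpos_continuous_shift (z - 1) (cont_coef j (z + 1)) k Cc))).
  rewrite Cunit_int_opp in E; [|apply continuous_ramp|apply Cpos_continuous_shift, Cc|exact Hq].
  rewrite (Cunit_int_shift (ramp q) (z - 1) (cont_coef j (z + 1)) k q (continuous_ramp q) Cc Hq) in E.
  match type of E with (- ?a)%C = _ => replace a with (- - a)%C by ring end.
  rewrite E. ring.
Qed.

(** After integration by parts the recursion reads: power, plus previous value, minus its mean. The
    mean is that very power. *)
Lemma cont_coef_succ (j : nat) (z : C) (k : nat) (q : R) :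
  lowers j -> has_unit_mean j -> in_strip j z -> 0 < q ->
  cont_coef (S j) z k q = cont_coef j z k q.
Proof.
  intros D I Hz Hq. simpl. rewrite ramp_of_lowered by assumption.
  rewrite I by assumption. ring.
Qed.

Lemma lowers_0 : lowers 0.
Proof.
  intros z k q Hz Hq. unfold in_strip in Hz. simpl INR in Hz. simpl cont_coef.
  replace (- shift (z - 1) (fun i => shift (z + 1 - 1) (fun i0 => series_coef (z + 1) i0 q) i) k)%C
    with (shift (z - 1) (fun i => - shift z (fun i0 => series_coef (z + 1) i0 q) i) k)%C.
  - apply Cderive_shift. intro i. apply Cderive_series_coef; lra.
  - rewrite shift_opp, Cplus1_minus1. reflexivity.
Qed.

Lemma has_unit_mean_0 : has_unit_mean 0.
Proof.
  intros z k q Hz Hq. unfold in_strip in Hz. simpl INR in Hz. simpl cont_coef.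
  assert (Hz1 : 1 < Re (z - 1)) by (unfold Re, Cminus, Cplus, Copp, RtoC in *; simpl in *; lra).
  assert (Cc : forall i, Cpos_continuous (series_coef z i)).
  { intro i. eapply Cderive_pos_continuous. intros x Hx. apply Cderive_series_coef; lra. }
  assert (D : forall x, 0 < x ->
    Cderive (series_coef (z - 1) k) x (- shift (z - 1) (fun i => series_coef z i x) k)%C).
  { intros x Hx. assert (T := Cderive_series_coef (z - 1) k x Hz1 Hx).
    rewrite Cminus1_plus1 in T. exact T. }
  assert (E := Cflat_int_derive _ _ q Hq D
    (Cpos_continuous_opp _ (Cpos_continuous_shift (z - 1) (series_coef z) k Cc))).
  rewrite Cunit_int_opp in E; [|apply continuous_flat|apply Cpos_continuous_shift, Cc|exact Hq].
  rewrite series_coef_succ in E by assumption.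
  match type of E with (- ?a)%C = _ => replace a with (- - a)%C by ring end.
  rewrite E. ring.
Qed.

(** Differentiating the recursion produces the coefficients of [(z - 1) q^(-z)] twice with opposite
    signs, once from [q^(1-z)] and once from the mean of step [j] at [z + 1]. What remains is step
    [j] at [z + 1], which agrees there with step [j + 1]. *)
Lemma lowers_succ (j : nat) : lowers j -> has_unit_mean j -> lowers (S j).
Proof.
  intros D I z k q Hz Hq.
  assert (Hz1 := in_strip_succ j z Hz).
  replace (- shift (z - 1) (fun i => cont_coef (S j) (z + 1) i q) k)%C
    with (- shift (z - 1) (fun i => pow_coef (z - 1 + 1) i q) k
          + shift (z - 1) (fun i => Cunit_int flat (cont_coef j (z + 1) i) q
                                    - cont_coef j (z + 1) i q) k)%C.
  - apply (Cderive_plus (pow_coef (z - 1) k)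
      (fun t => shift (z - 1) (fun i => Cunit_int (ramp t) (cont_coef j (z + 1) i) t) k)).
    + apply Cderive_pow_coef, Hq.
    + apply (Cderive_shift (z - 1) (fun i t => Cunit_int (ramp t) (cont_coef j (z + 1) i) t)).
      intro i. apply Cderive_ramp_int; [exact Hq|]. apply lowers_continuous; assumption.
  - rewrite (shift_ext (z - 1) (fun i => cont_coef (S j) (z + 1) i q) (fun i => cont_coef j (z + 1) i q))
      by (intro i; apply cont_coef_succ; assumption).
    rewrite (shift_ext (z - 1) (fun i => Cunit_int flat (cont_coef j (z + 1) i) q - cont_coef j (z + 1) i q)%C
      (fun i => pow_coef z i q - cont_coef j (z + 1) i q)%C)
      by (intro i; rewrite I, Cplus1_minus1 by assumption; reflexivity).
    rewrite Cminus1_plus1. unfold shift. destruct k; ring.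
Qed.

(** The ramp integral is known twice: integration by parts at step [j + 1] makes it the value minus
    its mean, and the recursion makes it the value minus [q^(1-z)]. Comparison yields the mean. *)
Lemma has_unit_mean_succ (j : nat) : lowers j -> has_unit_mean j -> has_unit_mean (S j).
Proof.
  intros D I z k q Hz Hq.
  assert (D1 := lowers_succ j D I).
  assert (Hz1 := in_strip_succ j z Hz).
  assert (E := ramp_of_lowered (S j) z k q D1 Hz Hq).
  rewrite (shift_ext (z - 1) (fun i => Cunit_int (ramp q) (cont_coef (S j) (z + 1) i) q)
    (fun i => Cunit_int (ramp q) (cont_coef j (z + 1) i) q)) in E.
  2:{ intro i. apply Cunit_int_ext; [exact Hq|]. intros t Ht. apply cont_coef_succ; assumption. }
  set (A := Cunit_int flat (cont_coef (S j) z k) q) in *.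
  simpl cont_coef in E.
  set (J := shift (z - 1) (fun i => Cunit_int (ramp q) (cont_coef j (z + 1) i) q) k) in *.
  set (p := pow_coef (z - 1) k q) in *.
  replace A with (p + J - (p + J - A))%C by ring. rewrite <- E. ring.
Qed.

Lemma cont_coef_props (j : nat) : lowers j /\ has_unit_mean j.
Proof.
  induction j as [|j [D I]].
  - split; [apply lowers_0|apply has_unit_mean_0].
  - split; [apply lowers_succ|apply has_unit_mean_succ]; assumption.
Qed.

Lemma cont_coef_stable (j i : nat) (z : C) (k : nat) (q : R) :
  in_strip j z -> (j <= i)%nat -> 0 < q -> cont_coef i z k q = cont_coef j z k q.
Proof.
  intros Hz Hi Hq. induction Hi as [|i Hi IH]; [reflexivity|].
  destruct (cont_coef_props i) as [D I].
  rewrite cont_coef_succ; [exact IH|exact D|exact I|apply (in_strip_weaken j)|exact Hq]; assumption.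
Qed.

Lemma cont_coef_continuous (j : nat) (z : C) (k : nat) :
  in_strip j z -> Cpos_continuous (cont_coef j z k).
Proof. intros Hz. apply lowers_continuous; [apply cont_coef_props|exact Hz]. Qed.

(** * Analyticity of the continuation in [z] *)

Definition taylor_bounded (j : nat) (z : C) (rho : R) : Prop :=
  forall q1 q2, 0 < q1 <= q2 -> exists N, forall q k, q1 <= q <= q2 ->
    Cmod (cont_coef j z k q) * rho ^ k <= N.

Definition taylor_expands (j : nat) (z : C) (rho : R) : Prop :=
  forall w q, Cmod w < rho -> 0 < q ->
    Cpseries (fun k => cont_coef j z k q) w (cont_coef j (z + w) 0 q).

Lemma shift_bound (a : C) (c : nat -> C) (rho N : R) (k : nat) :
  0 < rho -> (forall i, Cmod (c i) * rho ^ i <= N) ->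
  Cmod (shift a c k) * rho ^ k <= (Cmod a + rho) * N.
Proof.
  intros Hr H. assert (P := pow_lt rho k Hr). assert (A := Cmod_ge_0 a).
  assert (HN : 0 <= N).
  { eapply Rle_trans; [|apply (H 0%nat)]. simpl. rewrite Rmult_1_r. apply Cmod_ge_0. }
  apply Rle_trans with ((Cmod a * Cmod (c k)
    + match k with 0%nat => 0 | S i => Cmod (c i) end) * rho ^ k).
  - apply Rmult_le_compat_r; [lra|]. unfold shift.
    eapply Rle_trans; [apply Cmod_triangle|]. rewrite Cmod_mult.
    apply Rplus_le_compat_l. destruct k; [rewrite Cmod_0|]; lra.
  - assert (Hk := H k). destruct k as [|k].
    + simpl in *. nra.
    + assert (Hk' := H k). simpl in *.
      apply (Rmult_le_compat_l (Cmod a)) in Hk; [|exact A].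
      apply (Rmult_le_compat_l rho) in Hk'; [|lra]. lra.
Qed.

Lemma shift_pseries (a w l : C) (c : nat -> C) :
  Cpseries c w l -> Cpseries (shift a c) w ((a + w) * l)%C.
Proof.
  intros H.
  assert (H1 := is_pseries_scal (K := C_AbsRing) (V := C_NormedModule) a c w l (Cmult_comm w a) H).
  assert (H2 := is_pseries_incr_1 (K := C_AbsRing) (V := C_NormedModule) c w l H).
  assert (H3 := is_pseries_plus (K := C_AbsRing) (V := C_NormedModule) _ _ _ _ _ H1 H2).
  replace ((a + w) * l)%C with (a * l + w * l)%C by ring.
  revert H3. apply is_pseries_ext. intro k. destruct k; reflexivity.
Qed.

Lemma bound_smaller_radius (x r s N : R) (k : nat) :
  0 <= x -> 0 < r <= s -> x * s ^ k <= N -> x * r ^ k <= N.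
Proof.
  intros Hx Hr H. eapply Rle_trans; [|exact H].
  apply Rmult_le_compat_l; [exact Hx|]. apply pow_incr. lra.
Qed.

Lemma ln_compact_bound (q1 q2 : R) :
  0 < q1 <= q2 -> exists L, forall q, q1 <= q <= q2 -> Rabs (ln q) <= L.
Proof.
  intros [H1 H2]. exists (Rabs (ln q1) + Rabs (ln q2)). intros q Hq.
  assert (L1 : ln q1 <= ln q) by (apply ln_le; lra).
  assert (L2 : ln q <= ln q2) by (apply ln_le; lra).
  unfold Rabs. destruct (Rcase_abs (ln q1)), (Rcase_abs (ln q2)), (Rcase_abs (ln q)); lra.
Qed.

Lemma exp_mult_le (s x L : R) : Rabs x <= L -> exp (s * x) <= exp (Rabs s * L).
Proof.
  intros H.
  assert (E : s * x <= Rabs s * L).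
  { eapply Rle_trans; [apply Rle_abs|]. rewrite Rabs_mult.
    apply Rmult_le_compat_l; [apply Rabs_pos|exact H]. }
  destruct E as [E|E]; [left; apply exp_increasing, E|rewrite E; lra].
Qed.

Lemma pow_coef_compact_bound (z : C) (rho q1 q2 : R) :
  0 < rho -> 0 < q1 <= q2 -> exists N, forall q k, q1 <= q <= q2 ->
    Cmod (pow_coef z k q) * rho ^ k <= N.
Proof.
  intros Hr Hq. destruct (ln_compact_bound q1 q2 Hq) as [L HL].
  eexists. intros q k Hqq.
  eapply Rle_trans; [apply pow_coef_bound, Hr|].
  apply Rplus_le_compat; apply exp_mult_le, HL, Hqq.
Qed.

Lemma Cunit_int_sum (w : R -> R) (f : nat -> R -> C) (K : nat) (q : R) :
  (forall t, continuous w t) -> (forall i, Cpos_continuous (f i)) -> 0 < q ->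
  Cpos_continuous (fun t => sum_n (fun k => f k t) K) /\
  Cunit_int w (fun t => sum_n (fun k => f k t) K) q = sum_n (fun k => Cunit_int w (f k) q) K.
Proof.
  intros Hw H Hq. induction K as [|K [IH1 IH2]].
  - rewrite sum_O. split.
    + apply (Cpos_continuous_ext (f 0%nat)); [|apply H]. intros t _. rewrite sum_O. reflexivity.
    + apply Cunit_int_ext; [exact Hq|]. intros t _. rewrite sum_O. reflexivity.
  - rewrite sum_Sn, <- IH2.
    assert (E : forall t, (RtoC 1 * sum_n (fun k => f k t) K + RtoC 1 * f (S K) t)%C
                          = sum_n (fun k => f k t) (S K)).
    { intro t. rewrite sum_Sn. Cring. }
    split.
    + eapply Cpos_continuous_ext; [intros t _; apply E|].
      apply Cpos_continuous_lin; [exact IH1|apply H].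
    + rewrite <- (Cunit_int_ext w _ _ q Hq (fun t _ => E t)).
      rewrite Cunit_int_lin; auto. Cring.
Qed.

(** Termwise integration: on [[q, q + 1]] the remainders after [K] terms obey one geometric bound,
    and their weighted integrals inherit it. *)
Lemma ramp_pseries (j : nat) (z w : C) (rho q : R) :
  in_strip j z -> in_strip j (z + w) -> 0 < rho -> Cmod w < rho -> 0 < q ->
  taylor_bounded j z rho -> taylor_expands j z rho ->
  Cpseries (fun k => Cunit_int (ramp q) (cont_coef j z k) q) w
    (Cunit_int (ramp q) (cont_coef j (z + w) 0) q).
Proof.
  intros Hz Hzw Hr Hw Hq HB HE.
  assert (Hx := Cmod_ratio w rho Hw). set (x := Cmod w / rho) in *.
  destruct (HB q (q + 1)) as [N HN]; [lra|].
  apply (Cpseries_of_remainder _ w _ (2 * (N / (1 - x))) x Hx). intro K.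
  assert (Cc := fun k => cont_coef_continuous j z k Hz).
  assert (Cc' : forall k, Cpos_continuous (fun t => w ^ k * cont_coef j z k t)%C).
  { intro k. apply (Cpos_continuous_ext (fun t => w ^ k * cont_coef j z k t + RtoC 0 * cont_coef j z k t)%C);
      [intros; ring|]. apply Cpos_continuous_lin; apply Cc. }
  destruct (Cunit_int_sum (ramp q) (fun k t => w ^ k * cont_coef j z k t)%C K q
    (continuous_ramp q) Cc' Hq) as [S1 S2].
  assert (E : (Cunit_int (ramp q) (cont_coef j (z + w) 0) q
     - sum_n (fun k => w ^ k * Cunit_int (ramp q) (cont_coef j z k) q) K)%C
    = Cunit_int (ramp q) (fun t => RtoC 1 * cont_coef j (z + w) 0 t
         + RtoC (-1) * sum_n (fun k => w ^ k * cont_coef j z k t) K)%C q).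
  { rewrite Cunit_int_lin; [|apply continuous_ramp|apply cont_coef_continuous, Hzw|exact S1|exact Hq].
    rewrite S2.
    rewrite (sum_n_ext (fun k => Cunit_int (ramp q) (fun t => w ^ k * cont_coef j z k t)%C q)
      (fun k => w ^ k * Cunit_int (ramp q) (cont_coef j z k) q)%C).
    - rewrite RtoC_m1. Cring.
    - intro k.
      rewrite (Cunit_int_ext _ _ (fun t => w ^ k * cont_coef j z k t + RtoC 0 * cont_coef j z k t)%C q Hq)
        by (intros; ring).
      rewrite Cunit_int_lin; auto; [|apply continuous_ramp]. Cring. }
  rewrite E. replace (2 * (N / (1 - x)) * x ^ S K) with (2 * (N * x ^ S K / (1 - x)))
    by (field; lra).
  apply Cunit_int_norm_le.
  - apply continuous_ramp.
  - apply Cpos_continuous_lin; [apply cont_coef_continuous, Hzw|exact S1].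
  - exact Hq.
  - apply ramp_le_1.
  - intros t Ht.
    replace (RtoC 1 * cont_coef j (z + w) 0 t + RtoC (-1) * sum_n (fun k => w ^ k * cont_coef j z k t) K)%C
      with (cont_coef j (z + w) 0 t - sum_n (fun k => w ^ k * cont_coef j z k t) K)%C
      by (rewrite RtoC_m1; Cring).
    apply Cpseries_remainder.
    + intro k. apply HN, Ht.
    + exact Hw.
    + apply HE; [exact Hw|lra].
Qed.

(** The radius stays below the distance from [z] to the edge of its strip, so an expansion never
    leaves the region where [cont_coef j] is meaningful. That distance is the same for [z] at step
    [j + 1] and for [z + 1] at step [j], so one radius passes through the recursion unchanged. *)
Lemma cont_coef_taylor (j : nat) : forall z, in_strip j z ->
  exists rho, 0 < rho < Re z - 2 + INR j /\ taylor_bounded j z rho /\ taylor_expands j z rho.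
Proof.
  induction j as [|j IH]; intros z Hz.
  - unfold in_strip in Hz. simpl INR in *.
    set (rho := Rmin (abscissa_gap z) ((Re z - 2) / 2)).
    assert (M1 : rho <= abscissa_gap z) by apply Rmin_l.
    assert (M2 : rho <= (Re z - 2) / 2) by apply Rmin_r.
    assert (M3 : 0 < rho) by (apply Rmin_pos; unfold abscissa_gap; lra).
    exists rho. split; [lra|]. split.
    + intros q1 q2 Hq. destruct (series_coef_bound z q1) as [N HN]; [lra..|].
      exists ((Cmod (z - 1) + rho) * N). intros q k Hqq. simpl cont_coef.
      apply shift_bound; [exact M3|]. intro i.
      apply (bound_smaller_radius _ rho (abscissa_gap z)); [apply Cmod_ge_0|lra|].
      apply HN. lra.
    + intros w q Hw Hq. simpl cont_coef.
      replace (shift (z + w - 1) (fun i => series_coef (z + w) i q) 0)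
        with ((z - 1 + w) * series_coef (z + w) 0 q)%C by (unfold shift; ring).
      apply shift_pseries, series_coef_pseries; lra.
  - assert (Hz1 := in_strip_succ j z Hz).
    destruct (IH _ Hz1) as [rho [Hr [HB HE]]].
    rewrite Re_plus in Hr. simpl (Re 1) in Hr.
    exists rho. split; [rewrite S_INR; lra|]. split.
    + intros q1 q2 Hq.
      destruct (pow_coef_compact_bound (z - 1) rho q1 q2 ltac:(lra) Hq) as [N1 HN1].
      (* The integrals over [[q, q + 1]] with [q <= q2] reach up to [q2 + 1]. *)
      destruct (HB q1 (q2 + 1)) as [N2 HN2]; [lra|].
      exists (N1 + (Cmod (z - 1) + rho) * (2 * N2)). intros q k Hqq. simpl cont_coef.
      eapply Rle_trans; [apply Rmult_le_compat_r; [apply pow_le; lra|apply Cmod_triangle]|].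
      rewrite Rmult_plus_distr_r. apply Rplus_le_compat; [apply HN1, Hqq|].
      apply shift_bound; [lra|]. intro i.
      assert (P := pow_lt rho i (proj1 Hr)).
      apply Rle_trans with (2 * (N2 / rho ^ i) * rho ^ i); [|right; field; lra].
      apply Rmult_le_compat_r; [lra|].
      apply Cunit_int_norm_le.
      * apply continuous_ramp.
      * apply cont_coef_continuous, Hz1.
      * lra.
      * apply ramp_le_1.
      * intros t Ht. apply (Rmult_le_reg_r (rho ^ i)); [exact P|].
        replace (N2 / rho ^ i * rho ^ i) with N2 by (field; lra).
        apply HN2. lra.
    + intros w q Hw Hq. simpl cont_coef.
      assert (Hzw : in_strip j (z + 1 + w)).
      { assert (T := re_le_Cmod w). apply Rabs_le_between in T.
        unfold in_strip. rewrite !Re_plus. simpl (Re 1). lra. }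
      assert (H1 := pow_coef_pseries (z - 1) w q).
      assert (H2 := shift_pseries (z - 1) w _ _
        (ramp_pseries j (z + 1) w rho q Hz1 Hzw (proj1 Hr) Hw Hq HB HE)).
      assert (H3 := is_pseries_plus (K := C_AbsRing) (V := C_NormedModule) _ _ _ _ _ H1 H2).
      match type of H3 with Cpseries _ _ ?l => match goal with |- Cpseries _ _ ?l' =>
        replace l' with l; [exact H3|] end end.
      unfold pow_coef, shift.
      replace (z + w + 1)%C with (z + 1 + w)%C by ring.
      replace (z + w - 1)%C with (z - 1 + w)%C by ring.
      simpl pow. simpl fact. simpl INR. replace (1 / 1) with 1 by field.
      Cring.
Qed.

Definition strip_index (z : C) : nat := Z.to_nat (up (2 - Re z)).

Lemma in_strip_index (z : C) : in_strip (strip_index z) z.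
Proof.
  unfold in_strip, strip_index.
  destruct (archimed (2 - Re z)) as [H _].
  assert (L : IZR (up (2 - Re z)) <= INR (Z.to_nat (up (2 - Re z)))).
  { rewrite INR_IZR_INZ. apply IZR_le. lia. }
  lra.
Qed.

(** Taylor coefficients at [z] of the entire function [(z - 1) zeta (z, q)]. *)
Definition taylor (z : C) (k : nat) (q : R) : C := cont_coef (strip_index z) z k q.

(** Two admissible steps are compared through a later one, [strip_index z + j]. *)
Lemma taylor_eq (j : nat) (z : C) (k : nat) (q : R) :
  in_strip j z -> 0 < q -> taylor z k q = cont_coef j z k q.
Proof.
  intros Hz Hq. unfold taylor.
  rewrite <- (cont_coef_stable j (strip_index z + j)) by (try assumption; lia).
  rewrite <- (cont_coef_stable (strip_index z) (strip_index z + j))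
    by (try assumption; try apply in_strip_index; lia).
  reflexivity.
Qed.

Lemma Cderive_taylor (z : C) (k : nat) (q : R) :
  0 < q -> Cderive (taylor z k) q (- shift (z - 1) (fun i => taylor (z + 1) i q) k)%C.
Proof.
  intros Hq.
  assert (Hz := in_strip_index z).
  rewrite (shift_ext (z - 1) _ (fun i => cont_coef (strip_index z) (z + 1) i q))
    by (intro i; apply taylor_eq; [apply in_strip_plus1, Hz|exact Hq]).
  apply cont_coef_props; assumption.
Qed.

Lemma taylor_unit_mean (z : C) (k : nat) (q : R) :
  0 < q -> Cunit_int flat (taylor z k) q = pow_coef (z - 1) k q.
Proof.
  intros Hq. apply cont_coef_props; [apply in_strip_index|exact Hq].
Qed.

(** The increment over a unit interval is the integral of the derivative, hence up to the factor
    [z - 1] the mean at [z + 1], which is an explicit power. *)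
Lemma taylor_difference (z : C) (k : nat) (q : R) :
  0 < q ->
  (taylor z k (q + 1)%R - taylor z k q = - shift (z - 1) (fun i => pow_coef z i q) k)%C.
Proof.
  intros Hq.
  assert (Cc : forall i, Cpos_continuous (taylor (z + 1) i)).
  { intro i. apply cont_coef_continuous, in_strip_index. }
  assert (E := Cflat_int_derive (taylor z k) _ q Hq (fun x Hx => Cderive_taylor z k x Hx)
    (Cpos_continuous_opp _ (Cpos_continuous_shift (z - 1) (taylor (z + 1)) k Cc))).
  rewrite <- E.
  rewrite Cunit_int_opp; [|apply continuous_flat|apply Cpos_continuous_shift, Cc|exact Hq].
  rewrite (Cunit_int_shift flat (z - 1) (taylor (z + 1)) k q continuous_flat Cc Hq).
  f_equal. apply shift_ext. intro i. rewrite taylor_unit_mean by exact Hq.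
  rewrite Cplus1_minus1. reflexivity.
Qed.

Lemma taylor_local (z : C) (q : R) :
  0 < q -> exists rho, 0 < rho /\
    (exists N, forall k, Cmod (taylor z k q) * rho ^ k <= N) /\
    (forall w, Cmod w < rho -> Cpseries (fun k => taylor z k q) w (taylor (z + w) 0 q)).
Proof.
  intros Hq.
  destruct (cont_coef_taylor _ z (in_strip_index z)) as [rho [Hr [HB HE]]].
  exists rho. split; [lra|]. split.
  - destruct (HB q q) as [N HN]; [lra|]. exists N. intro k. apply HN. lra.
  - intros w Hw.
    rewrite (taylor_eq (strip_index z) (z + w)); [apply HE; assumption| |exact Hq].
    assert (T := re_le_Cmod w). apply Rabs_le_between in T.
    unfold in_strip. rewrite Re_plus. lra.
Qed.

Lemma taylor_series (z : C) (q : R) :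
  2 < Re z -> 0 < q -> taylor z 0 q = ((z - 1) * series_coef z 0 q)%C.
Proof.
  intros Hz Hq. rewrite (taylor_eq 0) by (unfold in_strip; simpl; lra).
  simpl. unfold shift. ring.
Qed.

(** * Values and derivatives of the zeta function at the nonpositive integers *)

(** Taylor coefficients of [f (z) / (a + (z - z0))] from those of [f]. *)
Fixpoint unshift (a : C) (c : nat -> C) (k : nat) : C :=
  match k with
  | 0%nat => (c 0%nat / a)%C
  | S i => ((c (S i) - unshift a c i) / a)%C
  end.

Lemma shift_unshift (a : C) (c : nat -> C) (k : nat) :
  a <> RtoC 0 -> shift a (unshift a c) k = c k.
Proof. intros Ha. unfold shift. destruct k; simpl; field; exact Ha. Qed.

(** The bound reproduces itself along the recursion: since [2 rho <= Cmod a], the subtracted earlier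
    coefficient contributes at most another [N]. *)
Lemma unshift_bound (a : C) (c : nat -> C) (rho N : R) (k : nat) :
  0 < rho -> 2 * rho <= Cmod a -> (forall i, Cmod (c i) * rho ^ i <= N) ->
  Cmod (unshift a c k) * rho ^ k <= 2 * N / Cmod a.
Proof.
  intros Hr Ha H.
  assert (Ha0 : a <> RtoC 0) by (apply Cmod_gt_0; lra).
  assert (HN : 0 <= N).
  { eapply Rle_trans; [|apply (H 0%nat)]. simpl. rewrite Rmult_1_r. apply Cmod_ge_0. }
  induction k as [|k IH]; simpl.
  - specialize (H 0%nat). simpl in H. rewrite Cmod_div by exact Ha0.
    rewrite Rmult_1_r in *. apply Rmult_le_compat_r; [|lra].
    left. apply Rinv_0_lt_compat. lra.
  - assert (P := pow_lt rho k Hr).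
    rewrite Cmod_div by exact Ha0. unfold Rdiv.
    replace (Cmod (c (S k) - unshift a c k) * / Cmod a * (rho * rho ^ k))
      with (Cmod (c (S k) - unshift a c k) * (rho * rho ^ k) * / Cmod a) by ring.
    apply Rmult_le_compat_r; [left; apply Rinv_0_lt_compat; lra|].
    apply Rle_trans with ((Cmod (c (S k)) + Cmod (unshift a c k)) * (rho * rho ^ k)).
    + apply Rmult_le_compat_r; [nra|]. unfold Cminus.
      eapply Rle_trans; [apply Cmod_triangle|]. rewrite Cmod_opp. lra.
    + specialize (H (S k)). simpl in H.
      assert (E : rho * (Cmod (unshift a c k) * rho ^ k) <= N).
      { apply Rle_trans with (rho * (2 * N / Cmod a)).
        - apply Rmult_le_compat_l; lra.
        - replace (rho * (2 * N / Cmod a)) with (N * (2 * rho) / Cmod a) by (field; lra).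
          apply Rle_div_l; [lra|]. nra. }
      lra.
Qed.

(** The bound gives convergence to some [d]; multiplying back by [a + w] recovers the series of [c],
    so [d = l / (a + w)] by uniqueness of sums. *)
Lemma unshift_pseries (a w l : C) (c : nat -> C) (rho N : R) :
  0 < rho -> 2 * rho <= Cmod a -> (forall i, Cmod (c i) * rho ^ i <= N) ->
  Cmod w < rho -> Cpseries c w l -> Cpseries (unshift a c) w (l / (a + w))%C.
Proof.
  intros Hr Ha H Hw Hl.
  assert (Ha0 : a <> RtoC 0) by (apply Cmod_gt_0; lra).
  assert (Haw : (a + w)%C <> RtoC 0).
  { intros E. assert (E' : a = (- w)%C) by (replace a with (a + w - w)%C by ring; rewrite E; ring).
    rewrite E', Cmod_opp in Ha. assert (G := Cmod_ge_0 w). lra. }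
  destruct (Cpseries_ex (unshift a c) w rho _ (fun k => unshift_bound a c rho N k Hr Ha H) Hw)
    as [d Hd].
  assert (S := shift_pseries a w d _ Hd).
  apply (is_pseries_ext (K := C_AbsRing) (V := C_NormedModule) _ c) in S;
    [|intro k; apply shift_unshift, Ha0].
  apply Cpseries_series in S. apply Cpseries_series in Hl.
  assert (E := Cseries_unique _ _ _ S Hl).
  change (@eq C ((a + w) * d)%C l) in E.
  assert (Ed : @eq C (l / (a + w))%C d) by (rewrite <- E; field; exact Haw).
  rewrite Ed. exact Hd.
Qed.

(** * The continued zeta function and its uniqueness *)

Definition zeta_cont (q : R) (z : C) : C := (taylor z 0 q / (z - 1))%C.

Lemma Cminus_neq_0 (z w : C) : z <> w -> (z - w)%C <> RtoC 0.
Proof. intros H E. apply H. replace z with (z - w + w)%C by ring. rewrite E. ring. Qed.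

Lemma zeta_cont_pseries (q : R) (z0 : C) :
  0 < q -> z0 <> RtoC 1 ->
  exists rho N, 0 < rho /\
    (forall k, Cmod (unshift (z0 - 1) (fun i => taylor z0 i q) k) * rho ^ k <= N) /\
    forall w, Cmod w < rho ->
      Cpseries (unshift (z0 - 1) (fun i => taylor z0 i q)) w (zeta_cont q (z0 + w)).
Proof.
  intros Hq Hz. destruct (taylor_local z0 q Hq) as [r [Hr [[N HN] HE]]].
  assert (Ha : 0 < Cmod (z0 - 1)) by (apply Cmod_gt_0, Cminus_neq_0, Hz).
  set (rho := Rmin r (Cmod (z0 - 1) / 2)).
  assert (M1 : rho <= r) by apply Rmin_l.
  assert (M2 : rho <= Cmod (z0 - 1) / 2) by apply Rmin_r.
  assert (M3 : 0 < rho) by (apply Rmin_pos; lra).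
  assert (HN' : forall k, Cmod (taylor z0 k q) * rho ^ k <= N).
  { intro k. apply (bound_smaller_radius _ rho r); [apply Cmod_ge_0|lra|apply HN]. }
  exists rho, (2 * N / Cmod (z0 - 1)). split; [exact M3|]. split.
  - intro k. apply unshift_bound; [exact M3|lra|exact HN'].
  - intros w Hw. unfold zeta_cont.
    replace (z0 + w - 1)%C with (z0 - 1 + w)%C by ring.
    apply (unshift_pseries _ _ _ _ rho N); [exact M3|lra|exact HN'|exact Hw|].
    apply HE. lra.
Qed.

Lemma zeta_cont_analytic (q : R) (z : C) :
  0 < q -> z <> RtoC 1 -> analytic_at (zeta_cont q) z.
Proof.
  intros Hq Hz. destruct (zeta_cont_pseries q z Hq Hz) as [rho [N [Hr [_ HE]]]].
  exists (unshift (z - 1) (fun i => taylor z i q)), rho. split; [exact Hr|].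
  intros x Hx. specialize (HE (x - z)%C Hx).
  replace (z + (x - z))%C with x in HE by ring. exact HE.
Qed.

Lemma series_coef_analytic (q : R) (z : C) :
  0 < q -> 1 < Re z -> analytic_at (fun z => series_coef z 0 q) z.
Proof.
  intros Hq Hz. exists (fun k => series_coef z k q), (abscissa_gap z).
  split; [unfold abscissa_gap; lra|].
  intros x Hx. assert (H := series_coef_pseries z (x - z) q Hz Hq Hx).
  replace (z + (x - z))%C with x in H by ring. exact H.
Qed.

Lemma Re_ne_1 (z : C) : 1 < Re z -> z <> RtoC 1.
Proof. intros H ->. simpl in H. lra. Qed.

(** The construction gives equality only for [Re z > 2]. The identity theorem along the segment from
    [z + 2] to [z], which stays in [Re z > 1], supplies the remaining strip. *)
Lemma zeta_cont_series (q : R) (z : C) :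
  0 < q -> 1 < Re z -> zeta_cont q z = series_coef z 0 q.
Proof.
  intros Hq Hz.
  assert (Hseg : forall t : R, 0 <= t <= 1 -> 1 < Re (z + 2 + RtoC t * (z - (z + 2)))).
  { intros t Ht. unfold Re, Cplus, Cmult, Cminus, Copp, RtoC in *. simpl. nra. }
  apply (identity_along_segment (zeta_cont q) (fun z => series_coef z 0 q) (z + 2)%C z 1).
  - intros t Ht. apply zeta_cont_analytic; [exact Hq|]. apply Re_ne_1, Hseg, Ht.
  - intros t Ht. apply series_coef_analytic; [exact Hq|]. apply Hseg, Ht.
  - lra.
  - intros x Hx.
    assert (Hx2 : 2 < Re x).
    { assert (T := re_le_Cmod (x - (z + 2))). apply Rabs_le_between in T.
      unfold Re, Cplus, Cmult, Cminus, Copp, RtoC in *. simpl in *. lra. }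
    unfold zeta_cont. rewrite taylor_series by assumption. field.
    apply Cminus_neq_0, Re_ne_1. lra.
Qed.

Lemma zeta_cont_is_hurwitz_zeta (q : R) : 0 < q -> is_hurwitz_zeta q (zeta_cont q).
Proof.
  intros Hq. split.
  - intros z Hz. apply zeta_cont_analytic; assumption.
  - intros z Hz. rewrite zeta_cont_series by assumption.
    apply (Cseries_ext (fun n => pow_coef z 0 (q + INR n))).
    + intro n. unfold pow_coef. simpl pow. simpl fact. simpl INR.
      replace (1 / 1) with 1 by field. rewrite (Rplus_comm q). ring.
    + apply series_coef_correct; assumption.
Qed.

(** The segment from [3 + i] to the real point [x] avoids the pole. *)
Lemma is_hurwitz_zeta_unique (q x : R) (f g : C -> C) :
  is_hurwitz_zeta q f -> is_hurwitz_zeta q g -> x <> 1 -> f (RtoC x) = g (RtoC x).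
Proof.
  intros [Fa Fs] [Ga Gs] Hx.
  set (z1 := (3, 1) : C).
  assert (Hseg : forall t : R, 0 <= t <= 1 -> (z1 + RtoC t * (RtoC x - z1))%C <> RtoC 1).
  { intros t Ht E. assert (E1 := f_equal Re E). assert (E2 := f_equal Im E).
    unfold z1, Re, Im, Cplus, Cmult, Cminus, Copp, RtoC in E1, E2. simpl in E1, E2.
    assert (t = 1) by lra. subst t. apply Hx. lra. }
  apply (identity_along_segment f g z1 (RtoC x) 1).
  - intros t Ht. apply Fa, Hseg, Ht.
  - intros t Ht. apply Ga, Hseg, Ht.
  - lra.
  - intros z Hz.
    assert (Hz1 : 1 < Re z).
    { assert (T := re_le_Cmod (z - z1)). apply Rabs_le_between in T.
      unfold z1, Re, Cplus, Cmult, Cminus, Copp, RtoC in *. simpl in *. lra. }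
    exact (Cseries_unique _ _ _ (Fs z Hz1) (Gs z Hz1)).
Qed.

Lemma hurwitz_zeta_eq (q x : R) :
  0 < q -> x <> 1 -> hurwitz_zeta (RtoC x) q = zeta_cont q (RtoC x).
Proof.
  intros Hq Hx.
  apply (is_hurwitz_zeta_unique q x (fun z => hurwitz_zeta z q) (zeta_cont q)); [|apply zeta_cont_is_hurwitz_zeta, Hq|exact Hx].
  unfold hurwitz_zeta.
  exact (epsilon_spec (inhabits (fun _ : C => RtoC 0)) (is_hurwitz_zeta q)
    (ex_intro _ _ (zeta_cont_is_hurwitz_zeta q Hq))).
Qed.

(** * The complex derivative at a real point *)

Lemma real_axis_difference_quotient (f : C -> C) (c : nat -> C) (rho N x0 : R) :
  0 < rho -> (forall k, Cmod (c k) * rho ^ k <= N) ->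
  (forall w, Cmod w < rho -> Cpseries c w (f (RtoC x0 + w)%C)) ->
  forall h : R, h <> 0 -> Rabs h <= rho / 2 ->
    Cmod ((f (RtoC (x0 + h)) - f (RtoC x0)) / RtoC h - c 1%nat) <= 2 * N / rho ^ 2 * Rabs h.
Proof.
  intros Hr H HE h Hh Hhr.
  assert (Hc : Cmod (RtoC h) = Rabs h) by apply Cmod_R.
  assert (F0 : f (RtoC x0) = c 0%nat).
  { assert (T := HE (RtoC 0)). rewrite Cmod_0, Cplus_0_r in T. specialize (T Hr).
    assert (Z := is_pseries_0 (K := C_AbsRing) (V := C_NormedModule) c).
    apply Cpseries_series in T. apply Cpseries_series in Z.
    exact (Cseries_unique _ _ _ T Z). }
  assert (T := Cpseries_remainder_half c (RtoC h) (f (RtoC x0 + RtoC h)%C) rho N 1 H Hr).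
  rewrite Hc in T. specialize (T Hhr (HE (RtoC h) ltac:(rewrite Hc; lra))).
  rewrite <- RtoC_plus, sum_Sn, sum_O in T.
  change (Cmod (f (RtoC (x0 + h)) - (RtoC h ^ 0 * c 0%nat + RtoC h ^ 1 * c 1%nat))
    <= 2 * N * (Rabs h / rho) ^ 2) in T.
  assert (Hh' : RtoC h <> RtoC 0) by (intros E; apply Hh; exact (f_equal fst E)).
  assert (Hp : 0 < Rabs h) by (apply Rabs_pos_lt, Hh).
  replace ((f (RtoC (x0 + h)) - f (RtoC x0)) / RtoC h - c 1%nat)%C
    with ((f (RtoC (x0 + h)) - (RtoC h ^ 0 * c 0%nat + RtoC h ^ 1 * c 1%nat)) / RtoC h)%C
    by (rewrite F0; simpl Cpow; field; exact Hh').
  rewrite Cmod_div, Hc by exact Hh'. apply Rle_div_l; [exact Hp|].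
  eapply Rle_trans; [exact T|]. right. field. lra.
Qed.

Lemma Re_C_derive (f : C -> C) (c : nat -> C) (rho N x0 : R) :
  0 < rho -> (forall k, Cmod (c k) * rho ^ k <= N) ->
  (forall w, Cmod w < rho -> Cpseries c w (f (RtoC x0 + w)%C)) ->
  Re (C_derive f (RtoC x0)) = Re (c 1%nat).
Proof.
  intros Hr H HE.
  (* [C_derive] takes its limit along the horizontal line through the point, here the real axis. *)
  change (real (Lim (fun x => Re ((f (RtoC x) - f (RtoC x0)) / (RtoC x - RtoC x0))) x0)
    = Re (c 1%nat)).
  rewrite (is_lim_unique _ _ (Finite (Re (c 1%nat)))); [reflexivity|].
  apply is_lim_spec. intros eps.
  set (K := 2 * N / rho ^ 2).
  assert (HK : 0 < Rabs K + 1) by (assert (P := Rabs_pos K); lra).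
  assert (Hd : 0 < Rmin (rho / 2) (eps / (Rabs K + 1))).
  { apply Rmin_pos; [lra|]. apply Rdiv_lt_0_compat; [apply cond_pos|exact HK]. }
  exists (mkposreal _ Hd). intros y Hy Hne.
  apply R_ball in Hy; simpl in Hy.
  assert (M1 := Rmin_l (rho / 2) (eps / (Rabs K + 1))).
  assert (M2 := Rmin_r (rho / 2) (eps / (Rabs K + 1))).
  set (h := y - x0) in *.
  assert (Hh : h <> 0) by (unfold h; lra).
  assert (T := real_axis_difference_quotient f c rho N x0 Hr H HE h Hh ltac:(lra)).
  fold K in T. rewrite <- RtoC_minus. fold h.
  replace y with (x0 + h) by (unfold h; ring).
  replace (Re ((f (RtoC (x0 + h)) - f (RtoC x0)) / RtoC h) - Re (c 1%nat))
    with (Re ((f (RtoC (x0 + h)) - f (RtoC x0)) / RtoC h - c 1%nat)) by reflexivity.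
  eapply Rle_lt_trans; [apply re_le_Cmod|]. eapply Rle_lt_trans; [exact T|].
  assert (A : Rabs h * (Rabs K + 1) < eps).
  { replace (pos eps) with (eps / (Rabs K + 1) * (Rabs K + 1)) by (field; lra).
    apply Rmult_lt_compat_r; lra. }
  assert (KK := Rle_abs K). assert (P := Rabs_pos h). nra.
Qed.

(** Both limits run along the real axis, so agreement at real points, as given by [hurwitz_zeta_eq],
    can be transferred to the derivatives. *)
Lemma C_derive_real_ext (f g : C -> C) (x0 d : R) :
  0 < d -> (forall x, Rabs (x - x0) < d -> f (RtoC x) = g (RtoC x)) ->
  Re (C_derive f (RtoC x0)) = Re (C_derive g (RtoC x0)).
Proof.
  intros Hd H.
  change (real (Lim (fun x => Re ((f (RtoC x) - f (RtoC x0)) / (RtoC x - RtoC x0))) x0)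
    = real (Lim (fun x => Re ((g (RtoC x) - g (RtoC x0)) / (RtoC x - RtoC x0))) x0)).
  f_equal. apply Lim_ext_loc.
  exists (mkposreal d Hd). intros y Hy _.
  apply R_ball in Hy; simpl in Hy.
  rewrite !H; [reflexivity|..].
  - replace (x0 - x0) with 0 by ring. rewrite Rabs_R0. exact Hd.
  - exact Hy.
Qed.

(** [bern k] and [dzeta k] are the value and the derivative at [z = 1 - k] of
    [(z - 1) zeta (z, q)]; the former is the Bernoulli polynomial. *)
Definition bern (k : nat) (q : R) : R := Re (taylor (RtoC (1 - INR k)) 0 q).
Definition dzeta (k : nat) (q : R) : R := Re (taylor (RtoC (1 - INR k)) 1 q).

(** The quotient rule for [E (z) / (z - 1)] at [z - 1 = - k]; the factor [k] in [A_fun] cancels one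
    denominator. The leftover [bern k q / INR k] is what raises the harmonic number from [H_(k-1)]
    to [H_k]. *)
Lemma A_fun_eq (k : nat) (q : R) :
  (0 < k)%nat -> 0 < q -> A_fun k q = - (dzeta k q + bern k q / INR k).
Proof.
  intros Hk Hq. apply lt_INR in Hk. simpl INR in Hk.
  set (x0 := 1 - INR k).
  assert (Hx0 : RtoC x0 <> RtoC 1).
  { intros E. assert (E' := f_equal fst E). simpl in E'. unfold x0 in E'. lra. }
  unfold A_fun. fold x0.
  (* Within distance [INR k] of [1 - k] the pole at 1 is not met. *)
  rewrite (C_derive_real_ext _ (zeta_cont q) x0 (INR k) Hk).
  2:{ intros x Hx. apply hurwitz_zeta_eq; [exact Hq|].
      apply Rabs_def2 in Hx. unfold x0 in Hx. lra. }
  destruct (zeta_cont_pseries q (RtoC x0) Hq Hx0) as [rho [N [Hr [HN HE]]]].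
  rewrite (Re_C_derive (zeta_cont q) _ rho N x0 Hr HN HE). simpl unshift.
  assert (Ex : (RtoC x0 - 1)%C = RtoC (- INR k)).
  { rewrite <- RtoC_minus. f_equal. unfold x0. ring. }
  rewrite Ex. unfold dzeta, bern. fold x0.
  set (c0 := taylor x0 0 q). set (c1 := taylor x0 1 q).
  assert (Ei : (/ RtoC (- INR k))%C = RtoC (- / INR k)).
  { rewrite <- RtoC_inv by lra. f_equal. field. lra. }
  unfold Cdiv. rewrite Ei.
  unfold Re, Cminus, Cplus, Copp, Cmult, RtoC. simpl. field. lra.
Qed.

Lemma Re_shift_real (x : R) (c : nat -> C) (k : nat) :
  Re (shift (RtoC x) c k) = x * Re (c k) + match k with 0%nat => 0 | S i => Re (c i) end.
Proof.
  unfold shift. destruct k; unfold Re, Cplus, Cmult, RtoC; simpl; ring.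
Qed.

Lemma is_derive_bern (k : nat) (q : R) :
  0 < q -> is_derive (bern (S k)) q (INR (S k) * bern k q).
Proof.
  intros Hq. destruct (Cderive_taylor (RtoC (1 - INR (S k))) 0 q Hq) as [D _].
  replace (INR (S k) * bern k q) with
    (Re (- shift (RtoC (1 - INR (S k)) - 1) (fun i => taylor (RtoC (1 - INR (S k)) + 1) i q) 0)).
  - exact D.
  - rewrite <- RtoC_minus, <- RtoC_plus. 
    change (- Re (shift (RtoC (1 - INR (S k) - 1)) (fun i => taylor (1 - INR (S k) + 1)%R i q) 0)
      = INR (S k) * bern k q).
    rewrite Re_shift_real. unfold bern.
    replace (1 - INR (S k) + 1) with (1 - INR k) by (rewrite S_INR; ring). ring.
Qed.

(** The term [- bern k q] arises from differentiating in [z] the factor [z - 1] of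
    [dE/dq = - (z - 1) E (z + 1, q)]. *)
Lemma is_derive_dzeta (k : nat) (q : R) :
  0 < q -> is_derive (dzeta (S k)) q (INR (S k) * dzeta k q - bern k q).
Proof.
  intros Hq. destruct (Cderive_taylor (RtoC (1 - INR (S k))) 1 q Hq) as [D _].
  replace (INR (S k) * dzeta k q - bern k q) with
    (Re (- shift (RtoC (1 - INR (S k)) - 1) (fun i => taylor (RtoC (1 - INR (S k)) + 1) i q) 1)).
  - exact D.
  - rewrite <- RtoC_minus, <- RtoC_plus. 
    change (- Re (shift (RtoC (1 - INR (S k) - 1)) (fun i => taylor (1 - INR (S k) + 1)%R i q) 1)
      = INR (S k) * dzeta k q - bern k q).
    rewrite Re_shift_real. unfold bern, dzeta.
    replace (1 - INR (S k) + 1) with (1 - INR k) by (rewrite S_INR; ring). ring.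
Qed.

Lemma Rpower_C_real (y s : R) : Rpower_C y (RtoC s) = RtoC (exp (s * ln y)).
Proof.
  unfold Rpower_C, RtoC; simpl. rewrite Rmult_0_l, cos_0, sin_0. f_equal; ring.
Qed.

Lemma Re_pow_coef_real (s y : R) (k : nat) :
  Re (pow_coef (RtoC s) k y) = exp (- s * ln y) * ((- ln y) ^ k / INR (fact k)).
Proof.
  unfold pow_coef. rewrite <- RtoC_opp, Rpower_C_real, <- RtoC_mult. reflexivity.
Qed.

Lemma bern_difference (k : nat) (q : R) :
  0 < q -> bern (S k) (q + 1) - bern (S k) q = INR (S k) * q ^ k.
Proof.
  intros Hq. assert (D := f_equal Re (taylor_difference (RtoC (1 - INR (S k))) 0 q Hq)).
  rewrite <- RtoC_minus in D.
  change (bern (S k) (q + 1) - bern (S k) q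
    = - Re (shift (RtoC (1 - INR (S k) - 1)) (fun i => pow_coef (1 - INR (S k))%R i q) 0)) in D.
  rewrite Re_shift_real, Re_pow_coef_real in D. rewrite D.
  replace (- (1 - INR (S k)) * ln q) with (INR k * ln q) by (rewrite S_INR; ring).
  rewrite <- (Rpower_pow k q Hq). unfold Rpower. simpl pow. simpl fact. simpl (INR 1).
  field.
Qed.

(** The [z]-derivative at [z = 0] of [E (z, q + 1) - E (z, q) = - (z - 1) q^(-z)]. *)
Lemma dzeta_difference (q : R) : 0 < q -> dzeta 1 (q + 1) - dzeta 1 q = - ln q - 1.
Proof.
  intros Hq. assert (D := f_equal Re (taylor_difference (RtoC (1 - INR 1)) 1 q Hq)).
  rewrite <- RtoC_minus in D.
  change (dzeta 1 (q + 1) - dzeta 1 q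
    = - Re (shift (RtoC (1 - INR 1 - 1)) (fun i => pow_coef (1 - INR 1)%R i q) 1)) in D.
  rewrite Re_shift_real, !Re_pow_coef_real in D. rewrite D. simpl.
  replace (- (1 - 1) * ln q) with 0 by ring. rewrite exp_0. field.
Qed.

(** At [z = 1] the factor [z - 1] removes the integral from the recursion and leaves [q^0]. This is
    the residue of the zeta function at its pole. *)
Lemma bern_0 (q : R) : 0 < q -> bern 0 q = 1.
Proof.
  intros Hq. unfold bern. simpl INR. rewrite Rminus_0_r.
  (* Membership of [z = 1] in the strip reads [2 - j < 1], so 2 is the least step available. *)
  rewrite (taylor_eq 2) by (try exact Hq; unfold in_strip; simpl; lra).
  change (Re (pow_coef (RtoC 1 - 1) 0 q + shift (RtoC 1 - 1)
    (fun i => Cunit_int (ramp q) (cont_coef 1 (RtoC 1 + 1) i) q) 0) = 1).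
  rewrite Re_plus, <- RtoC_minus, Re_shift_real, Re_pow_coef_real.
  replace (1 - 1) with 0 by ring. simpl. replace (- 0 * ln q) with 0 by ring.
  rewrite exp_0. field.
Qed.

Lemma unit_int_nonneg (w g : R -> R) (q : R) :
  (forall t, continuous w t) -> pos_continuous g -> 0 < q ->
  (forall t, q <= t <= q + 1 -> 0 <= w t) -> (forall t, q <= t <= q + 1 -> 0 <= g t) ->
  0 <= unit_int w g q.
Proof.
  intros Hw Hg Hq Pw Pg. apply RInt_ge_0; [lra|apply unit_int_ex; assumption|].
  intros x Hx. apply Rmult_le_pos; [apply Pw|apply Pg]; lra.
Qed.

Lemma Cseries_Re_nonneg (a : nat -> C) (l : C) :
  (forall n, 0 <= Re (a n)) -> Cseries a l -> 0 <= Re l.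
Proof.
  intros H Ha. apply Rnot_lt_le. intros Hl.
  destruct (proj1 (Cseries_eps a l) Ha (- Re l)) as [N HN]; [lra|].
  specialize (HN N (Nat.le_refl N)).
  assert (P : 0 <= Re (sum_n a N)).
  { clear HN. induction N as [|N IH].
    - rewrite sum_O. apply H.
    - rewrite sum_Sn. change (0 <= Re (sum_n a N) + Re (a (S N))). specialize (H (S N)). lra. }
  assert (T := re_le_Cmod (sum_n a N - l)). apply Rabs_le_between in T.
  change (- Cmod (sum_n a N - l) <= Re (sum_n a N) - Re l <= Cmod (sum_n a N - l)) in T.
  lra.
Qed.

(** At [z = 1] only the derivative of the factor [z - 1] survives, giving [- E (2, q)]. One step of
    the recursion writes [E (2, q)] as [1 / q] plus a ramp integral of [E (3, t) = 2 zeta (3, t)],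
    all nonnegative. The sign is the convexity input of the Bohr-Mollerup argument. *)
Lemma is_derive_dzeta_0 (q : R) :
  0 < q -> exists l, l <= 0 /\ is_derive (dzeta 0) q l.
Proof.
  intros Hq. destruct (Cderive_taylor (RtoC (1 - INR 0)) 1 q Hq) as [D _].
  eexists. split; [|exact D].
  rewrite <- RtoC_minus, <- RtoC_plus. simpl INR.
  replace (1 - 0 - 1) with 0 by ring. replace (1 - 0 + 1) with 2 by ring.
  change (- Re (shift (RtoC 0) (fun i => taylor (RtoC 2) i q) 1) <= 0).
  rewrite Re_shift_real, Rmult_0_l, Rplus_0_l.
  rewrite (taylor_eq 1) by (try exact Hq; unfold in_strip; simpl; lra).
  change (- Re (pow_coef (RtoC 2 - 1) 0 q + shift (RtoC 2 - 1)
    (fun i => Cunit_int (ramp q) (cont_coef 0 (RtoC 2 + 1) i) q) 0) <= 0).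
  rewrite Re_plus, <- RtoC_minus, <- RtoC_plus, Re_shift_real, Re_pow_coef_real.
  assert (P := exp_pos (- (2 - 1) * ln q)).
  assert (J : 0 <= Re (Cunit_int (ramp q) (cont_coef 0 (RtoC (2 + 1)) 0) q)).
  { assert (S3 : in_strip 0 (RtoC (2 + 1))) by (unfold in_strip; simpl; lra).
    apply unit_int_nonneg.
    - apply continuous_ramp.
    - apply (cont_coef_continuous 0 _ 0 S3).
    - exact Hq.
    - intros t Ht. unfold ramp. lra.
    - intros t Ht. simpl cont_coef. rewrite <- RtoC_minus, Re_shift_real.
      assert (N : 0 <= Re (series_coef (RtoC (2 + 1)) 0 t)).
      { apply (Cseries_Re_nonneg (fun n => pow_coef (RtoC (2 + 1)) 0 (t + INR n))).
        - intro n. rewrite Re_pow_coef_real. simpl. left. apply Rmult_lt_0_compat; [apply exp_pos|lra].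
        - apply series_coef_correct; [simpl; lra|lra]. }
      lra. }
  simpl pow. simpl fact. simpl (INR 1). lra.
Qed.

(** * The Gamma function and the Bohr-Mollerup argument *)

(** An epsilon form of the two-sided limit. The cut-offs lie on either side of 1, so every interval
    considered contains 1 and can be split there. *)
Definition improper_int (f : R -> R) (l : R) : Prop :=
  forall eps, 0 < eps -> exists d B, 0 < d <= 1 /\ 1 <= B /\
    forall a b, 0 < a < d -> B < b -> Rabs (RInt f a b - l) < eps.

Lemma improper_int_RInt_gen (f : R -> R) (l : R) :
  pos_continuous f -> improper_int f l ->
  RInt_gen f (at_right 0) (Rbar_locally p_infty) = l.
Proof.
  intros Hc H.
  apply (is_RInt_gen_unique (V := R_CompleteNormedModule) f l).
  intros P [eps HP].
  destruct (H eps (cond_pos eps)) as [d [B [Hd [HB Hab]]]].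
  exists (fun a => 0 < a < d) (fun b => B < b).
  - exists (mkposreal d (proj1 Hd)). intros y Hy Hy0.
    apply R_ball in Hy; simpl in Hy.
    apply Rabs_def2 in Hy. lra.
  - exists B. intros y Hy. exact Hy.
  - intros a b Ha Hb. simpl. exists (RInt f a b). split.
    + apply (RInt_correct (V := R_CompleteNormedModule)).
      apply pos_continuous_ex_RInt; [exact Hc|lra|lra].
    + apply HP. exact (Hab a b Ha Hb).
Qed.

Lemma improper_int_unique (f : R -> R) (l l' : R) :
  improper_int f l -> improper_int f l' -> l = l'.
Proof.
  intros H H'. apply Rminus_diag_uniq, cond_eq. intros eps He.
  destruct (H (eps / 2)) as [d [B [Hd [HB Hab]]]]; [lra|].
  destruct (H' (eps / 2)) as [d' [B' [Hd' [HB' Hab']]]]; [lra|].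
  assert (M : 0 < Rmin d d') by (apply Rmin_pos; lra).
  assert (M1 := Rmin_l d d'). assert (M2 := Rmin_r d d').
  assert (N1 := Rmax_l B B'). assert (N2 := Rmax_r B B').
  specialize (Hab (Rmin d d' / 2) (Rmax B B' + 1) ltac:(lra) ltac:(lra)).
  specialize (Hab' (Rmin d d' / 2) (Rmax B B' + 1) ltac:(lra) ltac:(lra)).
  apply Rabs_def2 in Hab. apply Rabs_def2 in Hab'.
  rewrite Rminus_0_r. apply Rabs_def1; lra.
Qed.

Lemma improper_int_le (f g : R -> R) (lf lg : R) :
  pos_continuous f -> pos_continuous g -> (forall t, 0 < t -> f t <= g t) ->
  improper_int f lf -> improper_int g lg -> lf <= lg.
Proof.
  intros Cf Cg Hfg H H'. apply Rnot_lt_le. intros Hlt.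
  destruct (H ((lf - lg) / 2)) as [d [B [Hd [HB Hab]]]]; [lra|].
  destruct (H' ((lf - lg) / 2)) as [d' [B' [Hd' [HB' Hab']]]]; [lra|].
  assert (M : 0 < Rmin d d') by (apply Rmin_pos; lra).
  assert (M1 := Rmin_l d d'). assert (M2 := Rmin_r d d').
  assert (N1 := Rmax_l B B'). assert (N2 := Rmax_r B B').
  specialize (Hab (Rmin d d' / 2) (Rmax B B' + 1) ltac:(lra) ltac:(lra)).
  specialize (Hab' (Rmin d d' / 2) (Rmax B B' + 1) ltac:(lra) ltac:(lra)).
  apply Rabs_def2 in Hab. apply Rabs_def2 in Hab'.
  assert (L : RInt f (Rmin d d' / 2) (Rmax B B' + 1) <= RInt g (Rmin d d' / 2) (Rmax B B' + 1)).
  { apply RInt_le; [lra|apply pos_continuous_ex_RInt; auto; lra..|].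
    intros x Hx. apply Hfg. lra. }
  lra.
Qed.

Lemma improper_int_lin (f g : R -> R) (a b lf lg : R) :
  pos_continuous f -> pos_continuous g ->
  improper_int f lf -> improper_int g lg ->
  improper_int (fun t => a * f t + b * g t) (a * lf + b * lg).
Proof.
  intros Cf Cg H H' eps He.
  set (K := Rabs a + Rabs b + 1).
  assert (Pa := Rabs_pos a). assert (Pb := Rabs_pos b).
  assert (HK : 0 < K) by (unfold K; lra).
  assert (He' : 0 < eps / K) by (apply Rdiv_lt_0_compat; lra).
  destruct (H _ He') as [d [B [Hd [HB Hab]]]].
  destruct (H' _ He') as [d' [B' [Hd' [HB' Hab']]]].
  assert (M : 0 < Rmin d d') by (apply Rmin_pos; lra).
  assert (M1 := Rmin_l d d'). assert (M2 := Rmin_r d d').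
  assert (N1 := Rmax_l B B'). assert (N2 := Rmax_r B B').
  exists (Rmin d d'), (Rmax B B'). split; [lra|]. split; [lra|].
  intros x y Hx Hy.
  specialize (Hab x y ltac:(lra) ltac:(lra)). specialize (Hab' x y ltac:(lra) ltac:(lra)).
  assert (E : RInt (fun t => a * f t + b * g t) x y = a * RInt f x y + b * RInt g x y).
  { assert (Ef : ex_RInt f x y) by (apply pos_continuous_ex_RInt; auto; lra).
    assert (Eg : ex_RInt g x y) by (apply pos_continuous_ex_RInt; auto; lra).
    transitivity (RInt (fun t => plus (scal a (f t)) (scal b (g t))) x y); [reflexivity|].
    rewrite (RInt_plus (V := R_CompleteNormedModule)); [|apply (ex_RInt_scal (V := R_NormedModule)); assumption..].
    rewrite !(RInt_scal (V := R_CompleteNormedModule)) by assumption. reflexivity. }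
  rewrite E.
  replace (a * RInt f x y + b * RInt g x y - (a * lf + b * lg))
    with (a * (RInt f x y - lf) + b * (RInt g x y - lg)) by ring.
  eapply Rle_lt_trans; [apply Rabs_triang|]. rewrite !Rabs_mult.
  apply Rle_lt_trans with ((Rabs a + Rabs b) * (eps / K)); [nra|].
  replace eps with (K * (eps / K)) at 2 by (field; lra). unfold K at 2. nra.
Qed.

(** For a nonnegative integrand the integrals grow with the interval, so their supremum is the
    limit; that it bounds each of them later gives positivity of [Gamma]. *)
Lemma improper_int_nonneg_ex (f : R -> R) (M : R) :
  pos_continuous f -> (forall t, 0 < t -> 0 <= f t) ->
  (forall a b, 0 < a <= 1 -> 1 <= b -> RInt f a b <= M) ->
  exists l, improper_int f l /\ forall a b, 0 < a <= 1 -> 1 <= b -> RInt f a b <= l.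
Proof.
  intros Hc Hp HM.
  set (S := fun y => exists a b, 0 < a <= 1 /\ 1 <= b /\ y = RInt f a b).
  destruct (completeness S) as [l [Hub Hlub]].
  { exists M. intros y [a [b [Ha [Hb ->]]]]. auto. }
  { exists (RInt f 1 1), 1, 1. repeat split; lra. }
  assert (Hle : forall a b, 0 < a <= 1 -> 1 <= b -> RInt f a b <= l).
  { intros a b Ha Hb. apply Hub. exists a, b. auto. }
  exists l. split; [|exact Hle].
  intros eps He.
  destruct (classic (exists a b, 0 < a <= 1 /\ 1 <= b /\ l - eps < RInt f a b))
    as [[a0 [b0 [Ha0 [Hb0 H0]]]]|Hn].
  - exists a0, b0. split; [exact Ha0|]. split; [exact Hb0|]. intros a b Ha Hb.
    assert (E1 := RInt_Chasles (V := R_CompleteNormedModule) f a a0 b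
      ltac:(apply pos_continuous_ex_RInt; auto; lra) ltac:(apply pos_continuous_ex_RInt; auto; lra)).
    assert (E2 := RInt_Chasles (V := R_CompleteNormedModule) f a0 b0 b
      ltac:(apply pos_continuous_ex_RInt; auto; lra) ltac:(apply pos_continuous_ex_RInt; auto; lra)).
    unfold plus in E1, E2; simpl in E1, E2.
    assert (P1 : 0 <= RInt f a a0).
    { apply RInt_ge_0; [lra|apply pos_continuous_ex_RInt; auto; lra|].
      intros x Hx. apply Hp. lra. }
    assert (P2 : 0 <= RInt f b0 b).
    { apply RInt_ge_0; [lra|apply pos_continuous_ex_RInt; auto; lra|].
      intros x Hx. apply Hp. lra. }
    assert (U := Hle a b ltac:(lra) ltac:(lra)).
    apply Rabs_def1; lra.
  - exfalso. assert (l <= l - eps); [|lra].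
    apply Hlub. intros y [a [b [Ha [Hb ->]]]].
    apply Rnot_lt_le. intros Hlt. apply Hn. exists a, b. auto.
Qed.

(** * The Gamma integral: convergence, functional equation, log-convexity *)

Definition gamma_integrand (x t : R) : R := Rpower t (x - 1) * exp (- t).

Lemma gamma_integrand_exp (x t : R) : gamma_integrand x t = exp ((x - 1) * ln t - t).
Proof. unfold gamma_integrand, Rpower. rewrite <- exp_plus. reflexivity. Qed.

Lemma gamma_integrand_pos (x t : R) : 0 < gamma_integrand x t.
Proof. rewrite gamma_integrand_exp. apply exp_pos. Qed.

Lemma gamma_integrand_continuous (x : R) : pos_continuous (gamma_integrand x).
Proof.
  intros t Ht. apply (ex_derive_continuous (gamma_integrand x)).
  unfold gamma_integrand, Rpower. auto_derive. exact Ht.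
Qed.

(** For an integer [n > x], the estimate [(t / 2)^n / n! <= exp (t / 2)] absorbs the power at the
    price of half the exponential decay. *)
Lemma Rpower_exp_tail (x : R) :
  exists K, 0 < K /\ forall t, 1 <= t -> Rpower t x * exp (- t) <= K * exp (- t / 2).
Proof.
  destruct (INR_unbounded x) as [n Hn].
  exists (INR (fact n) * 2 ^ n). split.
  { apply Rmult_lt_0_compat; [apply INR_fact_lt_0|apply pow_lt; lra]. }
  intros t Ht.
  assert (H1 : Rpower t x <= t ^ n).
  { rewrite <- Rpower_pow by lra. apply Rle_Rpower; lra. }
  assert (H2 := pow_fact_le_exp (t / 2) n ltac:(lra)).
  assert (F := INR_fact_lt_0 n). assert (P2 : 0 < 2 ^ n) by (apply pow_lt; lra).
  assert (H3 : t ^ n <= INR (fact n) * 2 ^ n * exp (t / 2)).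
  { apply Rle_div_l in H2; [|exact F].
    unfold Rdiv in H2. rewrite Rpow_mult_distr, pow_inv in H2.
    apply (Rmult_le_compat_r (2 ^ n)) in H2; [|lra].
    rewrite Rmult_assoc, Rinv_l, Rmult_1_r in H2 by lra. unfold Rdiv. lra. }
  replace (exp (- t / 2)) with (exp (t / 2) * exp (- t))
    by (rewrite <- exp_plus; f_equal; field).
  rewrite <- Rmult_assoc. apply Rmult_le_compat_r; [left; apply exp_pos|]. lra.
Qed.

Lemma gamma_improper_ex (x : R) :
  0 < x -> exists l, improper_int (gamma_integrand x) l /\
    forall a b, 0 < a <= 1 -> 1 <= b -> RInt (gamma_integrand x) a b <= l.
Proof.
  intros Hx. destruct (Rpower_exp_tail (x - 1)) as [K [HK HKt]].
  (* [/ x] bounds the integral of [t^(x-1)] up to 1, where [exp (- t) <= 1]; [2 * K] bounds that of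
     [K exp (- t / 2)] from 1 on. *)
  apply (improper_int_nonneg_ex _ (/ x + 2 * K)).
  - apply gamma_integrand_continuous.
  - intros t _. left. apply gamma_integrand_pos.
  - intros a b Ha Hb.
    assert (C := gamma_integrand_continuous x).
    assert (E := RInt_Chasles (V := R_CompleteNormedModule) (gamma_integrand x) a 1 b
      ltac:(apply pos_continuous_ex_RInt; auto; lra) ltac:(apply pos_continuous_ex_RInt; auto; lra)).
    unfold plus in E; simpl in E. rewrite <- E.
    assert (I1 : is_RInt (fun t => exp ((x - 1) * ln t)) a 1
      (minus (exp (x * ln 1) / x) (exp (x * ln a) / x))).
    { apply (is_RInt_derive (V := R_CompleteNormedModule) (fun t => exp (x * ln t) / x)).
      - intros t. rewrite Rmin_left, Rmax_right by lra. intros Ht. auto_derive; [lra|].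
        replace (x * ln t) with ((x - 1) * ln t + ln t) by ring.
        rewrite exp_plus, exp_ln by lra. field. split; lra.
      - intros t. rewrite Rmin_left, Rmax_right by lra. intros Ht.
        apply (ex_derive_continuous (fun t => exp ((x - 1) * ln t))). auto_derive. lra. }
    assert (I2 : is_RInt (fun t => K * exp (- t / 2)) 1 b
      (minus (- 2 * K * exp (- b / 2)) (- 2 * K * exp (- (1) / 2)))).
    { apply (is_RInt_derive (V := R_CompleteNormedModule) (fun t => - 2 * K * exp (- t / 2))).
      - intros t _. auto_derive; [exact I|]. unfold Rdiv. field.
      - intros t _. apply (ex_derive_continuous (fun t => K * exp (- t / 2))). auto_derive. exact I. }
    assert (L1 : RInt (gamma_integrand x) a 1 <= / x).
    { apply Rle_trans with (RInt (fun t => exp ((x - 1) * ln t)) a 1).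
      - apply RInt_le; [lra|apply pos_continuous_ex_RInt; auto; lra|eexists; exact I1|].
        intros t Ht. unfold gamma_integrand, Rpower.
        rewrite <- (Rmult_1_r (exp ((x - 1) * ln t))) at 2.
        apply Rmult_le_compat_l; [left; apply exp_pos|].
        rewrite <- exp_0. left. apply exp_increasing. lra.
      - rewrite (is_RInt_unique _ _ _ _ I1). unfold minus, plus, opp; simpl.
        rewrite ln_1, Rmult_0_r, exp_0.
        assert (P : 0 < exp (x * ln a) / x) by (apply Rdiv_lt_0_compat; [apply exp_pos|exact Hx]).
        unfold Rdiv at 1. lra. }
    assert (L2 : RInt (gamma_integrand x) 1 b <= 2 * K).
    { apply Rle_trans with (RInt (fun t => K * exp (- t / 2)) 1 b).
      - apply RInt_le; [lra|apply pos_continuous_ex_RInt; auto; lra|eexists; exact I2|].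
        intros t Ht. apply HKt. lra.
      - rewrite (is_RInt_unique _ _ _ _ I2). unfold minus, plus, opp; simpl.
        assert (P : 0 < exp (- b / 2)) by apply exp_pos.
        assert (P' : exp (- (1) / 2) <= 1).
        { apply Rle_trans with (exp 0); [left; apply exp_increasing|rewrite exp_0]; lra. }
        nra. }
    lra.
Qed.

Lemma Gamma_improper (x : R) :
  0 < x -> improper_int (gamma_integrand x) (Gamma x) /\ 0 < Gamma x.
Proof.
  intros Hx. destruct (gamma_improper_ex x Hx) as [l [Hl Hle]].
  assert (E : Gamma x = l).
  { apply (improper_int_RInt_gen (gamma_integrand x)); [apply gamma_integrand_continuous|exact Hl]. }
  rewrite E. split; [exact Hl|].
  (* The integral over [[1, 2]] is positive and lies below the supremum. *)
  apply Rlt_le_trans with (RInt (gamma_integrand x) 1 2); [|apply Hle; lra].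
  apply RInt_gt_0; [lra| |].
  - intros t _. apply gamma_integrand_pos.
  - intros t Ht. apply gamma_integrand_continuous. lra.
Qed.

(** The integrand is the derivative of [t^x exp (- t)], which tends to 0 at both ends. This is the
    integration by parts behind the functional equation. *)
Lemma improper_int_boundary (x : R) :
  0 < x ->
  improper_int (fun t => x * gamma_integrand x t + (- 1) * gamma_integrand (x + 1) t) 0.
Proof.
  intros Hx eps He.
  set (F := fun t => exp (x * ln t) * exp (- t)).
  assert (DF : forall t, 0 < t ->
    is_derive F t (x * gamma_integrand x t + (- 1) * gamma_integrand (x + 1) t)).
  { intros t Ht. unfold F, gamma_integrand, Rpower. auto_derive; [exact Ht|].
    replace (x + 1 - 1) with x by ring.
    replace (x * ln t) with ((x - 1) * ln t + ln t) by ring.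
    rewrite exp_plus, exp_ln by lra. field. lra. }
  assert (CF : pos_continuous (fun t => x * gamma_integrand x t + (- 1) * gamma_integrand (x + 1) t)).
  { intros t Ht. apply continuous_lin; apply gamma_integrand_continuous, Ht. }
  assert (PF : forall t, 0 < F t).
  { intro t. apply Rmult_lt_0_compat; apply exp_pos. }
  destruct (Rpower_exp_tail x) as [K [HK HKt]].
  (* Below [d] one has [a^x < eps]; beyond [B] one has [K exp (- b / 2) < eps]. *)
  set (d := Rmin 1 (exp (ln eps / x))).
  set (B := Rmax 1 (- 2 * ln (eps / K))).
  assert (Hd : 0 < d) by (apply Rmin_pos; [lra|apply exp_pos]).
  assert (Hd1 : d <= 1) by apply Rmin_l.
  assert (Hd2 : d <= exp (ln eps / x)) by apply Rmin_r.
  assert (HB1 : 1 <= B) by apply Rmax_l.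
  assert (HB2 : - 2 * ln (eps / K) <= B) by apply Rmax_r.
  exists d, B. split; [lra|]. split; [lra|].
  intros a b Ha Hb.
  assert (EI : RInt (fun t => x * gamma_integrand x t + (- 1) * gamma_integrand (x + 1) t) a b = F b - F a).
  { apply is_RInt_unique. apply (is_RInt_derive (V := R_CompleteNormedModule) F).
    - intros t. rewrite Rmin_left, Rmax_right by lra. intros Ht. apply DF. lra.
    - intros t. rewrite Rmin_left, Rmax_right by lra. intros Ht. apply CF. lra. }
  rewrite EI, Rminus_0_r.
  assert (Fa : F a < eps).
  { unfold F. apply Rle_lt_trans with (exp (x * ln a)).
    - rewrite <- (Rmult_1_r (exp (x * ln a))) at 2.
      apply Rmult_le_compat_l; [left; apply exp_pos|].
      rewrite <- exp_0. left. apply exp_increasing. lra.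
    - rewrite <- (exp_ln eps He) at 1. apply exp_increasing.
      assert (La : ln a < ln eps / x).
      { rewrite <- (ln_exp (ln eps / x)). apply ln_increasing; lra. }
      apply (Rmult_lt_compat_l x) in La; [|exact Hx].
      replace (x * (ln eps / x)) with (ln eps) in La by (field; lra). exact La. }
  assert (Fb : F b < eps).
  { unfold F. eapply Rle_lt_trans; [apply HKt; lra|].
    assert (Q : 0 < eps / K) by (apply Rdiv_lt_0_compat; assumption).
    replace eps with (K * exp (ln (eps / K))).
    - apply Rmult_lt_compat_l; [exact HK|]. apply exp_increasing. lra.
    - rewrite exp_ln by exact Q. field. lra. }
  assert (Pa := PF a). assert (Pb := PF b).
  apply Rabs_def1; lra.
Qed.

Lemma Gamma_succ (x : R) : 0 < x -> Gamma (x + 1) = x * Gamma x.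
Proof.
  intros Hx.
  destruct (Gamma_improper x Hx) as [H1 _].
  destruct (Gamma_improper (x + 1) ltac:(lra)) as [H2 _].
  assert (H := improper_int_lin _ _ x (- 1) _ _ (gamma_integrand_continuous x)
    (gamma_integrand_continuous (x + 1)) H1 H2).
  assert (E := improper_int_unique _ _ _ H (improper_int_boundary x Hx)). lra.
Qed.

(** Both exponentials lie above the tangent line at the mean [m]; the weighted average of that line
    at [u] and [v] is [exp m]. *)
Lemma exp_convex (s u v : R) :
  0 <= s <= 1 -> exp (s * u + (1 - s) * v) <= s * exp u + (1 - s) * exp v.
Proof.
  intros Hs. set (m := s * u + (1 - s) * v).
  assert (T : forall w, exp m * (1 + (w - m)) <= exp w).
  { intro w. replace (exp w) with (exp m * exp (w - m)) by (rewrite <- exp_plus; f_equal; ring).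
    apply Rmult_le_compat_l; [left; apply exp_pos|apply exp_ineq1_le]. }
  assert (Tu := T u). assert (Tv := T v).
  apply (Rmult_le_compat_l s) in Tu; [|lra]. apply (Rmult_le_compat_l (1 - s)) in Tv; [|lra].
  assert (E : s * (exp m * (1 + (u - m))) + (1 - s) * (exp m * (1 + (v - m))) = exp m)
    by (unfold m; ring).
  lra.
Qed.

Definition lnGamma (x : R) : R := ln (Gamma x).

(** Pointwise convexity of [exp] applied to the integrands normalised by
    [Gamma x] and [Gamma y]. *)
Lemma lnGamma_convex (x y s : R) :
  0 < x -> 0 < y -> 0 <= s <= 1 ->
  lnGamma (s * x + (1 - s) * y) <= s * lnGamma x + (1 - s) * lnGamma y.
Proof.
  intros Hx Hy Hs. set (z := s * x + (1 - s) * y).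
  assert (Hz : 0 < z) by (unfold z; nra).
  destruct (Gamma_improper x Hx) as [Ix Px].
  destruct (Gamma_improper y Hy) as [Iy Py].
  destruct (Gamma_improper z Hz) as [Iz Pz].
  set (c := s * lnGamma x + (1 - s) * lnGamma y).
  assert (Cx := gamma_integrand_continuous x).
  assert (Cy := gamma_integrand_continuous y).
  assert (Cz := gamma_integrand_continuous z).
  assert (H1 := improper_int_lin _ _ (s / Gamma x) ((1 - s) / Gamma y) _ _ Cx Cy Ix Iy).
  assert (H2 := improper_int_lin _ _ (exp (- c)) 0 _ _ Cz Cz Iz Iz).
  assert (L : exp (- c) * Gamma z + 0 * Gamma z
    <= s / Gamma x * Gamma x + (1 - s) / Gamma y * Gamma y).
  { refine (improper_int_le _ _ _ _ _ _ _ H2 H1).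
    - intros t Ht. apply continuous_lin; apply Cz, Ht.
    - intros t Ht. apply continuous_lin; [apply Cx|apply Cy]; exact Ht.
    - intros t Ht. rewrite !gamma_integrand_exp.
      assert (E := exp_convex s ((x - 1) * ln t - t - lnGamma x) ((y - 1) * ln t - t - lnGamma y) Hs).
      rewrite Rmult_0_l, Rplus_0_r, <- exp_plus.
      replace (- c + ((z - 1) * ln t - t))
        with (s * ((x - 1) * ln t - t - lnGamma x) + (1 - s) * ((y - 1) * ln t - t - lnGamma y))
        by (unfold c, z; ring).
      eapply Rle_trans; [exact E|]. right.
      assert (N : forall A w, 0 < Gamma w -> exp (A - lnGamma w) = exp A / Gamma w).
      { intros A w Hw. unfold Rminus. rewrite exp_plus, exp_Ropp.
        unfold lnGamma. rewrite exp_ln by exact Hw. reflexivity. }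
      rewrite !N by assumption. unfold Rdiv. ring. }
  replace (s / Gamma x * Gamma x + (1 - s) / Gamma y * Gamma y) with 1 in L by (field; lra).
  rewrite Rmult_0_l, Rplus_0_r in L.
  assert (G : Gamma z <= exp c).
  { apply (Rmult_le_compat_l (exp c)) in L; [|left; apply exp_pos].
    rewrite <- Rmult_assoc, <- exp_plus, Rplus_opp_r, exp_0, Rmult_1_l, Rmult_1_r in L. exact L. }
  rewrite <- (ln_exp c). unfold lnGamma. apply ln_le; assumption.
Qed.

Lemma lnGamma_succ (x : R) : 0 < x -> lnGamma (x + 1) = lnGamma x + ln x.
Proof.
  intros Hx. unfold lnGamma. rewrite Gamma_succ, ln_mult by (try assumption; apply Gamma_improper, Hx).
  ring.
Qed.

(** Convexity is used twice: [y] lies between [y - 1] and [y + h] with weight [h / (1 + h)], and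
    [y + h] lies between [y] and [y + 1] with weight [h]. The functional equation evaluates the unit
    steps. *)
Lemma lnGamma_step (y h : R) :
  1 < y -> 0 <= h <= 1 ->
  h * ln (y - 1) <= lnGamma (y + h) - lnGamma y <= h * ln y.
Proof.
  intros Hy Hh. split.
  - assert (Hs : 0 <= h / (1 + h) <= 1).
    { split; [apply Rdiv_le_0_compat; lra|apply Rle_div_l; lra]. }
    assert (C := lnGamma_convex (y - 1) (y + h) (h / (1 + h)) ltac:(lra) ltac:(lra) Hs).
    replace (h / (1 + h) * (y - 1) + (1 - h / (1 + h)) * (y + h)) with y in C by (field; lra).
    assert (S := lnGamma_succ (y - 1) ltac:(lra)). replace (y - 1 + 1) with y in S by ring.
    apply (Rmult_le_compat_r (1 + h)) in C; [|lra].
    replace ((h / (1 + h) * lnGamma (y - 1) + (1 - h / (1 + h)) * lnGamma (y + h)) * (1 + h))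
      with (h * lnGamma (y - 1) + lnGamma (y + h)) in C by (field; lra).
    nra.
  - assert (C := lnGamma_convex (y + 1) y h ltac:(lra) ltac:(lra) Hh).
    replace (h * (y + 1) + (1 - h) * y) with (y + h) in C by ring.
    rewrite lnGamma_succ in C by lra. lra.
Qed.

(** Convexity pins the increments of both functions over [[y, y + h]] between
    [h ln (y - 1)] and [h ln (y + 1)]; their 1-periodic difference therefore has
    increments tending to [0] along [y = q + n]. *)
Lemma bohr_mollerup (G g : R -> R) :
  (forall x, 0 < x -> is_derive G x (g x)) ->
  (forall x y, 0 < x <= y -> g x <= g y) ->
  (forall x, 0 < x -> G (x + 1) = G x + ln x) ->
  forall q h, 0 < q -> 0 <= h <= 1 ->
    lnGamma (q + h) - G (q + h) = lnGamma q - G q.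
Proof.
  intros DG Mg SG q h Hq Hh.
  assert (MV : forall x k, 0 < x -> 0 <= k -> exists c, x <= c <= x + k /\ G (x + k) - G x = g c * k).
  { intros x k Hx Hk. destruct (MVT_gen G x (x + k) g) as [c [Hc E]].
    - intros t. rewrite Rmin_left, Rmax_right by lra. intros Ht. apply DG. lra.
    - intros t. rewrite Rmin_left, Rmax_right by lra. intros Ht.
      apply continuity_pt_filterlim. apply (ex_derive_continuous G). exists (g t). apply DG. lra.
    - rewrite Rmin_left, Rmax_right in Hc by lra. exists c. split; [exact Hc|].
      rewrite E. ring. }
  assert (Step : forall y, 1 < y -> h * ln (y - 1) <= G (y + h) - G y <= h * ln (y + 1)).
  { intros y Hy.
    destruct (MV y h ltac:(lra) ltac:(lra)) as [c [Hc Ec]].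
    destruct (MV (y - 1) 1 ltac:(lra) ltac:(lra)) as [c1 [Hc1 Ec1]].
    destruct (MV (y + 1) 1 ltac:(lra) ltac:(lra)) as [c2 [Hc2 Ec2]].
    rewrite SG in Ec1, Ec2 by lra.
    assert (A1 : g c1 <= g c) by (apply Mg; lra).
    assert (A2 : g c <= g c2) by (apply Mg; lra).
    rewrite Ec. nra. }
  set (D := fun x => lnGamma x - G x).
  assert (Per : forall n x, 0 < x -> D (x + INR n) = D x).
  { induction n as [|n IH]; intros x Hx.
    - simpl. rewrite Rplus_0_r. reflexivity.
    - rewrite S_INR. replace (x + (INR n + 1)) with (x + INR n + 1) by ring.
      assert (P := pos_INR n). unfold D at 1. rewrite lnGamma_succ, SG by lra.
      rewrite <- (IH x Hx). unfold D. ring. }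
  apply Rminus_diag_uniq, cond_eq. intros eps He. rewrite Rminus_0_r.
  (* The gap between the two bounds is at most [ln (y + 1) - ln (y - 1) <= 2 / (y - 1)]; this [n]
     brings it below [eps]. *)
  destruct (INR_unbounded (2 / eps + 2)) as [n Hn].
  set (y := q + INR n).
  assert (P2 : 0 < 2 / eps) by (apply Rdiv_lt_0_compat; lra).
  assert (Hy : 2 / eps + 1 < y - 1) by (unfold y; lra).
  change (Rabs (D (q + h) - D q) < eps).
  rewrite <- (Per n (q + h)), <- (Per n q) by lra.
  replace (q + h + INR n) with (y + h) by (unfold y; ring). fold y.
  assert (S1 := lnGamma_step y h ltac:(lra) Hh). assert (S2 := Step y ltac:(lra)).
  assert (L1 : ln y <= ln (y + 1)) by (apply ln_le; lra).
  assert (L2 : ln (y + 1) - ln (y - 1) <= 2 / (y - 1)).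
  { assert (E : ln (y + 1) = ln (y - 1) + ln (1 + 2 / (y - 1))).
    { rewrite <- ln_mult; [f_equal; field; lra|lra|].
      assert (0 < 2 / (y - 1)) by (apply Rdiv_lt_0_compat; lra). lra. }
    assert (L : ln (1 + 2 / (y - 1)) <= 2 / (y - 1)).
    { assert (0 < 2 / (y - 1)) by (apply Rdiv_lt_0_compat; lra).
      rewrite <- (ln_exp (2 / (y - 1))) at 2. apply ln_le; [lra|apply exp_ineq1_le]. }
    lra. }
  assert (L3 : 2 / (y - 1) < eps).
  { apply Rlt_div_l; [lra|].
    replace 2 with (eps * (2 / eps)) by (field; lra). nra. }
  assert (L0 : ln (y - 1) <= ln (y + 1)) by (apply ln_le; lra).
  unfold D. apply Rabs_def1; nra.
Qed.

(** [G] is the explicit form of [psi^(-1)]. It shares with [lnGamma] the functional equation and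
    convexity, so they differ by a constant near [q], to which the derivative is blind. The [bern 0]
    terms cancel in the derivative of [G]. *)
Lemma digamma_eq (q : R) : 0 < q -> digamma q = - dzeta 0 q.
Proof.
  intros Hq.
  set (G := fun x => - (dzeta 1 x + bern 1 x)). set (g := fun x => - dzeta 0 x).
  assert (DG : forall x, 0 < x -> is_derive G x (g x)).
  { intros x Hx.
    assert (D1 := is_derive_dzeta 0 x Hx). assert (D2 := is_derive_bern 0 x Hx).
    assert (D := is_derive_opp _ _ _ (is_derive_plus _ _ _ _ _ D1 D2)).
    replace (g x) with (opp (plus (INR 1 * dzeta 0 x - bern 0 x) (INR 1 * bern 0 x))).
    - exact D.
    - unfold g, opp, plus; simpl. ring. }
  assert (Mg : forall x y, 0 < x <= y -> g x <= g y).
  { intros x y Hxy. destruct (MVT_gen g x y (Derive g)) as [c [Hc E]].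
    - intros t. rewrite Rmin_left, Rmax_right by lra. intros Ht.
      destruct (is_derive_dzeta_0 t ltac:(lra)) as [l [_ Dl]].
      apply Derive_correct. exists (- l). exact (is_derive_opp _ _ _ Dl).
    - intros t. rewrite Rmin_left, Rmax_right by lra. intros Ht.
      destruct (is_derive_dzeta_0 t ltac:(lra)) as [l [_ Dl]].
      apply continuity_pt_filterlim. apply (ex_derive_continuous g).
      exists (- l). exact (is_derive_opp _ _ _ Dl).
    - rewrite Rmin_left, Rmax_right in Hc by lra.
      destruct (is_derive_dzeta_0 c ltac:(lra)) as [l [Hl Dl]].
      rewrite (is_derive_unique g c (- l) (is_derive_opp _ _ _ Dl)) in E. nra. }
  assert (SG : forall x, 0 < x -> G (x + 1) = G x + ln x).
  { intros x Hx. assert (E1 := dzeta_difference x Hx). assert (E2 := bern_difference 0 x Hx).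
    simpl in E2. unfold G. lra. }
  assert (BM := bohr_mollerup G g DG Mg SG).
  unfold digamma. change (Derive lnGamma q = g q). apply is_derive_unique.
  apply (is_derive_ext_loc (fun x => G x + (lnGamma q - G q))).
  - assert (Hd : 0 < Rmin 1 q) by (apply Rmin_pos; lra).
    assert (M1 := Rmin_l 1 q). assert (M2 := Rmin_r 1 q).
    exists (mkposreal _ Hd). intros y Hy.
    apply R_ball in Hy; simpl in Hy.
    apply Rabs_def2 in Hy.
    (* [BM] moves to the right, so the smaller of [q] and [y] is the base point. *)
    destruct (Rle_lt_dec q y) as [Hle|Hlt].
    + assert (E := BM q (y - q) Hq ltac:(lra)).
      rewrite Rplus_minus in E. lra.
    + assert (E := BM y (q - y) ltac:(lra) ltac:(lra)).
      rewrite Rplus_minus in E. lra.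
  - assert (D := DG q Hq). auto_derive; [exists (g q); exact D|].
    rewrite Rmult_1_l. apply is_derive_unique, D.
Qed.

(** * Bernoulli polynomials *)

(** By induction on [k] both sides have the same derivative in [h], and they agree at [h = 0]. *)
Lemma appell_taylor (beta : nat -> R -> R) :
  (forall k q, 0 < q -> is_derive (beta (S k)) q (beta k q)) ->
  (forall q, 0 < q -> beta 0%nat q = 1) ->
  forall k q h, 0 < q -> 0 <= h ->
    beta k (q + h) = sum_n (fun i => beta i q * (h ^ (k - i) / INR (fact (k - i)))) k.
Proof.
  intros HD H0. induction k as [|k IH]; intros q h Hq Hh.
  - rewrite sum_O, !H0 by lra. simpl. field.
  (* The summand [i = S k] is constant in [x] and is left out, so that [T 0 = 0] while the
     derivative of [T] is the full sum at level [k]. *)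
  - set (T := fun x => sum_n (fun i => beta i q * (x ^ (S k - i) / INR (fact (S k - i)))) k).
    assert (DT : forall x, is_derive T x (sum_n (fun i => beta i q * (x ^ (k - i) / INR (fact (k - i)))) k)).
    { intro x. apply (is_derive_sum_n (V := R_NormedModule)
        (fun i x => beta i q * (x ^ (S k - i) / INR (fact (S k - i))))).
      intros i Hi. replace (S k - i)%nat with (S (k - i)) by lia.
      generalize (k - i)%nat as m. intro m.
      assert (Q := INR_fact_lt_0 m). assert (P : 0 < INR (S m)) by (apply lt_0_INR; lia).
      assert (F : INR (fact (S m)) = INR (S m) * INR (fact m)) by (rewrite fact_simpl; apply mult_INR).
      set (f := INR (fact (S m))) in *. clearbody f.
      auto_derive; [exact I|]. rewrite F.
      change (match m with 0%nat => 1 | S _ => INR m + 1 end) with (INR (S m)).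
      field. lra. }
    assert (T0 : T 0 = 0).
    { unfold T. rewrite (sum_n_ext_loc _ (fun _ => 0)); [rewrite sum_n_const; apply Rmult_0_r|].
      intros i Hi. rewrite pow_i by lia. unfold Rdiv. rewrite Rmult_0_l. apply Rmult_0_r. }
    destruct (Req_dec h 0) as [->|Hh0].
    + rewrite Rplus_0_r, sum_Sn. change (beta (S k) q = T 0 + beta (S k) q * (0 ^ (S k - S k) / INR (fact (S k - S k)))).
      rewrite T0, Nat.sub_diag. simpl. field.
    + assert (DF : forall x, 0 <= x -> is_derive (fun x => beta (S k) (q + x) - T x) x 0).
      { intros x Hx. assert (D1 := HD k (q + x) ltac:(lra)). assert (D2 := DT x).
        rewrite <- IH in D2 by lra.
        auto_derive.
        - split; [exists (beta k (q + x)); exact D1|]. split; [|exact I]. eexists. exact D2.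
        - replace (Derive (fun x0 => beta (S k) x0) (q + x)) with (beta k (q + x))
            by (symmetry; apply is_derive_unique, D1).
          replace (Derive (fun x0 => T x0) x) with (beta k (q + x))
            by (symmetry; apply is_derive_unique, D2). ring. }
      destruct (MVT_gen (fun x => beta (S k) (q + x) - T x) 0 h (fun _ => 0)) as [c [_ E]].
      * intros x. rewrite Rmin_left, Rmax_right by lra. intros Hx. apply DF. lra.
      * intros x. rewrite Rmin_left, Rmax_right by lra. intros Hx.
        apply continuity_pt_filterlim. apply (ex_derive_continuous (fun x => beta (S k) (q + x) - T x)).
        exists 0. apply DF. lra.
      * rewrite T0, Rplus_0_r in E. rewrite sum_Sn.
        change (beta (S k) (q + h) = T h + beta (S k) q * (h ^ (S k - S k) / INR (fact (S k - S k)))).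
        rewrite Nat.sub_diag. simpl. lra.
Qed.

Definition bern_coef (k : nat) (q : R) : R := bern k q / INR (fact k).
(** Taylor coefficients of [(exp t - 1) / t]. *)
Definition expm1_coef (k : nat) : R := / INR (fact (S k)).

(** The coefficient form of the generating identity, [bern_coef] series times [(exp t - 1) / t]
    equal to [exp (q t)]. It comes from the Appell expansion of [bern (S m)] at [q + 1]: the top
    term cancels in the unit difference, which is a known monomial. *)
Lemma bern_coef_convolution (q : R) (m : nat) :
  0 < q -> PS_mult (fun k => bern_coef k q) expm1_coef m = q ^ m / INR (fact m).
Proof.
  intros Hq.
  assert (T : bern_coef (S m) (q + 1)
    = sum_n (fun i => bern_coef i q * (1 ^ (S m - i) / INR (fact (S m - i)))) (S m)).
  { apply (appell_taylor bern_coef).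
    - intros k x Hx. unfold bern_coef.
      assert (Q := INR_fact_lt_0 k). assert (P : 0 < INR (S k)) by (apply lt_0_INR; lia).
      replace (bern k x / INR (fact k)) with (/ INR (fact (S k)) * (INR (S k) * bern k x))
        by (rewrite fact_simpl, mult_INR; field; lra).
      apply (is_derive_ext (fun y => / INR (fact (S k)) * bern (S k) y)).
      { intro y. apply Rmult_comm. }
      apply (is_derive_scal (bern (S k))), is_derive_bern, Hx.
    - intros x Hx. unfold bern_coef. rewrite bern_0 by exact Hx. simpl. field.
    - exact Hq.
    - lra. }
  rewrite sum_Sn in T.
  change (bern_coef (S m) (q + 1) = sum_n (fun i => bern_coef i q * (1 ^ (S m - i) / INR (fact (S m - i)))) m
    + bern_coef (S m) q * (1 ^ (S m - S m) / INR (fact (S m - S m)))) in T.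
  rewrite Nat.sub_diag in T. simpl (1 ^ 0) in T. simpl (fact 0) in T. simpl (INR 1) in T.
  assert (D := bern_difference m q Hq).
  assert (E : bern_coef (S m) (q + 1) - bern_coef (S m) q = q ^ m / INR (fact m)).
  { unfold bern_coef. assert (Q := INR_fact_lt_0 m). assert (P : 0 < INR (S m)) by (apply lt_0_INR; lia).
    replace (bern (S m) (q + 1) / INR (fact (S m)) - bern (S m) q / INR (fact (S m)))
      with ((bern (S m) (q + 1) - bern (S m) q) / INR (fact (S m)))
      by (field; apply INR_fact_neq_0).
    rewrite D, fact_simpl, mult_INR. field. lra. }
  rewrite <- E, T. unfold PS_mult. rewrite <- sum_n_Reals.
  rewrite (sum_n_ext_loc _ (fun i => bern_coef i q * (1 ^ (S m - i) / INR (fact (S m - i))))).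
  - replace (1 / 1) with 1 by field. rewrite Rmult_1_r. unfold Rminus.
    rewrite Rplus_assoc, Rplus_opp_r. symmetry. apply Rplus_0_r.
  - intros i Hi. rewrite pow1. unfold expm1_coef. replace (S m - i)%nat with (S (m - i)) by lia.
    unfold Rdiv. rewrite Rmult_1_l. reflexivity.
Qed.

Lemma expm1_coef_le (k : nat) : 0 <= expm1_coef k <= / 2 ^ k.
Proof.
  unfold expm1_coef. split; [left; apply Rinv_0_lt_compat, INR_fact_lt_0|].
  apply Rinv_le_contravar; [apply pow_lt; lra|].
  induction k as [|k IH]; [simpl; lra|].
  rewrite fact_simpl, mult_INR. simpl (2 ^ S k).
  apply Rmult_le_compat; [lra|apply pow_le; lra| |exact IH].
  rewrite !S_INR. assert (P := pos_INR k). lra.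
Qed.

(** A positive radius of convergence must be secured before series are multiplied. Solving the
    convolution for its top coefficient, the right-hand side is at most half of the claimed bound,
    and the earlier terms, a geometric sum of ratio 4, at most a third. *)
Lemma bern_coef_bound (q : R) (m : nat) : 0 < q -> Rabs (bern_coef m q) <= 2 * exp q * 2 ^ m.
Proof.
  intros Hq. set (K := 2 * exp q). assert (HK : 0 < K) by (unfold K; assert (P := exp_pos q); lra).
  induction m as [m IH] using (well_founded_induction lt_wf).
  assert (C := bern_coef_convolution q m Hq).
  assert (X := pow_fact_le_exp q m ltac:(lra)).
  assert (X0 : 0 <= q ^ m / INR (fact m))
    by (apply Rdiv_le_0_compat; [apply pow_le; lra|apply INR_fact_lt_0]).
  assert (P2 : 1 <= 2 ^ m) by (apply pow_R1_Rle; lra).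
  destruct m as [|m].
  - unfold PS_mult, expm1_coef in C. simpl in C, X |- *. apply Rabs_le. unfold K. lra.
  - unfold PS_mult in C. rewrite tech5, Nat.sub_diag in C.
    assert (S3 : Rabs (sum_f_R0 (fun k => bern_coef k q * expm1_coef (S m - k)) m) <= K * 2 ^ S m / 3).
    { eapply Rle_trans; [apply Rsum_abs|].
      apply Rle_trans with (sum_f_R0 (fun k => K / 2 ^ S m * 4 ^ k) m).
      - apply sum_Rle. intros k Hk.
        assert (I := IH k ltac:(lia)).
        destruct (expm1_coef_le (S m - k)) as [U1 U2].
        rewrite Rabs_mult, (Rabs_pos_eq (expm1_coef _)) by exact U1.
        apply Rle_trans with (K * 2 ^ k * / 2 ^ (S m - k)).
        + apply Rmult_le_compat; auto. apply Rabs_pos.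
        + right. replace (2 ^ S m) with (2 ^ k * 2 ^ (S m - k)) by (rewrite <- pow_add; f_equal; lia).
          replace (4 ^ k) with (2 ^ k * 2 ^ k) by (rewrite <- Rpow_mult_distr; f_equal; ring).
          assert (A1 : 0 < 2 ^ k) by (apply pow_lt; lra).
          assert (A2 : 0 < 2 ^ (S m - k)) by (apply pow_lt; lra).
          field. lra.
      - rewrite <- sum_n_Reals.
        assert (G := geom_sum_closed 4 m ltac:(lra)).
        rewrite (sum_n_scal_l (K := R_AbsRing) (V := R_NormedModule) (K / 2 ^ S m) (fun k => 4 ^ k)).
        change (K / 2 ^ S m * sum_n (fun k => 4 ^ k) m <= K * 2 ^ S m / 3).
        rewrite G. replace (4 ^ S m) with (2 ^ S m * 2 ^ S m) by (rewrite <- Rpow_mult_distr; f_equal; ring).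
        set (y := 2 ^ S m) in *.
        replace (K / y * ((1 - y * y) / (1 - 4))) with (K * y / 3 - K / (3 * y)) by (field; lra).
        assert (0 < K / (3 * y)) by (apply Rdiv_lt_0_compat; lra). lra. }
    assert (U0 : expm1_coef 0 = 1) by (unfold expm1_coef; simpl; field).
    rewrite U0, Rmult_1_r in C.
    set (s := sum_f_R0 (fun k => bern_coef k q * expm1_coef (S m - k)) m) in *.
    apply Rabs_le_between in S3. apply Rabs_le.
    assert (E2 : exp q <= K / 2 * 2 ^ S m) by (unfold K; nra).
    unfold K in *. nra.
Qed.

Lemma expm1_pseries (t : R) : t <> 0 -> is_pseries expm1_coef t ((exp t - 1) / t).
Proof.
  intros Ht.
  assert (H := is_pseries_decr_1 (K := R_AbsRing) (V := R_NormedModule) _ t (/ t) _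
    ltac:(apply Rinv_l, Ht) (is_exp_Reals t)).
  replace ((exp t - 1) / t) with (scal (/ t) (plus (exp t) (opp (/ INR (fact 0))))).
  - exact H.
  - unfold scal, plus, opp; simpl. unfold mult; simpl. field. exact Ht.
Qed.

Lemma bern_is_bernoulli_seq (q : R) : 0 < q -> is_bernoulli_seq q (fun k => bern k q).
Proof.
  (* [1 / 2] is the radius granted by the growth rate [2 ^ m] of [bern_coef_bound]. *)
  intros Hq. exists (1 / 2). split; [lra|]. intros t Ht.
  assert (Ht0 : t <> 0) by (intros ->; rewrite Rabs_R0 in Ht; lra).
  assert (Hb : Rbar_le (1 / 2) (CV_radius (fun k => bern_coef k q))).
  { apply (proj1 (CV_radius_bounded (fun k => bern_coef k q))).
    exists (2 * exp q). intro n.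
    rewrite Rabs_mult, (Rabs_pos_eq (_ ^ n)) by (apply pow_le; lra).
    assert (B := bern_coef_bound q n Hq). assert (P : 0 < (1 / 2) ^ n) by (apply pow_lt; lra).
    apply (Rmult_le_compat_r ((1 / 2) ^ n)) in B; [|lra].
    rewrite Rmult_assoc, <- Rpow_mult_distr in B.
    replace (2 * (1 / 2)) with 1 in B by field. rewrite pow1, Rmult_1_r in B. exact B. }
  assert (Rb : Rbar_lt (Rabs t) (CV_radius (fun k => bern_coef k q))).
  { apply (Rbar_lt_le_trans _ (1 / 2)); [simpl; lra|exact Hb]. }
  assert (Ru : Rbar_lt (Rabs t) (CV_radius expm1_coef)).
  { apply (pseries_entire expm1_coef 1 t Rlt_0_1). intro k.
    rewrite pow1. unfold expm1_coef. rewrite Rabs_pos_eq by (left; apply Rinv_0_lt_compat, INR_fact_lt_0).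
    unfold Rdiv. rewrite Rmult_1_l. apply Rinv_le_contravar; [apply INR_fact_lt_0|].
    apply le_INR. apply fact_le. lia. }
  assert (Pb := PSeries_correct (fun k => bern_coef k q) t
    ltac:(apply CV_disk_correct, CV_disk_inside, Rb)).
  assert (Pm := is_pseries_mult _ _ t _ _ Pb (expm1_pseries t Ht0) Rb Ru).
  assert (Pe : is_pseries (PS_mult (fun k => bern_coef k q) expm1_coef) t (exp (q * t))).
  { apply (is_pseries_ext (fun m => q ^ m / INR (fact m))).
    { intro m. symmetry. apply bern_coef_convolution, Hq. }
    assert (H := is_exp_Reals (q * t)). apply is_pseries_R in H. apply is_pseries_R.
    revert H. apply is_series_ext. intro m. rewrite Rpow_mult_distr. unfold Rdiv.
    Rring. }
  assert (E : PSeries (fun k => bern_coef k q) t * ((exp t - 1) / t) = exp (q * t)).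
  { rewrite <- (is_pseries_unique _ _ _ Pm). apply is_pseries_unique, Pe. }
  assert (Hexp : exp t - 1 <> 0).
  { intros Hz. apply Ht0. apply exp_inv. rewrite exp_0. lra. }
  replace (t * exp (q * t) / (exp t - 1)) with (PSeries (fun k => bern_coef k q) t); [exact Pb|].
  rewrite <- E. field. split; assumption.
Qed.

Lemma CV_radius_pos (a : nat -> R) (r : R) :
  0 < r -> (forall t, 0 < Rabs t < r -> ex_pseries a t) -> Rbar_lt 0 (CV_radius a).
Proof.
  intros Hr H. apply (Rbar_lt_le_trans _ (Rabs (r / 2))).
  - simpl. rewrite Rabs_pos_eq; lra.
  - apply Rbar_not_lt_le. intros Hlt. apply CV_disk_outside in Hlt. apply Hlt.
    apply ex_series_lim_0.
    destruct (H (r / 2)) as [l Hl]; [rewrite Rabs_pos_eq; lra|].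
    exists l. exact (proj1 (is_pseries_R a (r / 2) l) Hl).
Qed.

Lemma is_bernoulli_seq_unique (q : R) (B B' : nat -> R) (k : nat) :
  is_bernoulli_seq q B -> is_bernoulli_seq q B' -> B k = B' k.
Proof.
  intros [r [Hr H]] [r' [Hr' H']].
  set (a := fun k => B k / INR (fact k)) in *. set (a' := fun k => B' k / INR (fact k)) in *.
  (* Multiplying by [t] removes the exclusion of [t = 0]. *)
  assert (E : PS_incr_1 a (S k) = PS_incr_1 a' (S k)).
  { apply PSeries_ext_recip.
    - rewrite CV_radius_incr_1. apply (CV_radius_pos a r Hr).
      intros t Ht. eexists. apply H, Ht.
    - rewrite CV_radius_incr_1. apply (CV_radius_pos a' r' Hr').
      intros t Ht. eexists. apply H', Ht.
    - assert (Hm : 0 < Rmin r r') by (apply Rmin_pos; assumption).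
      assert (M1 := Rmin_l r r'). assert (M2 := Rmin_r r r').
      exists (mkposreal _ Hm). intros t Ht.
      apply R_ball in Ht; simpl in Ht.
      rewrite !PSeries_incr_1.
      destruct (Req_dec t 0) as [->|Ht0]; [rewrite !Rmult_0_l; reflexivity|].
      assert (Hp : 0 < Rabs t) by (apply Rabs_pos_lt, Ht0).
      rewrite Rminus_0_r in Ht.
      rewrite (is_pseries_unique _ _ _ (H t ltac:(lra))).
      rewrite (is_pseries_unique _ _ _ (H' t ltac:(lra))). reflexivity. }
  change (a k = a' k) in E. unfold a, a' in E.
  apply (Rmult_eq_compat_r (INR (fact k))) in E. unfold Rdiv in E.
  rewrite !Rmult_assoc, Rinv_l, !Rmult_1_r in E by apply INR_fact_neq_0. exact E.
Qed.

Lemma bernoulli_poly_eq (k : nat) (q : R) : 0 < q -> bernoulli_poly k q = bern k q.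
Proof.
  intros Hq. apply (is_bernoulli_seq_unique q (fun k => bernoulli_poly k q) (fun k => bern k q));
    [|apply bern_is_bernoulli_seq, Hq].
  exact (epsilon_spec (inhabits (fun _ : nat => 0)) (is_bernoulli_seq q)
    (ex_intro _ _ (bern_is_bernoulli_seq q Hq))).
Qed.

(** * Negapolygamma functions *)

(** The balanced negapolygamma functions, extended to [k = 0] where they give
    the digamma function. *)
Definition negapoly (k : nat) (q : R) : R :=
  / INR (fact k) * (- dzeta k q - harmonic k * bern k q).

Lemma harmonic_S (k : nat) : harmonic (S k) = harmonic k + / INR (S k).
Proof.
  unfold harmonic. rewrite sum_n_Sm by lia. reflexivity.
Qed.

Lemma negapoly_0 (q : R) : 0 < q -> negapoly 0 q = digamma q.
Proof.
  intros Hq. rewrite digamma_eq by exact Hq. unfold negapoly, harmonic.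
  rewrite sum_n_m_zero by lia. unfold zero; simpl. field.
Qed.

Lemma negapolygamma_eq (k : nat) (q : R) :
  0 < q -> negapolygamma (S k) q = negapoly (S k) q.
Proof.
  intros Hq. unfold negapolygamma, negapoly.
  rewrite A_fun_eq, bernoulli_poly_eq, harmonic_S by (try exact Hq; lia).
  replace (S k - 1)%nat with k by lia. unfold Rdiv. ring.
Qed.

(** The harmonic weights balance the two terms: the inhomogeneous [- bern k q] in the derivative of
    [dzeta (S k)] accounts exactly for [/ INR (S k)], by which [harmonic (S k)] exceeds
    [harmonic k]. *)
Lemma is_derive_negapoly (k : nat) (q : R) :
  0 < q -> is_derive (negapoly (S k)) q (negapoly k q).
Proof.
  intros Hq.
  assert (D1 := is_derive_dzeta k q Hq). assert (D2 := is_derive_bern k q Hq).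
  assert (P : 0 < INR (S k)) by (apply lt_0_INR; lia).
  assert (Q := INR_fact_neq_0 k).
  apply (is_derive_ext (fun x => (- / INR (fact (S k))) * dzeta (S k) x
    + (- / INR (fact (S k)) * harmonic (S k)) * bern (S k) x)).
  { intro x. unfold negapoly.
    Rring. }
  eapply is_derive_lin; [exact D1|exact D2|].
  unfold negapoly. rewrite harmonic_S, fact_simpl, mult_INR. field. lra.
Qed.

Lemma sum_n_telescope (U : nat -> R) (n : nat) :
  sum_n (fun j => U j - U (S j)) n = U 0%nat - U (S n).
Proof.
  induction n as [|n IH]; [rewrite sum_O; reflexivity|].
  rewrite sum_Sn, IH. unfold plus; simpl. ring.
Qed.

(** The [j]-th summand has derivative [U j - U (S j)]: differentiating [Psi] gives the first term,
    differentiating the power the second. The sum telescopes to [U 0]. *)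
Lemma is_derive_iterated_by_parts (Psi : nat -> R -> R) (n : nat) (a b q : R) :
  b <> 0 ->
  (forall k, is_derive (Psi (S k)) (a + b * q) (Psi k (a + b * q))) ->
  is_derive
    (fun x => INR (fact n) * sum_n (fun j => (-1) ^ j / (b ^ (j + 1) * INR (fact (n - j)))
                * x ^ (n - j) * Psi (j + 1)%nat (a + b * x)) n)
    q (q ^ n * Psi 0%nat (a + b * q)).
Proof.
  intros Hb HD.
  (* The cut-off matters at [j = S n]: there [n - j] truncates to 0 and the formula would not
     vanish, whereas the last power is constant and contributes 0. *)
  set (U := fun j => if le_lt_dec j n then
    (-1) ^ j / (b ^ j * INR (fact (n - j))) * q ^ (n - j) * Psi j (a + b * q) else 0).
  assert (E : q ^ n * Psi 0%nat (a + b * q) = INR (fact n) * sum_n (fun j => U j - U (S j)) n).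
  { rewrite sum_n_telescope. unfold U.
    destruct (le_lt_dec 0 n); [|lia]. destruct (le_lt_dec (S n) n); [lia|].
    rewrite Nat.sub_0_r. simpl. field. apply INR_fact_neq_0. }
  rewrite E.
  apply (is_derive_scal (fun x => sum_n (fun j => (-1) ^ j / (b ^ (j + 1) * INR (fact (n - j)))
                * x ^ (n - j) * Psi (j + 1)%nat (a + b * x)) n)).
  apply (is_derive_sum_n (V := R_NormedModule) (fun j x => (-1) ^ j / (b ^ (j + 1) * INR (fact (n - j)))
                * x ^ (n - j) * Psi (j + 1)%nat (a + b * x))).
  intros j Hj.
  replace (j + 1)%nat with (S j) by lia.
  assert (D := HD j).
  auto_derive; [exists (Psi j (a + b * q)); exact D|].
  replace (Derive (fun x => Psi (S j) x) (a + b * q)) with (Psi j (a + b * q))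
    by (symmetry; apply is_derive_unique, D).
  assert (Bj : b ^ j <> 0) by (apply pow_nonzero, Hb).
  unfold U. destruct (le_lt_dec j n) as [_|]; [|lia].
  destruct (le_lt_dec (S j) n) as [Hj'|Hj'].
  - replace (n - j)%nat with (S (n - S j)) by lia. rewrite Nat.pred_succ.
    rewrite fact_simpl, mult_INR.
    assert (F := INR_fact_neq_0 (n - S j)).
    assert (P : INR (S (n - S j)) <> 0) by (apply not_0_INR; lia).
    simpl ((-1) ^ S j). simpl (b ^ S j). simpl (q ^ S (n - S j)). field. tauto.
  - replace (n - j)%nat with 0%nat by lia. simpl. field. tauto.
Qed.

Theorem theorem4p3 :
  forall (n : nat) (a b : R) (l u : Rbar),
    b <> 0 ->
    (forall q : R, Rbar_lt l q -> Rbar_lt q u -> 0 < a + b * q) ->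
    forall q : R, Rbar_lt l q -> Rbar_lt q u ->
      is_derive
        (fun x : R =>
           INR (fact n) *
           sum_n (fun j : nat =>
             (-1) ^ j / (b ^ (j + 1) * INR (fact (n - j))) *
             x ^ (n - j) * negapolygamma (j + 1) (a + b * x)) n)
        q
        (q ^ n * digamma (a + b * q)).
Proof.
  intros n a b l u Hb Hpos q Hl Hu.
  assert (Hq := Hpos q Hl Hu).
  rewrite <- negapoly_0 by exact Hq.
  eapply is_derive_ext_loc;
    [|apply (is_derive_iterated_by_parts negapoly n a b q Hb);
      intro k; apply is_derive_negapoly, Hq].
  assert (Bp : 0 < Rabs b) by (apply Rabs_pos_lt, Hb).
  (* [negapolygamma] and [negapoly] are compared at positive arguments; within this radius of [q]
     the argument [a + b * y] stays positive. *)
  assert (Hd : 0 < (a + b * q) / Rabs b) by (apply Rdiv_lt_0_compat; assumption).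
  exists (mkposreal _ Hd). intros y Hy.
  apply R_ball in Hy; simpl in Hy.
  assert (Hy' : 0 < a + b * y).
  { apply (Rmult_lt_compat_l (Rabs b)) in Hy; [|exact Bp].
    replace (Rabs b * ((a + b * q) / Rabs b)) with (a + b * q) in Hy by (field; lra).
    rewrite <- Rabs_mult in Hy. apply Rabs_def2 in Hy.
    rewrite Rmult_minus_distr_l in Hy. lra. }
  apply (f_equal (Rmult (INR (fact n)))). apply sum_n_ext. intro j.
  rewrite Nat.add_1_r, negapolygamma_eq by exact Hy'. reflexivity.
Qed.
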